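(* Let $n\ge 2$, let $\delta\in(0,1)$, and let $M\subset\mathbb{S}^{n-1}$ be a closed subset satisfying $C_{\mathcal H}^{n-2+\delta}(M)>0$. Then for every $T>0$ there exists a constant $C_{obs}=C(T,n,\delta,M)>0$ such that for every $u_0\in L^2(\mathbb{S}^{n-1})$, $$\left\|e^{T\Delta_{\mathbb{S}^{n-1}}}u_0\right\|_{L^2(\mathbb{S}^{n-1})}\le C_{obs}\int_0^T\sup_{x\in M}\left|(e^{t\Delta_{\mathbb{S}^{n-1}}}u_0)(x)\right|dt.$$
   Context: $\mathbb{S}^{n-1}$ is the unit sphere in $\mathbb{R}^n$ with its standard metric, $\Delta_{\mathbb{S}^{n-1}}$ is its Laplace--Beltrami operator, and $e^{t\Delta_{\mathbb{S}^{n-1}}}$ is the heat semigroup, so that $u(t,\cdot)=e^{t\Delta_{\mathbb{S}^{n-1}}}u_0$ solves $\partial_tu-\Delta_{\mathbb{S}^{n-1}}u=0$ for $t>0$, $u(0,\cdot)=u_0$. For $\alpha>0$ and $E\subset\mathbb{R}^n$, the $\alpha$-Hausdorff content is $C_{\mathcal H}^\alpha(E)=\inf\{\sum_{j=1}^\infty d(B_j)^\alpha: E\subset\bigcup_{j=1}^\infty B_j\}$, where the $B_j\subset\mathbb{R}^n$ are open balls and $d(B_j)$ is the diameter of $B_j$. *)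

(* Defs.v *)
From HB Require Import structures.
From mathcomp Require Import all_boot all_order all_algebra.
From mathcomp Require Import all_classical all_reals all_analysis.
From mathcomp Require Import measurable_realfun.

Set Implicit Arguments.
Unset Strict Implicit.
Unset Printing Implicit Defensive.

Import Order.TTheory GRing.Theory Num.Theory.
Import numFieldNormedType.Exports.

Local Open Scope classical_set_scope.
Local Open Scope ring_scope.

(* The norm that the library puts on 'rV[R]_n is the sup norm; it induces the
   usual topology of R^n but not the Euclidean balls and sphere. *)
Definition enorm (R : realType) (n : nat) (x : 'rV[R]_n) : R :=
  Num.sqrt (\sum_(i < n) x ord0 i ^+ 2).

Definition eball (R : realType) (n : nat) (c : 'rV[R]_n) (r : R) :
  set 'rV[R]_n := [set x | enorm (x - c) < r].

Definition usphere (R : realType) (n : nat) : set 'rV[R]_n :=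
  [set x | enorm x = 1].
Arguments usphere R n : clear implicits.

(* y / |y|, extended by 0 at the origin. *)
Definition normalize (R : realType) (n : nat) (y : 'rV[R]_n) : 'rV[R]_n :=
  (enorm y)^-1 *: y.

Definition ediam (R : realType) (n : nat) (E : set 'rV[R]_n) : \bar R :=
  ereal_sup [set (enorm (xy.1 - xy.2))%:E | xy in E `*` E].

Definition hausdorff_content (R : realType) (n : nat) (alpha : R)
    (E : set 'rV[R]_n) : \bar R :=
  ereal_inf [set s : \bar R | exists (c : nat -> 'rV[R]_n) (r : nat -> R),
    [/\ forall j, 0 < r j,
        E `<=` \bigcup_j eball (c j) (r j) &
        s = (\sum_(0 <= j <oo) ediam (eball (c j) (r j)) `^ alpha)%E]].

(* Borel sigma-algebra of R^n, as the one generated by the coordinates. *)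
Definition rV_display : measure_display. Proof. exact: default_measure_display. Qed.

Section measurable_rV.
Context (R : realType) (n : nat).

Let coors : 'I_n -> 'rV[R]_n -> R := fun i x => x ord0 i.

Let rV_set0 : g_sigma_preimage coors set0.
Proof. exact: sigma_algebra0. Qed.

Let rV_setC A : g_sigma_preimage coors A -> g_sigma_preimage coors (~` A).
Proof. exact: sigma_algebraC. Qed.

Let rV_bigcup (F : _^nat) : (forall i, g_sigma_preimage coors (F i)) ->
  g_sigma_preimage coors (\bigcup_i (F i)).
Proof. exact: sigma_algebra_bigcup. Qed.

HB.instance Definition _ := @isMeasurable.Build rV_display
  'rV[R]_n (g_sigma_preimage coors) rV_set0 rV_setC rV_bigcup.

Lemma measurable_coord (i : 'I_n) :
  measurable_fun [set: 'rV[R]_n] (fun x => x ord0 i).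
Proof.
move=> _ Y mY; rewrite setTI; apply: sub_sigma_algebra => /=.
by rewrite -bigcup_seq/=; exists i; [rewrite /= mem_index_enum|exists Y; rewrite ?setTI].
Qed.

Lemma measurable_fun_rVP d (T : measurableType d) (f : T -> 'rV[R]_n) :
  (forall i, measurable_fun [set: T]
     (fun x => f x ord0 i)) -> measurable_fun [set: T] f.
Proof.
move=> mf.
apply: (@measurability _ _ _ _ _ _
  (\big[setU/set0]_(i < n) preimage_set_system setT (coors i) measurable)) => //.
move=> C [A]; rewrite -bigcup_seq => -[i _ [B mB <-]] <-.
by rewrite !setTI -comp_preimage; have := mf i measurableT B mB; rewrite setTI.
Qed.

End measurable_rV.

Section measurability.
Context (R : realType) (n : nat).

Lemma measurable_enorm : measurable_fun [set: 'rV[R]_n] (@enorm R n).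
Proof.
have msum : measurable_fun [set: 'rV[R]_n]
    (fun x => \sum_(i < n) x ord0 i ^+ 2).
  by apply: measurable_sum => i; apply: measurable_funX; exact: measurable_coord.
rewrite (_ : @enorm R n = (@powR R ^~ 2^-1) \o
    (fun x => \sum_(i < n) x ord0 i ^+ 2)).
  exact: (measurableT_comp (measurable_powR _) msum).
apply/funext => x; rewrite /= powR12_sqrt//.
by apply: sumr_ge0 => i _; exact: sqr_ge0.
Qed.

Lemma measurable_normalize :
  measurable_fun [set: 'rV[R]_n] (@normalize R n).
Proof.
apply: measurable_fun_rVP => i.
rewrite (_ : (fun x => _) =
    (fun x : 'rV[R]_n => (enorm x `^ (-1)) * x ord0 i)); last first.
  by apply/funext => x; rewrite mxE powR_inv1// sqrtr_ge0.
apply: measurable_funM; last exact: measurable_coord.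
exact: (measurableT_comp (measurable_powR _) measurable_enorm).
Qed.

Lemma measurable_ball1 : measurable (eball (0 : 'rV[R]_n) 1).
Proof.
rewrite (_ : eball _ _ = setT `&` @enorm R n @^-1` `]-oo, 1[%classic).
  exact: measurable_enorm.
by apply/seteqP; split => x; rewrite /eball/= subr0 in_itv/=; [move=>?; split|case].
Qed.

End measurability.

Section lebesgue_rV.
Context (R : realType).

Definition cons_rV (n : nat) (p : R * 'rV[R]_n) : 'rV[R]_n.+1 :=
  \row_j oapp (fun k => p.2 ord0 k) p.1 (unlift ord0 j).

Definition split_rV (n : nat) (x : 'rV[R]_n.+1) : R * 'rV[R]_n :=
  (x ord0 ord0, \row_k x ord0 (lift ord0 k)).

Lemma measurable_cons_rV n : measurable_fun setT (@cons_rV n).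
Proof.
apply: measurable_fun_rVP => i.
under eq_fun do rewrite mxE.
case: unliftP => [k _|_] /=; last exact: measurable_fst.
by apply: (measurableT_comp (measurable_coord k)); exact: measurable_snd.
Qed.

Lemma measurable_split_rV n : measurable_fun setT (@split_rV n).
Proof.
apply: measurable_fun_pair; first exact: measurable_coord.
apply: measurable_fun_rVP => i.
under eq_fun do rewrite mxE.
exact: measurable_coord.
Qed.

Lemma cons_rVK n : cancel (@cons_rV n) (@split_rV n).
Proof.
move=> [t x]; congr pair; first by rewrite mxE unlift_none.
by apply/rowP => k; rewrite !mxE liftK.
Qed.

Lemma split_rVK n : cancel (@split_rV n) (@cons_rV n).
Proof.
move=> x; apply/rowP => j; rewrite mxE.
by case: unliftP => [k ->|->] //=; rewrite mxE.
Qed.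

Section succ.
Context (n : nat) (mu : {sigma_finite_measure set 'rV[R]_n -> \bar R}).

Definition lebesgue_succ : set 'rV[R]_n.+1 -> \bar R :=
  pushforward (@lebesgue_measure R \x mu)%E (@cons_rV n).

HB.instance Definition _ := Measure.copy lebesgue_succ
  (measure_function_pushforward__canonical__measure_function_Measure
    (@lebesgue_measure R \x mu)%E (@measurable_cons_rV n)).

Let lebesgue_succ_sigma_finite : sigma_finite setT lebesgue_succ.
Proof.
have /sigma_finiteP[F [TF ndF Foo]] := sigma_finiteT (@lebesgue_measure R).
have /sigma_finiteP[G [TG ndG Goo]] := sigma_finiteT mu.
exists (fun k => @split_rV n @^-1` (F k `*` G k)).
  rewrite -preimage_bigcup -[LHS](preimage_setT (@split_rV n)); congr (_ @^-1` _).
  apply/seteqP; split => // -[t x] _.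
  have [i _ Fit] : (\bigcup_i F i) t by rewrite -TF.
  have [j _ Gjx] : (\bigcup_i G i) x by rewrite -TG.
  exists (maxn i j) => //; split => /=.
    by move: Fit; exact/subsetPset/ndF/leq_maxl.
  by move: Gjx; exact/subsetPset/ndG/leq_maxr.
move=> k; have [mF Fk] := Foo k; have [mG Gk] := Goo k; split.
  rewrite -[X in measurable X]setTI; apply: measurable_split_rV => //.
  exact: measurableX.
rewrite /lebesgue_succ /pushforward -comp_preimage.
rewrite (_ : _ \o _ = id) ?preimage_id; last first.
  by apply/funext => p /=; rewrite cons_rVK.
by rewrite product_measure1E// lte_mul_pinfty// ge0_fin_numE.
Qed.

HB.instance Definition _ := Measure_isSigmaFinite.Build _ _ _ lebesgue_succ
  lebesgue_succ_sigma_finite.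

End succ.

(* n-dimensional Lebesgue measure, as the n-fold product of the
   one-dimensional one. *)
Fixpoint lebesgue_rV (n : nat) : {sigma_finite_measure set 'rV[R]_n -> \bar R} :=
  match n with
  | 0 => dirac (0 : 'rV[R]_0)
  | k.+1 => lebesgue_succ (lebesgue_rV k)
  end.

End lebesgue_rV.

Section sphere_measure.
Context (R : realType) (n : nat).

(* Surface measure of the unit sphere in polar coordinates:
   sigma A = n * vol {y | 0 < |y| < 1, y / |y| \in A} for A in the sphere.
   It is a Borel measure on R^n giving mass 0 to the complement of the sphere,
   so that its L^2 space is L^2 of the sphere, represented by functions on R^n
   whose values off the sphere are irrelevant. *)
Definition cone_measure : set 'rV[R]_n -> \bar R :=
  pushforward (mrestr (lebesgue_rV R n) (@measurable_ball1 R n))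
    (@normalize R n).

HB.instance Definition _ := Measure.copy cone_measure
  (measure_function_pushforward__canonical__measure_function_Measure
    (mrestr (lebesgue_rV R n) (@measurable_ball1 R n))
    (@measurable_normalize R n)).

Definition sphere_measure : set 'rV[R]_n -> \bar R :=
  mscale n%:R%:nng cone_measure.

HB.instance Definition _ := Measure.on sphere_measure.

End sphere_measure.
Arguments sphere_measure R n : clear implicits.

Section heat_equation.
Context (R : realType) (n : nat).

Definition partial (i : 'I_n) (f : 'rV[R]_n -> R) : 'rV[R]_n -> R :=
  fun y => 'D_(delta_mx ord0 i) f y.

Definition laplacian (f : 'rV[R]_n -> R) : 'rV[R]_n -> R :=
  fun y => \sum_(i < n) partial i (partial i f) y.

(* The Laplace-Beltrami operator of the round sphere is the Euclidean Laplacian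
   of the extension f (y / |y|), which is constant along rays; only the values
   of f on the sphere enter. *)
Definition laplace_beltrami (f : 'rV[R]_n -> R) : 'rV[R]_n -> R :=
  laplacian (f \o @normalize R n).

(* u is C^1 in time and C^2 in space on ]0, +oo[ x S^{n-1}, again read on the
   extension of u (t, .) that is constant along rays. *)
Definition C12_sphere (u : R -> 'rV[R]_n -> R) : Prop :=
  let U t := u t \o @normalize R n in
  let D := [set p : R * 'rV[R]_n | 0 < p.1 /\ p.2 != 0] in
  [/\ {in D, forall p : R * 'rV[R]_n, derivable (fun s => U s p.2) p.1 1},
      {in D, forall p i, derivable (U p.1) p.2 (delta_mx ord0 i)},
      {in D, forall p i j,
        derivable (partial i (U p.1)) p.2 (delta_mx ord0 j)} &
      [/\ {in D, continuous (fun p => U p.1 p.2)},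
          {in D, continuous (fun p => derive1 (fun s => U s p.2) p.1)},
          forall i, {in D, continuous (fun p => partial i (U p.1) p.2)} &
          forall i j, {in D, continuous
            (fun p => partial j (partial i (U p.1)) p.2)}]].

(* u (t, .) = e^{t Delta} u0: u is the solution of the heat equation on the
   sphere with initial value u0, attained in L^2. *)
Definition heat_flow (u0 : 'rV[R]_n -> R) (u : R -> 'rV[R]_n -> R) : Prop :=
  [/\ forall t : R, 0 < t -> u t \in Lfun (sphere_measure R n) 2%:E,
      C12_sphere u,
      forall (t : R) (x : 'rV[R]_n), 0 < t -> usphere R n x ->
        derive1 (fun s => u s x) t - laplace_beltrami (u t) x = 0 &
      ('N[sphere_measure R n]_2%:E[EFin \o (u t \- u0)%R])%E
        @[t --> 0^'+] --> 0%E].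

End heat_equation.

(* Main.v *)
(* On [T/2, T] the flow is controlled through the sup norm alone, by the maximum
   principle.  A polynomial of degree N on the sphere satisfies a Remez
   inequality  sup_S |P| <= (q (N + 1))^(E (N + 1)) sup_M |P|:  in a
   stereographic chart, if |P| is small on a cell of a grid, then some iterated
   derivative of P is small on the boundary of the cell, so an induction on the
   dimension covers the sublevel sets of P by so few small balls that their
   (n - 2 + delta)-content is smaller than that of M.  By Stone-Weierstrass and
   the decomposition of polynomials into harmonic ones, the flow at a time s is
   uniformly close to a finite sum of spherical harmonics; a Bernstein argument
   with the maximum principle in the ball bounds the k-th component by
   C^k sup |u(s)|, and heat flow during r multiplies it by exp (- k (k + n - 2) r).
   With N modes observed during a time tau,
     sup |u(s + tau)| <= A_N sup_M |u(t)| + 2 A_N exp (- N^2 tau / 4) sup |u(s)|,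
   where A_N = exp (O (N log N)).  Since N log N = o(N^2 tau) for
   N ~ 4^j and tau ~ 2^-j, the telescoping argument of Lebeau and Robbiano along
   times decreasing to T/2 closes. *)
Require Import Defs.
From HB Require Import structures.
From mathcomp Require Import all_boot all_order all_algebra.
From mathcomp Require Import all_classical all_reals all_analysis.
From mathcomp Require Import measurable_realfun ring lra zify.
Import Order.TTheory GRing.Theory Num.Theory.
Import numFieldNormedType.Exports.
Local Open Scope classical_set_scope.
Local Open Scope ring_scope.

Set Implicit Arguments.
Unset Strict Implicit.
Unset Printing Implicit Defensive.

(** * Polynomials on a line *)

(** The Remez factor stays as small as exp (O (N log N)) because sublevel sets behave like sets of
    codimension one: at scale 1 / m they are covered by poly(N) m^(n-2) balls, so their (n - 2 +
    delta)-content is at most poly(N) m^(-delta), and a power m of N with exponent of order 1 /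
    delta suffices. Interpolation between points 1 / m apart then loses m^(O(N)). The obstacle in
    the induction on the dimension is that a piece of a sublevel set may hide inside a grid cell
    without meeting the hyperplanes to which the induction applies. Then the cell contains a
    critical point in direction 0, and the search passes to the next derivative; it ends because
    derivatives of order N + 1 vanish. The flow is never expanded in eigenfunctions. At the start of
    each time step the solution is replaced by a finite sum of harmonics up to an arbitrarily small
    error, the sum evolves explicitly, and the maximum principle keeps the error small. The bounds
    C^k on the components, useless at time s, become summable afterwards because the eigenvalues are
    quadratic in k. *)

Section one_variable.
Context (R : realType).
Implicit Types (p : {poly R}) (s : seq R).

Definition lagr s (a : R) : {poly R} :=
  \prod_(b <- rem a s) ((a - b)^-1 *: ('X - b%:P)).

Lemma lagr_id s a : uniq s -> (lagr s a).[a] = 1.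
Proof.
move=> us; rewrite horner_prod big_seq big1// => b.
rewrite mem_rem_uniq// => /andP[/= ba _].
by rewrite !hornerE mulVf// subr_eq0 eq_sym.
Qed.

Lemma size_lagr s a : (size (lagr s a) <= (size (rem a s)).+1)%N.
Proof.
rewrite /lagr; elim: (rem a s) => [|b t ih]; first by rewrite big_nil size_poly1.
rewrite big_cons (leq_trans (size_polyMleq _ _))//.
have : (size ((a - b)^-1 *: ('X - b%:P)) <= 2)%N.
  by rewrite (leq_trans (size_scale_leq _ _))// size_XsubC.
by move=> h; rewrite -!subn1 (leq_trans (leq_sub2r 1 (leq_add h ih)))// addnS subn1.
Qed.

Lemma lagr_interp s p : uniq s -> (size p <= size s)%N ->
  p = \sum_(a <- s) p.[a] *: lagr s a.
Proof.
move=> us ps; apply/eqP; rewrite -subr_eq0; apply/eqP.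
apply: (@roots_geq_poly_eq0 _ _ s) => //.
  apply/allP => b bs; rewrite rootE hornerD hornerN horner_sum.
  rewrite (bigD1_seq b)//= hornerZ lagr_id// mulr1.
  rewrite big_seq_cond big1 ?addr0 ?subrr// => a /andP[as_ ab].
  rewrite hornerZ /lagr horner_prod.
  have : b \in rem a s by rewrite mem_rem_uniq// inE eq_sym ab.
  move=> /perm_to_rem/(perm_big _) ->.
  by rewrite big_cons hornerZ hornerXsubC subrr /= mulr0 mul0r mulr0.
rewrite (leq_trans (size_polyD _ _))// size_polyN geq_max ps/=.
rewrite (leq_trans (size_sum _ _ _))//; apply/bigmax_leqP_seq => a as_ _.
rewrite (leq_trans (size_scale_leq _ _))// (leq_trans (size_lagr _ _))//.
by rewrite size_rem//; case: (s) as_.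
Qed.

(** Each factor of a Lagrange basis polynomial at [x] is at most 1 / [h]: numerators are differences
    of points of [0, 1], denominators are at least [h] in absolute value. There are [(size s).-1]
    factors and [size s] summands. *)
Lemma lagr_bound s p (h kappa x : R) : 0 < h ->
  pairwise (fun a b : R => h <= `|a - b|) s ->
  {in s, forall a : R, 0 <= a <= 1} -> (size p <= size s)%N ->
  {in s, forall a, `|p.[a]| <= kappa} -> 0 <= x <= 1 -> 0 <= kappa ->
  `|p.[x]| <= (size s)%:R * kappa * (h ^+ (size s).-1)^-1.
Proof.
move=> h0 sep s01 ps pk x01 k0.
(* [pairwise] compares an entry only with later ones; allowing equality makes the relation reflexive
   and symmetric, so that it holds for all pairs of entries. *)
have sep' a b : a \in s -> b \in s -> a != b -> h <= `|a - b|.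
  have rsym : symmetric (fun a b : R => (a == b) || (h <= `|a - b|)).
    by move=> u v /=; rewrite eq_sym distrC.
  have rrefl : reflexive (fun a b : R => (a == b) || (h <= `|a - b|)).
    by move=> u /=; rewrite eqxx.
  have := pairwise_all2rel rrefl rsym s.
  have -> : pairwise (fun a b : R => (a == b) || (h <= `|a - b|)) s.
    by apply: sub_pairwise sep => u v ->; rewrite orbT.
  move=> /esym/allrelP H as_ bs ab.
  by have := H a b as_ bs; rewrite (negPf ab).
have us : uniq s.
  by apply: (pairwise_uniq _ sep) => a; rewrite subrr normr0 leNgt h0.
rewrite {1}(lagr_interp us ps) horner_sum (le_trans (ler_norm_sum _ _ _))//.
rewrite [leRHS](_ : _ = \sum_(a <- s) (kappa * (h ^+ (size s).-1)^-1)); last first.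
  by rewrite big_const_seq count_predT iter_addr_0 -mulrA mulr_natl.
rewrite big_seq [leRHS]big_seq; apply: ler_sum => a as_.
rewrite hornerZ normrM ler_pM// ?pk// /lagr horner_prod normr_prod.
have -> : (size s).-1 = size (rem a s) by rewrite size_rem.
have : {subset rem a s <= [pred b | (b \in s) && (b != a)]}.
  by move=> b; rewrite mem_rem_uniq// !inE andbC.
elim: (rem a s) => [|b t ih] bt; first by rewrite big_nil expr0 invr1.
rewrite big_cons exprS invfM ler_pM//; last first.
  by apply: ih => c ct; apply: bt; rewrite inE ct orbT.
have /andP[bs ba] : b \in [pred b | (b \in s) && (b != a)].
  by apply: bt; rewrite mem_head.
rewrite !hornerE normrM normfV.
have hab := sep' a b as_ bs; rewrite eq_sym in hab.
have := hab ba => {}hab.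
have ab0 : 0 < `|a - b| by rewrite (lt_le_trans h0).
rewrite -[leRHS]mulr1 ler_pM//.
  by rewrite lef_pV2 ?posrE.
have /andP[b0 b1] := s01 b bs; move/andP: x01 => [x0 x1].
  by rewrite ler_norml; lra.
by apply: prodr_ge0 => *.
Qed.

Lemma poly_ivt0 p (a b : R) : a <= b -> p.[a] * p.[b] <= 0 ->
  exists2 c, a <= c <= b & p.[c] = 0.
Proof.
move=> ab pab.
have [||c] := @IVT _ (horner p) a b 0 ab.
- exact/continuous_subspaceT/continuous_horner.
- rewrite ge_min le_max; have [pa|pa] := lerP p.[a] 0 => /=.
    have [->|pa0] := eqVneq p.[a] 0; rewrite ?lexx//.
    have pa' : p.[a] < 0 by rewrite lt_neqAle pa0.
    by rewrite -[X in _ || X](ler_nM2l pa') mulr0 pab orbT.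
  by rewrite (ltW pa)/= andbT -(ler_pM2l pa) mulr0.
- by rewrite in_itv/= => cab pc; exists c.
Qed.

(** If there is no sign change, then up to sign [p] is positive at both ends and smaller at [z], so
    its minimum over the segment is attained at an interior point. *)
Lemma poly_crit p (a b z e : R) : a <= z <= b -> `|p.[z]| <= e ->
  e < `|p.[a]| -> e < `|p.[b]| ->
  p.[a] * p.[b] < 0 \/ exists2 c, a <= c <= b & p^`().[c] = 0.
Proof.
move=> azb pz pa pb; have [|pab] := ltP (p.[a] * p.[b]) 0; [by left|right].
wlog pa0 : p pz pa pb pab / 0 < p.[a].
  move=> H; have [|pa0] := ltP 0 p.[a]; first exact: H.
  have [||||//|c cab] := H (- p); rewrite ?hornerN ?normrN ?mulrNN//.
    rewrite oppr_gt0 lt_neqAle pa0 andbT; apply: contraTneq pa => ->.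
    by rewrite normr0 -leNgt (le_trans _ pz).
  by rewrite derivN hornerN => /eqP; rewrite oppr_eq0 => /eqP; exists c.
have e0 : 0 <= e by exact: le_trans pz.
have pb0 : 0 < p.[b].
  rewrite lt_neqAle; apply/andP; split.
    by apply: contraTneq pb => <-; rewrite normr0 -leNgt.
  by rewrite -(pmulr_rge0 _ pa0).
rewrite (gtr0_norm pa0) in pa; rewrite (gtr0_norm pb0) in pb.
have ab : a <= b by case/andP: azb => /le_trans; apply.
have [|c cab cmin] := @EVT_min _ (horner p) a b ab.
  exact/continuous_subspaceT/continuous_horner.
have pce : p.[c] <= e.
  by rewrite (le_trans (cmin z _)) ?in_itv//= (le_trans (ler_norm _)).
exists c; first by rewrite in_itv in cab.
have c_in : c \in `]a, b[.
  move: cab; rewrite !in_itv/= !le_eqVlt => /andP[/orP[/eqP ac|->] /orP[/eqP cb|->]] //.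
  - by move: pce; rewrite -ac leNgt pa.
  - by move: pce; rewrite -ac leNgt pa.
  - by move: pce; rewrite cb leNgt pb.
have := @derive1_at_min _ (horner p) a b c ab _ c_in.
have /[swap]/[apply] : forall t, t \in `]a, b[ -> p.[c] <= p.[t].
  by move=> t tab; apply: cmin; exact: subset_itv_oo_cc tab.
move=> H; have H2 : is_derive c 1 (horner p) 0.
  by apply: H => t _; exact: derivable_horner.
by rewrite derivE derive1E; rewrite (@derive_val _ _ _ _ _ _ _ H2).
Qed.

End one_variable.

(** * Functions that are polynomial in each variable separately *)

Section separate_polynomials.
Context (R : realType).
Implicit Types (d N : nat).

Definition upd d (x : 'I_d -> R) (i : 'I_d) (s : R) : 'I_d -> R :=
  fun j => if j == i then s else x j.

Definition ins d (i : 'I_d.+1) (c : R) (y : 'I_d -> R) : 'I_d.+1 -> R :=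
  fun j => oapp y c (unlift i j).

Lemma upd_eq d (x : 'I_d -> R) i s : upd x i s i = s.
Proof. by rewrite /upd eqxx. Qed.

Lemma upd_id d (x : 'I_d -> R) i : upd x i (x i) = x.
Proof. by apply/funext => j; rewrite /upd; case: eqVneq => [->|]. Qed.

Lemma updK d (x : 'I_d -> R) i s t : upd (upd x i s) i t = upd x i t.
Proof. by apply/funext => j; rewrite /upd; case: eqVneq. Qed.

Lemma updC d (x : 'I_d -> R) i j s t : i != j ->
  upd (upd x i s) j t = upd (upd x j t) i s.
Proof.
move=> ij; apply/funext => k; rewrite /upd.
by case: (eqVneq k j) => [->|//]; rewrite eq_sym (negPf ij).
Qed.

Lemma insK d (i : 'I_d.+1) (x : 'I_d.+1 -> R) :
  ins i (x i) (fun k => x (lift i k)) = x.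
Proof. by apply/funext => j; rewrite /ins; case: unliftP => [k ->|->]. Qed.

Lemma upd_ins d (i : 'I_d.+1) c (y : 'I_d -> R) k s :
  upd (ins i c y) (lift i k) s = ins i c (upd y k s).
Proof.
apply/funext => j; rewrite /upd /ins; case: unliftP => [l ->|->] /=.
  by rewrite (inj_eq lift_inj).
by rewrite (negPf (neq_lift _ _)).
Qed.

(** The degree is bounded in each variable and not in total: this survives freezing a variable and
    differentiating along an axis, it is what the stereographic charts produce, and all
    interpolation takes place on lines parallel to the axes. *)
Definition sep_poly N d (f : ('I_d -> R) -> R) :=
  forall i x, exists2 p : {poly R}, (size p <= N.+1)%N &
    forall s, f (upd x i s) = p.[s].

Lemma sep_poly_ins N d (f : ('I_d.+1 -> R) -> R) i c : sep_poly N f ->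
  sep_poly N (f \o ins i c).
Proof.
move=> Nf k x; have [p sp fp] := Nf (lift i k) (ins i c x).
by exists p => // s; rewrite /= -upd_ins.
Qed.

Lemma sep_polyZ N d (f : ('I_d -> R) -> R) c : sep_poly N f ->
  sep_poly N (fun x => c * f x).
Proof.
move=> Nf i x; have [p sp fp] := Nf i x; exists (c *: p).
  exact: leq_trans (size_scale_leq _ _) sp.
by move=> s; rewrite fp hornerZ.
Qed.

Lemma sep_polyD N d (f g : ('I_d -> R) -> R) : sep_poly N f -> sep_poly N g ->
  sep_poly N (fun x => f x + g x).
Proof.
move=> Nf Ng i x; have [p sp fp] := Nf i x; have [q sq gq] := Ng i x.
exists (p + q); first by rewrite (leq_trans (size_polyD _ _))// geq_max sp.
by move=> s; rewrite fp gq hornerD.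
Qed.

Lemma sep_polyM N K d (f g : ('I_d -> R) -> R) : sep_poly N f -> sep_poly K g ->
  sep_poly (N + K) (fun x => f x * g x).
Proof.
move=> Nf Ng i x; have [p sp fp] := Nf i x; have [q sq gq] := Ng i x.
exists (p * q); last by move=> s; rewrite fp gq hornerM.
rewrite (leq_trans (size_polyMleq _ _))//.
by rewrite -subn1 (leq_trans (leq_sub2r 1 (leq_add sp sq)))// addnS subn1.
Qed.

Lemma sep_poly_cst N d c : sep_poly N (fun _ : 'I_d -> R => c).
Proof.
move=> i x; exists c%:P; first by rewrite (leq_trans (size_polyC_leq1 _)).
by move=> s; rewrite hornerC.
Qed.

Lemma sep_poly_widen N K d (f : ('I_d -> R) -> R) : (N <= K)%N ->
  sep_poly N f -> sep_poly K f.
Proof.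
move=> NK Nf i x; have [p sp fp] := Nf i x.
by exists p => //; rewrite (leq_trans sp).
Qed.

Definition nodes N : seq R := [seq k%:R | k <- iota 0 N.+1].

Lemma nodes_uniq N : uniq (nodes N).
Proof. by rewrite map_inj_uniq ?iota_uniq//; exact: mulrIn. Qed.

Lemma size_nodes N : size (nodes N) = N.+1.
Proof. by rewrite size_map size_iota. Qed.

(* Interpolation makes the polynomial s |-> f (upd x i s) linear in f. *)
Definition line_poly N d (f : ('I_d -> R) -> R) i x : {poly R} :=
  \sum_(a <- nodes N) f (upd x i a) *: lagr (nodes N) a.

Lemma line_polyE N d (f : ('I_d -> R) -> R) i x s : sep_poly N f ->
  f (upd x i s) = (line_poly N f i x).[s].
Proof.
move=> Nf; have [p sp fp] := Nf i x; rewrite fp; congr (_.[_]).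
rewrite [LHS](@lagr_interp _ (nodes N))// ?nodes_uniq ?size_nodes//.
by apply: eq_bigr => a _; rewrite fp.
Qed.

Lemma size_line_poly N d (f : ('I_d -> R) -> R) i x :
  (size (line_poly N f i x) <= N.+1)%N.
Proof.
rewrite (leq_trans (size_sum _ _ _))//; apply/bigmax_leqP_seq => a as_ _.
rewrite (leq_trans (size_scale_leq _ _))// (leq_trans (size_lagr _ _))//.
by rewrite size_rem// size_nodes.
Qed.

Lemma line_poly_upd N d (f : ('I_d -> R) -> R) i x s :
  line_poly N f i (upd x i s) = line_poly N f i x.
Proof. by apply: eq_bigr => a _; rewrite updK. Qed.

Definition dline N k d (f : ('I_d.+1 -> R) -> R) x : R :=
  (line_poly N f ord0 x)^`(k).[x ord0].

Lemma dline_upd N k d (f : ('I_d.+1 -> R) -> R) x s :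
  dline N k f (upd x ord0 s) = (line_poly N f ord0 x)^`(k).[s].
Proof. by rewrite /dline line_poly_upd upd_eq. Qed.

Lemma dline0 N d (f : ('I_d.+1 -> R) -> R) : sep_poly N f -> dline N 0 f = f.
Proof.
move=> Nf; apply/funext => x.
by rewrite /dline derivn0 -line_polyE// upd_id.
Qed.

Lemma size_derivn (p : {poly R}) k : (size p^`(k) <= size p)%N.
Proof.
elim: k => [|k ih]; first by rewrite derivn0.
rewrite derivnS; have [->|p0] := eqVneq p^`(k) 0.
  by rewrite deriv0 size_poly0.
by rewrite (leq_trans (ltnW (lt_size_deriv p0))).
Qed.

Lemma dline_eq0 N d (f : ('I_d.+1 -> R) -> R) x : dline N N.+1 f x = 0.
Proof. by rewrite /dline derivn_poly0 ?horner0// size_line_poly. Qed.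

(** Along direction 0 this is a derivative of a polynomial. Along any other direction, interpolation
    writes the derivative as a combination of the values of [f] at the nodes, with coefficients that
    do not depend on the moving variable. *)
Lemma sep_poly_dline N k d (f : ('I_d.+1 -> R) -> R) : sep_poly N f ->
  sep_poly N (dline N k f).
Proof.
move=> Nf i x; have [->|i0] := eqVneq i ord0.
  exists (line_poly N f ord0 x)^`(k); last by move=> s; rewrite dline_upd.
  by rewrite (leq_trans (size_derivn _ _))// size_line_poly.
exists (\sum_(a <- nodes N) (lagr (nodes N) a)^`(k).[x ord0] *:
          line_poly N f i (upd x ord0 a)).
  rewrite (leq_trans (size_sum _ _ _))//; apply/bigmax_leqP_seq => a as_ _.
  by rewrite (leq_trans (size_scale_leq _ _))// size_line_poly.
move=> s; rewrite /dline [line_poly N f ord0 _]/line_poly raddf_sum/= !horner_sum.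
have -> : upd x i s ord0 = x ord0 by rewrite /upd eq_sym (negPf i0).
apply: eq_bigr => a _; rewrite derivnZ !hornerZ mulrC; congr (_ * _).
by rewrite updC// -line_polyE.
Qed.

End separate_polynomials.

(** * Small values of a polynomial in a grid cell *)

Section cells.
Context (R : realType).

Definition cell d (a : 'I_d -> R) (h : R) : set ('I_d -> R) :=
  [set x | forall i, a i <= x i <= a i + h].

Definition cell_bd d (a : 'I_d -> R) (h : R) : set ('I_d -> R) :=
  [set x | cell a h x /\ exists i, x i = a i \/ x i = a i + h].

Lemma cell_upd d (a : 'I_d -> R) h x i s :
  cell a h x -> a i <= s <= a i + h -> cell a h (upd x i s).
Proof. by move=> ax s01 j; rewrite /upd; case: eqVneq => [->|_]. Qed.

(* If |g| > e on the boundary of the cell then g has constant sign there, since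
   the two faces x_0 = a_0 and x_0 = a_0 + h are joined by a boundary path; so
   Rolle's theorem applies along the line through z in direction 0. *)
Lemma cell_crit N d (a : 'I_d.+2 -> R) h (g g' : ('I_d.+2 -> R) -> R) e z :
  0 <= h -> sep_poly N g ->
  (forall x, exists p : {poly R},
     forall s, g (upd x ord0 s) = p.[s] /\ g' (upd x ord0 s) = p^`().[s]) ->
  cell a h z -> `|g z| <= e ->
  (exists2 w, cell_bd a h w & `|g w| <= e) \/ (exists2 w, cell a h w & g' w = 0).
Proof.
move=> h0 Ng gg' az gz; apply/or_asboolP.
have [//|/asboolPn nb] := boolP `[< exists2 w, cell_bd a h w & `|g w| <= e >].
have bd w : cell_bd a h w -> e < `|g w|.
  by move=> bw; rewrite ltNge; apply/negP => gw; apply: nb; exists w.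
have e0 : 0 <= e by exact: le_trans gz.
rewrite orFb; apply/asboolP.
have [p Hp] := gg' z.
have lo i : a i <= a i <= a i + h by rewrite lexx lerDl.
have hi i : a i <= a i + h <= a i + h by rewrite lexx andbT lerDl.
(* A second direction, available from dimension two on. In each face orthogonal to direction 0 one
   moves along it to the face [x i1 = a i1], and inside that face one crosses in direction 0. *)
pose i1 : 'I_d.+2 := lift ord0 ord0.
have seg x i : cell a h x -> (exists2 j, j != i & x j = a j \/ x j = a j + h) ->
    0 < g (upd x i (a i)) * g (upd x i (a i + h)).
  move=> ax [j ji xj]; rewrite ltNge; apply/negP => neg.
  have [q sq Hq] := Ng i x; rewrite !Hq in neg.
  have [|c ac qc] := poly_ivt0 _ neg; first by rewrite lerDl.
  have : e < `|g (upd x i c)|.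
    apply: bd; split; first exact: cell_upd.
    by exists j; rewrite /upd (negPf ji).
  by rewrite Hq qc normr0 ltNge e0.
have [||||pab|[c ac pc]] := @poly_crit _ p (a ord0) (a ord0 + h) (z ord0) e.
- exact: az.
- by have [<- _] := Hp (z ord0); rewrite upd_id.
- have [<- _] := Hp (a ord0); apply: bd; split; first exact: cell_upd.
  by exists ord0; left; rewrite upd_eq.
- have [<- _] := Hp (a ord0 + h); apply: bd; split; first exact: cell_upd.
  by exists ord0; right; rewrite upd_eq.
- pose A := upd z ord0 (a ord0); pose B := upd z ord0 (a ord0 + h).
  have cA : cell a h A by exact: cell_upd.
  have cB : cell a h B by exact: cell_upd.
  have seg2 x s : cell a h x -> (exists2 j, j != i1 & x j = a j \/ x j = a j + h) ->
      a i1 <= s <= a i1 + h -> 0 < g x * g (upd x i1 s).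
    move=> ax xj s01; rewrite ltNge; apply/negP => neg.
    have [q sq Hq] := Ng i1 x.
    rewrite Hq -{1}(upd_id x i1) Hq in neg.
    have [c ac qc] : exists2 c, a i1 <= c <= a i1 + h & q.[c] = 0.
      have /andP[s0 s1] := s01; have /andP[x0 x1] := ax i1.
      have [xs|/ltW xs] := leP (x i1) s.
        have [c /andP[c0 c1] qc] := poly_ivt0 xs neg; exists c => //.
        by rewrite (le_trans x0)// (le_trans c1).
      rewrite mulrC in neg.
      have [c /andP[c0 c1] qc] := poly_ivt0 xs neg; exists c => //.
      by rewrite (le_trans s0)// (le_trans c1).
    have : e < `|g (upd x i1 c)|.
      have [j ji xj'] := xj.
      apply: bd; split; first exact: cell_upd.
      by exists j; rewrite /upd (negPf ji).
    by rewrite Hq qc normr0 ltNge e0.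
  have A1 : 0 < g A * g (upd A i1 (a i1)).
    by apply: seg2 => //; exists ord0 => //; left; rewrite /A upd_eq.
  have B1 : 0 < g B * g (upd B i1 (a i1)).
    by apply: seg2 => //; exists ord0 => //; right; rewrite /B upd_eq.
  have AB : 0 < g (upd A i1 (a i1)) * g (upd B i1 (a i1)).
    rewrite /A /B !(@updC _ _ _ ord0 i1)//; apply: seg.
      exact: cell_upd.
    by exists i1 => //; left; rewrite upd_eq.
  have gAB : g A * g B < 0.
    by have [-> _] := Hp (a ord0); have [-> _] := Hp (a ord0 + h).
  move: (g A) (g B) (g (upd A i1 (a i1))) (g (upd B i1 (a i1))) A1 B1 AB gAB.
  move=> u v u' v' A1 B1 AB gAB.
  have := mulr_gt0 (mulr_gt0 A1 B1) AB.
  rewrite (_ : u * u' * (v * v') * (u' * v') = (u * v) * (u' * v') ^+ 2); last by ring.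
  by rewrite nmulr_rgt0// ltNge sqr_ge0.
- exists (upd z ord0 c); first exact: cell_upd.
  by have [_ ->] := Hp c.
Qed.

End cells.

(** * Coverings of sublevel sets of polynomials *)

Section covers.
Context (R : realType).

Definition ucube d : set ('I_d -> R) := [set x | forall i, 0 <= x i <= 1].
Arguments ucube : clear implicits.

Definition covers d (r : R) (E : set ('I_d -> R)) (n : nat) :=
  exists L : nat -> 'I_d -> R, forall z, E z ->
    exists2 k, (k < n)%N & forall i, `|z i - L k i| <= r.

Lemma covers_sub d (r r' : R) (E F : set ('I_d -> R)) n n' :
  covers r E n -> F `<=` E -> r <= r' -> (n <= n')%N -> covers r' F n'.
Proof.
move=> [L HL] FE rr' nn'; exists L => z /FE/HL[k kn zL].
exists k; first exact: leq_trans nn'.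
by move=> i; exact: le_trans rr'.
Qed.

Lemma covers0 d (r : R) (E : set ('I_d -> R)) n : E `<=` set0 -> covers r E n.
Proof. by move=> E0; exists (fun=> fun=> 0) => z /E0. Qed.

Lemma coversU d (r : R) (E F : set ('I_d -> R)) n m :
  covers r E n -> covers r F m -> covers r (E `|` F) (n + m).
Proof.
move=> [L HL] [L' HL']; exists (fun k => if (k < n)%N then L k else L' (k - n)%N).
move=> z [/HL|/HL'] [k kn zL].
  by exists k; [exact: ltn_addr|rewrite kn].
exists (n + k)%N; first by rewrite ltn_add2l.
by move=> i; rewrite ltnNge leq_addr/= addKn.
Qed.

Lemma covers_bigcup d (r : R) (I : eqType) (s : seq I) (E : I -> set ('I_d -> R))
    (n : I -> nat) : (forall i, i \in s -> covers r (E i) (n i)) ->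
  covers r [set z | exists2 i, i \in s & E i z] (\sum_(i <- s) n i)%N.
Proof.
elim: s => [|i s ih] H; first by apply: covers0 => z [].
rewrite big_cons; apply: covers_sub (coversU (H i _) (ih _)) _ (lexx r) (leqnn _).
- by rewrite mem_head.
- by move=> j js; apply: H; rewrite inE js orbT.
- move=> z [j]; rewrite inE => /orP[/eqP ->|js] Ej; first by left.
  by right; exists j.
Qed.

Lemma covers_ins d (r : R) (E : set ('I_d -> R)) n i c : covers r E n ->
  covers r [set x : 'I_d.+1 -> R |
    `|x i - c| <= r /\ E (fun k => x (lift i k))] n.
Proof.
move=> [L HL]; exists (fun k => ins i c (L k)) => x [xc /HL[k kn xL]].
exists k => // j; rewrite /ins; case: unliftP => [l ->|->] //=.
Qed.

Lemma grid_near (m : nat) (s : R) : (0 < m)%N -> 0 <= s <= 1 ->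
  exists2 j, (j < m)%N & j%:R / m%:R <= s <= j%:R / m%:R + m%:R^-1.
Proof.
move=> m0 /andP[s0 s1].
have m0R : 0 < m%:R :> R by rewrite ltr0n.
suff H k : (0 < k)%N -> s <= k%:R / m%:R ->
    exists2 j, (j < k)%N & j%:R / m%:R <= s <= j%:R / m%:R + m%:R^-1.
  by apply: H; rewrite ?divff ?gt_eqF.
elim: k => // k ih _ sk.
have [ks|/ltW ks] := leP (k%:R / m%:R) s.
  by exists k => //; rewrite ks/= (le_trans sk)// -natr1 mulrDl mul1r.
have [k0|k0] := posnP k.
  exists 0%N => //; rewrite mul0r add0r s0/= (le_trans ks)// k0 mul0r.
  by rewrite invr_ge0 ltW.
by have [j jk js] := ih k0 ks; exists j => //; exact: ltnW.
Qed.

Lemma covers_ucube d (m : nat) : (0 < m)%N ->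
  covers m%:R^-1 (ucube d) (m.+1 ^ d)%N.
Proof.
move=> m0; elim: d => [|d ih].
  by exists (fun=> fun=> 0) => z _; exists 0%N => // -[].
rewrite expnS -[X in (X * _)%N](size_iota 0) -sum1_size big_distrl/=.
apply: covers_sub (covers_bigcup (s := iota 0 m.+1) (n := fun=> _)
  (fun j _ => @covers_ins _ _ _ _ ord0 (j%:R / m%:R) ih)) _ (lexx _) _; last first.
  by apply: leq_sum => j _; rewrite mul1n.
move=> z Qz; have [j jm /andP[zj1 zj2]] := grid_near m0 (Qz ord0).
exists j; first by rewrite mem_iota/= add0n ltnW.
split; last by move=> i; exact: Qz.
by rewrite ger0_norm ?subr_ge0// lerBlDl.
Qed.

(** Greedy choice: an [h]-separated family in [Z] that cannot be extended is already an [h]-net of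
    [Z]. *)
Lemma separated_or_cover (Z : set R) (h : R) (k : nat) :
  (exists s : seq R, [/\ size s = k, pairwise (fun a b : R => h <= `|a - b|) s &
     {in s, forall a, Z a}]) \/
  exists2 s : seq R, (size s < k)%N &
    forall z, Z z -> exists2 a, a \in s & `|z - a| < h.
Proof.
elim: k => [|k [[s [sk sep sZ]]|[s sk sZ]]]; first by left; exists [::].
- have [H|] := pselect (forall z, Z z -> exists2 a, a \in s & `|z - a| < h).
    by right; exists s; rewrite ?sk.
  move=> /existsNP[z /not_implyP[Zz Hz]]; left; exists (z :: s); split => /=.
  + by rewrite sk.
  + rewrite sep andbT; apply/allP => a as_; rewrite leNgt; apply/negP => za.
    by apply: Hz; exists a.
  + by move=> a; rewrite inE => /orP[/eqP ->//|/sZ].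
- by right; exists s => //; exact: ltnW.
Qed.

End covers.
Arguments ucube : clear implicits.

(** * Covering sublevel sets by induction on the dimension *)

Section sublevel.
Context (R : realType) (N m : nat) (m0 : (0 < m)%N).

Let h : R := m%:R^-1.
(** The inverse of twice the loss in [lagr_bound] for N + 1 nodes at mutual distance [h]: values at
    most [remez_kappa] times b at the nodes give at most b / 2 on [0, 1]. *)
Definition remez_kappa : R := h ^+ N / (2 * N.+1%:R).
Let kappa := remez_kappa.
(** The extra factor 2 pays for the one lost in [descend]. *)
Let rho : R := kappa / 2.

(** In the step, [N.+1] counts the orders of differentiation and [d.+1] the directions of the grid
    hyperplanes. For each order and direction at most [N] hyperplanes are covered entirely; the
    induction hypothesis handles the others. *)
Fixpoint remez_count (d : nat) : nat :=
  if d is d'.+1 then (N.+1 * d.+1 * (remez_count d' + N))%N else N.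

Let h0 : 0 < h. Proof. by rewrite invr_gt0 ltr0n. Qed.
Let h1 : h <= 1. Proof. by rewrite invf_le1 ?ltr0n// ler1n. Qed.
Let kappa0 : 0 < kappa.
Proof. by rewrite divr_gt0 ?exprn_gt0// mulr_gt0. Qed.
Let rho0 : 0 < rho. Proof. by rewrite divr_gt0. Qed.
Lemma small_at_nodes s (p : {poly R}) (b x : R) : 0 < b ->
  pairwise (fun a b : R => h <= `|a - b|) s ->
  {in s, forall a : R, 0 <= a <= 1} -> size s = N.+1 -> (size p <= N.+1)%N ->
  {in s, forall a, `|p.[a]| <= kappa * b} -> 0 <= x <= 1 -> `|p.[x]| < b.
Proof.
move=> b0 sep s01 sN pN pk x01.
have := lagr_bound h0 sep s01 _ pk x01 (ltW (mulr_gt0 kappa0 b0)).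
rewrite sN/= => /(_ pN)/le_lt_trans; apply.
rewrite /kappa /remez_kappa.
rewrite (_ : _ * _ = b / 2); first by rewrite ltr_pdivrMr// ltr_pMr// ltr1n.
by field; rewrite expf_neq0 ?gt_eqF//= nat1r pnatr_eq0.
Qed.

(** N + 1 points of the sublevel set at mutual distance [h] would, by interpolation, contradict the
    point where |f| reaches 1; so a net of at most N points exists. *)
Lemma cover_sublevel1 (f : ('I_1 -> R) -> R) : sep_poly N f ->
  (exists2 x, ucube R 1 x & 1 <= `|f x|) ->
  covers h [set x | ucube R 1 x /\ `|f x| <= kappa] N.
Proof.
move=> Nf [x Qx fx].
have [p sp fp] := Nf ord0 x.
have fE y : f y = p.[y ord0].
  rewrite -fp; congr (f _); apply/funext => i.
  by rewrite /upd (ord1 i) eqxx.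
have [[s [sk sep sZ]]|[s sk sZ]] := separated_or_cover
    [set t : R | 0 <= t <= 1 /\ `|p.[t]| <= kappa] h N.+1.
  have : `|p.[x ord0]| < 1.
    apply: (@small_at_nodes s) => //.
    - by move=> a /sZ[].
    - by rewrite mulr1 => a /sZ[].
  by rewrite -fE ltNge fx.
exists (fun k => fun=> nth 0 s k) => z [Qz fz].
have [|a as_ za] := sZ (z ord0); first by split; [exact: Qz|rewrite -fE].
exists (index a s); first by rewrite ltnS in sk; rewrite (leq_trans _ sk)// index_mem.
by move=> i; rewrite (ord1 i) nth_index// ltW.
Qed.

Section step.
Context (d : nat) (f : ('I_d.+2 -> R) -> R) (Nf : sep_poly N f).
Hypothesis f1 : exists2 x, ucube R d.+2 x & 1 <= `|f x|.
Variable B : nat.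
Hypothesis IH : forall g : ('I_d.+1 -> R) -> R, sep_poly N g ->
  (exists2 x, ucube R d.+1 x & 1 <= `|g x|) ->
  covers (d.+1%:R * h) [set x | ucube R d.+1 x /\ `|g x| <= rho ^+ d.+1]
    (B * m.+1 ^ d)%N.

Let eta : R := rho ^+ d.+2.
Let eta0 : 0 < eta. Proof. exact: exprn_gt0. Qed.
Let F k := dline N k f.
Let big k := exists2 x, ucube R d.+2 x & eta ^+ k <= `|F k x|.

(** [K.+1] is the first order whose derivative stays below its threshold [eta ^+ K.+1] on the whole
    cube; there is one because derivatives of order [N.+1] vanish. *)
Let stop : exists2 K, (K <= N)%N &
  ~ big K.+1 /\ forall k, (k <= K)%N -> big k.
Proof.
have exK : exists k, `[< ~ big k.+1 >].
  exists N; apply/asboolP => -[x _]; rewrite /F dline_eq0 normr0 leNgt.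
  by rewrite exprn_gt0.
have [K /asboolP HK Kmin] := ex_minnP exK.
exists K.
  apply: Kmin; apply/asboolP => -[x _]; rewrite /F dline_eq0 normr0 leNgt.
  by rewrite exprn_gt0.
split => // -[_|k kK]; first by rewrite /big expr0 /F dline0.
have [//|nb] := pselect (big k.+1).
by have := Kmin k; rewrite leqNgt kK => /(_ (asboolT nb)).
Qed.

Let cell_ucube (j : 'I_d.+2 -> nat) : (forall i, (j i < m)%N) ->
  cell (fun i => (j i)%:R / m%:R) h `<=` ucube R d.+2.
Proof.
move=> jm x jx i; have /andP[x0 x1] := jx i.
rewrite (le_trans _ x0) ?divr_ge0//= (le_trans x1)//.
rewrite -[X in _ + X]mul1r -mulrDl natr1 ler_pdivrMr ?ltr0n// mul1r ler_nat.
exact: jm.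
Qed.

(** Each use of [cell_crit] leads from a small value of [F k] in the cell either to its boundary or
    to a zero of [F k.+1]. If order [K] is reached inside the cell, then [F K.+1] is small
    throughout it, and moving in direction 0 to a face at most doubles the bound. *)
Let descend (K : nat) (a : 'I_d.+2 -> R) z : ~ big K.+1 ->
  cell a h `<=` ucube R d.+2 -> cell a h z -> `|f z| <= eta ->
  exists2 k, (k <= K)%N &
    exists2 w, cell_bd a h w & `|F k w| <= 2 * eta * eta ^+ k.
Proof.
move=> bK aQ az fz.
have step k : (k <= K)%N ->
    (exists2 k', (k' < k)%N &
      exists2 w, cell_bd a h w & `|F k' w| <= eta * eta ^+ k') \/
    exists2 w, cell a h w & `|F k w| <= eta * eta ^+ k.
  elim: k => [_|k ih kK].
    by right; exists z => //; rewrite /F dline0// expr0 mulr1.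
  have [[k' k'k Hk']|[w aw Fw]] := ih (ltnW kK).
    by left; exists k' => //; exact: ltnW.
  have [|||[v av Fv]|[v av Fv]] := @cell_crit _ N _ a h (F k) (F k.+1) _ w _ _ _ aw Fw.
  - exact: ltW.
  - exact: sep_poly_dline.
  - move=> x; exists (line_poly N f ord0 x)^`(k) => s.
    by rewrite /F !dline_upd derivnS.
  - by left; exists k => //; exists v.
  - by right; exists v => //; rewrite Fv normr0 mulr_ge0 ?exprn_ge0 ?ltW.
have [[k' k'k [w aw Fw]]|[w aw Fw]] := step K (leqnn _).
  exists k'; first exact: ltnW.
  exists w => //; rewrite (le_trans Fw)// ler_pM2r ?exprn_gt0//.
  by rewrite ler_peMl ?ler1n// ltW.
exists K => //.
pose s := a ord0; have s01 : a ord0 <= s <= a ord0 + h by rewrite lexx lerDl ltW.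
exists (upd w ord0 s); first split; first exact: cell_upd.
  by exists ord0; left; rewrite upd_eq.
have dF x : cell a h x -> `|F K.+1 x| <= eta * eta ^+ K.
  move=> ax; rewrite -exprS leNgt; apply/negP => Fx; apply: bK; exists x.
    exact: aQ.
  exact: ltW.
pose p := (line_poly N f ord0 w)^`(K).
have pE t : F K (upd w ord0 t) = p.[t] by rewrite /F dline_upd.
have dpE t : F K.+1 (upd w ord0 t) = p^`().[t] by rewrite /F dline_upd derivnS.
have /andP[sw1 sw2] := aw ord0.
have [//||c] := @MVT_segment _ (horner p) (horner p^`()) s (w ord0).
  exact/continuous_subspaceT/continuous_horner.
rewrite in_itv/= => /andP[c0 c1] pw.
have {}pw : p.[s] = p.[w ord0] - p^`().[c] * (w ord0 - s) by rewrite -pw subKr.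
rewrite pE pw (le_trans (ler_normB _ _))//.
rewrite (_ : 2 * eta * _ = eta * eta ^+ K + eta * eta ^+ K * 1); last by ring.
rewrite lerD//.
rewrite normrM ler_pM//.
  rewrite -dpE dF//; apply: cell_upd => //.
  by rewrite c0 (le_trans c1).
rewrite ger0_norm ?subr_ge0// lerBlDl (le_trans sw2)// lerD2l.
exact: h1.
Qed.

(* The grid hyperplanes to which the induction hypothesis does not apply; by
   Lagrange interpolation there are at most N of them for each k and i. *)
Let bad k (i : 'I_d.+2) (j : nat) : bool := `[< forall w, ucube R d.+2 w ->
  w i = j%:R / m%:R -> `|F k w| <= kappa * eta ^+ k >].

Let badE k i : big k -> (\sum_(0 <= j < m.+1) bad k i j <= N)%N.
Proof.
move=> [x Qx Fx]; rewrite leqNgt; apply/negP => Nb.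
pose s : seq R := take N.+1 [seq j%:R / m%:R | j <- index_iota 0 m.+1 & bad k i j].
have [p sp pF] := sep_poly_dline k Nf i x.
have sE : size s = N.+1.
  rewrite size_take_min size_map size_filter; apply/minn_idPl.
  by rewrite -sum1_count big_mkcond/= (leq_trans Nb)// leq_sum// => j _; case: bad.
have ss a : a \in s -> exists2 j, (j <= m)%N & bad k i j /\ a = j%:R / m%:R.
  move=> /mem_take/mapP[j]; rewrite mem_filter mem_index_iota/= ltnS.
  by move=> /andP[bj jm] ->; exists j.
have : `|p.[x i]| < eta ^+ k.
  apply: (@small_at_nodes s) => //.
  - by rewrite exprn_gt0.
  - apply: (subseq_pairwise (take_subseq _ _)).
    rewrite pairwise_map; apply: pairwise_filter.
    have : pairwise ltn (index_iota 0 m.+1).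
      by rewrite -sorted_pairwise ?iota_ltn_sorted//; exact: ltn_trans.
    apply: sub_pairwise => u v /= uv.
    rewrite -mulrBl normrM (ger0_norm (ltW h0)) -[leLHS]mul1r.
    rewrite ler_pM2r// distrC -natrB 1?ltnW// ger0_norm//.
    by rewrite ler1n subn_gt0.
  - move=> a /ss[j jm [_ ->]]; rewrite divr_ge0//= ler_pdivrMr ?ltr0n//.
    by rewrite mul1r ler_nat.
  - move=> a /ss[j jm [/asboolP bj aE]]; rewrite -pF; apply: bj.
      move=> l; rewrite /upd; case: eqVneq => // _.
      rewrite aE divr_ge0//= ler_pdivrMr ?ltr0n//.
      by rewrite mul1r ler_nat.
    by rewrite upd_eq.
by rewrite -pF upd_id ltNge Fx.
Qed.

(** Every point of the sublevel set is within [h] of a point of a grid hyperplane where some [F k]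
    is small. If the hyperplane is not bad, [F k] exceeds [kappa * eta ^+ k] somewhere on it; after
    division by this number the induction hypothesis applies, because
    [2 * eta = kappa * rho ^+ d.+1]. *)
Lemma cover_sublevel_step :
  covers (d.+2%:R * h) [set x | ucube R d.+2 x /\ `|f x| <= rho ^+ d.+2]
    (N.+1 * d.+2 * (B + N) * m.+1 ^ d.+1)%N.
Proof.
have [K KN [bK bigK]] := stop.
pose E k (i : 'I_d.+2) j : set ('I_d.+2 -> R) := [set z | ucube R d.+2 z /\
  exists w, [/\ forall l, `|z l - w l| <= h, ucube R d.+2 w,
    w i = j%:R / m%:R & `|F k w| <= 2 * eta * eta ^+ k]].
pose c k i j := (B * m.+1 ^ d + bad k i j * m.+1 ^ d.+1)%N.
have covE k i j : (k <= K)%N -> covers (d.+2%:R * h) (E k i j) (c k i j).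
  move=> kK; rewrite /c; have [bj|/asboolPn] := boolP (bad k i j).
    rewrite mul1n; apply: covers_sub (covers_ins i (j%:R / m%:R) (covers_ucube R d.+1 m0)) _ _ _.
    - move=> z [Qz [w [zw Qw wi _]]]; split; first by rewrite -wi zw.
      by move=> l; exact: Qz.
    - by rewrite -[leLHS]mul1r ler_pM2r// ler1n.
    - exact: leq_addl.
  move=> /existsNP[v /not_implyP[Qv /not_implyP[vi /negP]]].
  rewrite -ltNge => Fv; rewrite addn0.
  have ke0 : 0 < kappa * eta ^+ k by rewrite mulr_gt0// exprn_gt0.
  pose g y := (kappa * eta ^+ k)^-1 * F k (ins i (j%:R / m%:R) y).
  have Ng : sep_poly N g.
    exact/sep_polyZ/(sep_poly_ins i _ (sep_poly_dline k Nf)).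
  have [|L HL] := IH Ng.
    exists (fun l => v (lift i l)); first by move=> l; exact: Qv.
    rewrite /g -vi insK normrM normfV (gtr0_norm ke0).
    by rewrite ler_pdivlMl// mulr1 ltW.
  exists (fun k => ins i (j%:R / m%:R) (L k)) => z [Qz [w [zw Qw wi Fw]]].
  have [|q qn Lq] := HL (fun l => w (lift i l)); first split.
    - by move=> l; exact: Qw.
    - rewrite /g -wi insK normrM normfV (gtr0_norm ke0) ler_pdivrMl//.
      rewrite (le_trans Fw)// le_eqVlt; apply/orP; left; apply/eqP.
      by rewrite /eta /rho !exprS; field.
  exists q => // l; rewrite (_ : z l - _ =
    (z l - w l) + (w l - ins i (j%:R / m%:R) (L q) l)); last by ring.
  rewrite (le_trans (ler_normD _ _))// -natr1 mulrDl mul1r addrC lerD//.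
  rewrite /ins; case: unliftP => [l' ->|->] /=; first exact: Lq.
  by rewrite wi subrr normr0 mulr_ge0// ltW.
have covs : covers (d.+2%:R * h)
    [set z | exists2 k, k \in iota 0 K.+1 & exists2 i, i \in index_enum 'I_d.+2 &
       exists2 j, j \in index_iota 0 m.+1 & E k i j z]
    (\sum_(k <- iota 0 K.+1) \sum_(i <- index_enum 'I_d.+2)
       \sum_(0 <= j < m.+1) c k i j)%N.
  apply: covers_bigcup => k; rewrite mem_iota/= add0n ltnS => kK.
  by apply: covers_bigcup => i _; apply: covers_bigcup => j _; exact: covE.
apply: covers_sub covs _ (lexx _) _.
  move=> z [Qz fz].
  have /choice[a Ha] : forall i, exists j, (j < m)%N /\
      j%:R / m%:R <= z i <= j%:R / m%:R + m%:R^-1.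
    by move=> i; have [j jm jz] := grid_near m0 (Qz i); exists j.
  have am i : (a i < m)%N by have [] := Ha i.
  have az : cell (fun i => (a i)%:R / m%:R) h z by move=> i; have [] := Ha i.
  have [k kK [w [aw [i wi]] Fw]] := descend bK (cell_ucube am) az fz.
  exists k; first by rewrite mem_iota/= add0n ltnS.
  exists i; first by rewrite mem_index_enum.
  have zw l : `|z l - w l| <= h.
    have := az l; have := aw l; rewrite ler_norml; move: (_ / _) => u.
    by move=> /andP[? ?] /andP[? ?]; apply/andP; split; lra.
  have Qw := cell_ucube am aw.
  have wi' : exists2 j, (j <= m)%N & w i = j%:R / m%:R.
    case: wi => ->; first by exists (a i) => //; exact: ltnW.
    by exists (a i).+1 => //; rewrite -natr1 mulrDl mul1r.
  have [j jm wj] := wi'; exists j; first by rewrite mem_index_iota/= ltnS.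
  by split => //; exists w.
have -> : (N.+1 * d.+2 * (B + N) * m.+1 ^ d.+1 =
    \sum_(k <- iota 0 N.+1) \sum_(i <- index_enum 'I_d.+2)
      ((B + N) * m.+1 ^ d.+1))%N.
  under eq_bigr do rewrite big_const_ord iter_addn_0.
  by rewrite big_const_seq/= iter_addn_0 count_predT size_iota; ring.
have -> : (\sum_(k <- iota 0 N.+1) \sum_(i <- index_enum 'I_d.+2)
      ((B + N) * m.+1 ^ d.+1) = \sum_(0 <= k < K.+1) \sum_(i <- index_enum 'I_d.+2)
      ((B + N) * m.+1 ^ d.+1) + \sum_(K.+1 <= k < N.+1) \sum_(i <- index_enum 'I_d.+2)
      ((B + N) * m.+1 ^ d.+1))%N.
  by rewrite -big_cat_nat.
apply: leq_trans (leq_addr _ _).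
rewrite big_seq [leqRHS]big_seq; apply: leq_sum => k.
rewrite mem_iota/= add0n ltnS => kK; apply: leq_sum => i _.
rewrite /c big_split/= sum_nat_const_nat subn0 -big_distrl/= mulnDl leq_add//.
  by rewrite mulnCA -expnS.
by rewrite leq_mul2r badE ?orbT//; exact: bigK.
Qed.

End step.

Lemma cover_sublevel d (f : ('I_d.+1 -> R) -> R) : sep_poly N f ->
  (exists2 x, ucube R d.+1 x & 1 <= `|f x|) ->
  covers (d.+1%:R * h) [set x | ucube R d.+1 x /\ `|f x| <= rho ^+ d.+1]
    (remez_count d * m.+1 ^ d)%N.
Proof.
elim: d f => [|d ih] f Nf f1.
  apply: covers_sub (cover_sublevel1 Nf f1) _ _ _.
  - move=> z [Qz fz]; split => //; rewrite (le_trans fz)// expr1.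
    by rewrite ler_pdivrMr// ler_peMr ?ler1n// ltW.
  - by rewrite mul1r.
  - by rewrite expn0 muln1.
exact: (cover_sublevel_step Nf f1 ih).
Qed.

End sublevel.

(** * The Remez inequality on the sphere *)

Section hpoly.
Context (R : realType) (n : nat).
Implicit Types (f g : 'rV[R]_n -> R) (k : nat).

(** Homogeneous polynomial functions of a given degree. The zero function is put in every degree so
    that families indexed by the degree can be padded. *)
Inductive hpoly : nat -> ('rV[R]_n -> R) -> Prop :=
| hpoly_cst c : hpoly 0 (fun=> c)
| hpoly_coord k i f : hpoly k f -> hpoly k.+1 (fun x => x ord0 i * f x)
| hpolyD k f g : hpoly k f -> hpoly k g -> hpoly k (fun x => f x + g x)
| hpoly0 k : hpoly k (fun=> 0).

Lemma hpolyZ k f c : hpoly k f -> hpoly k (fun x => c * f x).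
Proof.
elim=> {k f} [a|k i f _ ih|k f g _ ihf _ ihg|k].
- exact: hpoly_cst.
- rewrite (_ : (fun _ => _) = (fun x : 'rV[R]_n => x ord0 i * (c * f x))).
    exact: hpoly_coord.
  by apply/funext => x; rewrite mulrCA.
- rewrite (_ : (fun _ => _) = (fun x => c * f x + c * g x)).
    exact: hpolyD.
  by apply/funext => x; rewrite mulrDr.
- rewrite (_ : (fun _ => _) = (fun=> 0)); first exact: hpoly0.
  by apply/funext => x; rewrite mulr0.
Qed.

Lemma hpolyM k l f g : hpoly k f -> hpoly l g -> hpoly (k + l) (fun x => f x * g x).
Proof.
move=> fk; elim: fk l g => {k f} [a|k i f _ ih|k f f' _ ihf _ ihf'|k] l g gl.
- exact: hpolyZ.
- rewrite (_ : (fun _ => _) = (fun x : 'rV[R]_n => x ord0 i * (f x * g x))).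
    by rewrite addSn; apply: hpoly_coord; exact: ih.
  by apply/funext => x; rewrite mulrA.
- rewrite (_ : (fun _ => _) = (fun x => f x * g x + f' x * g x)).
    by apply: hpolyD; [exact: ihf|exact: ihf'].
  by apply/funext => x; rewrite mulrDl.
- rewrite (_ : (fun _ => _) = (fun=> 0)); first exact: hpoly0.
  by apply/funext => x; rewrite mul0r.
Qed.

Lemma hpoly_sum k (I : Type) (s : seq I) (P : pred I) (F : I -> 'rV[R]_n -> R) :
  (forall i, P i -> hpoly k (F i)) -> hpoly k (fun x => \sum_(i <- s | P i) F i x).
Proof.
move=> HF; elim: s => [|i s ih].
  rewrite (_ : (fun _ => _) = (fun=> 0)); first exact: hpoly0.
  by apply/funext => x; rewrite big_nil.
have [Pi|Pi] := boolP (P i).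
  rewrite (_ : (fun _ => _) = (fun x => F i x + \sum_(i <- s | P i) F i x)).
    by apply: hpolyD => //; exact: HF.
  by apply/funext => x; rewrite big_cons Pi.
rewrite (_ : (fun _ => _) = (fun x => \sum_(i <- s | P i) F i x))//.
by apply/funext => x; rewrite big_cons (negPf Pi).
Qed.

Lemma hpoly_id i : hpoly 1 (fun x => x ord0 i).
Proof.
rewrite (_ : (fun _ => _) = (fun x : 'rV[R]_n => x ord0 i * 1)).
  exact/hpoly_coord/hpoly_cst.
by apply/funext => x; rewrite mulr1.
Qed.

Lemma hpoly_scale k f c x : hpoly k f -> f (c *: x) = c ^+ k * f x.
Proof.
elim=> {k f} [a|k i f _ ih|k f g _ ihf _ ihg|k].
- by rewrite expr0 mul1r.
- by rewrite mxE ih exprS; ring.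
- by rewrite ihf ihg mulrDr.
- by rewrite mulr0.
Qed.

End hpoly.
Arguments hpoly {R n}.

Section euclidean_norm.
Context (R : realType) (n : nat).
Implicit Types x y : 'rV[R]_n.

Lemma enorm_ge0 x : 0 <= enorm x.
Proof. exact: sqrtr_ge0. Qed.

Lemma enorm_sqr x : enorm x ^+ 2 = \sum_(i < n) x ord0 i ^+ 2.
Proof. by rewrite sqr_sqrtr// sumr_ge0// => i _; exact: sqr_ge0. Qed.

Lemma usphereP x : usphere R n x <-> \sum_(i < n) x ord0 i ^+ 2 = 1.
Proof.
rewrite /usphere/= -enorm_sqr; split=> [->|]; first by rewrite expr1n.
by move=> /eqP; rewrite sqrf_eq1 => /orP[/eqP//|/eqP x1]; have := enorm_ge0 x; rewrite x1 ler0N1.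
Qed.

Lemma enorm_le x c : 0 <= c -> \sum_(i < n) x ord0 i ^+ 2 <= c ^+ 2 -> enorm x <= c.
Proof. by move=> c0 xc; rewrite -(@ler_sqr _ (enorm x)) ?nnegrE ?enorm_ge0// enorm_sqr. Qed.

End euclidean_norm.

(** * Stereographic charts of the two hemispheres *)

Section stereographic.
Context (R : realType) (d : nat) (sg : R) (sg1 : sg ^+ 2 = 1).
Implicit Types z : 'I_d.+1 -> R.

Let y z i : R := 4 * z i - 2.
Let a z : R := \sum_i y z i ^+ 2.

(* Stereographic projection from the pole x_0 = sg, in the coordinates
   y = 4 z - 2, so that the unit cube of the z covers the hemisphere opposite
   to the pole with some room to spare. *)
Definition stereo z : 'rV[R]_d.+2 :=
  \row_j (oapp (fun k => 2 * y z k) (sg * (a z - 1)) (unlift ord0 j) / (1 + a z)).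

Definition stereo_den z : R := 1 + a z.

Lemma stereo_den_ge1 z : 1 <= stereo_den z.
Proof. by rewrite lerDl sumr_ge0// => i _; exact: sqr_ge0. Qed.

Lemma stereo_den_gt0 z : 0 < stereo_den z.
Proof. exact: lt_le_trans (stereo_den_ge1 z). Qed.

(** On the cube |y_i| <= 2, so 1 + |y|^2 <= 1 + 4 (d + 1). *)
Lemma stereo_den_le z : ucube R d.+1 z -> stereo_den z <= (5 + 4 * d)%:R.
Proof.
move=> Qz; rewrite (_ : (5 + 4 * d)%:R = 1 + \sum_(i < d.+1) 4).
  rewrite lerD2l; apply: ler_sum => i _.
  have /andP[z0 z1] := Qz i; rewrite /y.
  have -> : (4 : R) = 2 ^+ 2 by rewrite -natrX.
  rewrite -[leLHS]real_normK ?num_real// ler_sqr ?nnegrE// ler_norml.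
  by rewrite -natrX; apply/andP; split; lra.
by rewrite sumr_const card_ord -mulrnA -natr1 -[1]/(1%:R) -!natrD; congr _%:R; lia.
Qed.

Lemma stereo0 z : stereo z ord0 ord0 = sg * (a z - 1) / stereo_den z.
Proof. by rewrite mxE unlift_none. Qed.

Lemma stereoS z k : stereo z ord0 (lift ord0 k) = 2 * y z k / stereo_den z.
Proof. by rewrite mxE liftK. Qed.

Lemma stereo_usphere z : usphere R d.+2 (stereo z).
Proof.
apply/usphereP; rewrite big_ord_recl stereo0.
under eq_bigr do rewrite stereoS -mulrA exprMn exprMn [_ ^+ 2 * _ ^+ 2]mulrC mulrA.
rewrite -mulr_sumr -/(a z) !exprMn sg1.
by rewrite /stereo_den; field; rewrite gt_eqF// stereo_den_gt0.
Qed.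

(** The conformal identity |x - x'|^2 = 4 |y - y'|^2 / ((1 + |y|^2) (1 + |y'|^2)). The factor 8 is 2
    times the dilation 4, and [d.+1] bounds its own square root. *)
Lemma stereo_lip z z' r : 0 <= r -> (forall i, `|z i - z' i| <= r) ->
  enorm (stereo z - stereo z') <= 8 * d.+1%:R * r.
Proof.
move=> r0 zz; apply: enorm_le; first by rewrite !mulr_ge0.
have D0 := stereo_den_gt0 z; have D0' := stereo_den_gt0 z'.
have -> : \sum_(i < d.+2) (stereo z - stereo z') ord0 i ^+ 2 =
    4 * (\sum_i (y z i - y z' i) ^+ 2) / (stereo_den z * stereo_den z').
  rewrite big_ord_recl !mxE unlift_none/=.
  have -> : \sum_i (stereo z - stereo z') ord0 (lift ord0 i) ^+ 2 =
      \sum_i ((2 / stereo_den z) ^+ 2 * y z i ^+ 2 +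
        (2 / stereo_den z') ^+ 2 * y z' i ^+ 2 -
        2 * (2 / stereo_den z) * (2 / stereo_den z') * (y z i * y z' i)).
    apply: eq_bigr => i _; rewrite !mxE !liftK/=.
    by rewrite -!/(stereo_den _); ring.
  have -> : \sum_i (y z i - y z' i) ^+ 2 =
      a z + a z' - 2 * \sum_i (y z i * y z' i).
    rewrite /a mulr_sumr -big_split -sumrB; apply: eq_bigr => i _ /=; ring.
  rewrite sumrB big_split/= -!mulr_sumr -!/(a _) -!/(stereo_den _).
  move: (\sum_i _) => c.
  rewrite (_ : sg * (a z - 1) / _ - _ = sg *
    ((a z - 1) / stereo_den z - (a z' - 1) / stereo_den z')); last by ring.
  rewrite exprMn sg1 /stereo_den.
  by field; rewrite !gt_eqF.
rewrite ler_pdivrMr ?mulr_gt0//.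
apply: (@le_trans _ _ ((8 * d.+1%:R * r) ^+ 2)); last first.
  rewrite ler_peMr ?sqr_ge0// -[1]mulr1 ler_pM//; exact: stereo_den_ge1.
have : \sum_i (y z i - y z' i) ^+ 2 <= \sum_(i < d.+1) (4 * r) ^+ 2.
  apply: ler_sum => i _; rewrite -[leLHS]real_normK ?num_real//.
  rewrite ler_sqr ?nnegrE ?mulr_ge0// /y.
  rewrite (_ : _ - _ = 4 * (z i - z' i)); last by ring.
  by rewrite normrM ger0_norm// ler_pM2l.
rewrite sumr_const card_ord -[leRHS]mulr_natl => H.
apply: (le_trans (ler_wpM2l (ler0n R 4) H)).
rewrite [leRHS](_ : _ = d.+1%:R * (d.+1%:R * (4 * (4 * r) ^+ 2))); last by ring.
rewrite mulrCA ler_pM2l ?ltr0n// ler_peMl ?ler1n// mulr_ge0// sqr_ge0//.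
Qed.

Lemma stereo_onto x : usphere R d.+2 x -> sg * x ord0 ord0 <= 0 ->
  exists2 z, ucube R d.+1 z & stereo z = x.
Proof.
move=> /usphereP x1 sx.
pose D := 1 - sg * x ord0 ord0.
have D1 : 1 <= D by rewrite lerBrDl gerDr.
have D0 : 0 < D by exact: lt_le_trans D1.
(* The inverse projection y_k = x_k / (1 - sg x_0), followed by z = (y + 2) / 4; on this hemisphere
   |y_k| <= 1. *)
exists (fun k => (x ord0 (lift ord0 k) / D + 2) / 4).
  move=> k; have : `|x ord0 (lift ord0 k) / D| <= 1.
    rewrite normrM normfV (gtr0_norm D0) ler_pdivrMr// mul1r (le_trans _ D1)//.
    rewrite -(@ler_sqr _ _ 1) ?nnegrE// real_normK ?num_real// expr1n -x1.
    by rewrite (bigD1 (lift ord0 k))//= lerDl sumr_ge0// => i _; exact: sqr_ge0.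
  by rewrite ler_norml => /andP[? ?]; apply/andP; split; lra.
set z := fun _ => _.
have yE k : y z k = x ord0 (lift ord0 k) / D by rewrite /y /z; field; rewrite gt_eqF.
have aE : a z = (1 - x ord0 ord0 ^+ 2) / D ^+ 2.
  rewrite /a; under eq_bigr do rewrite yE expr_div_n.
  by rewrite -mulr_suml; move: x1; rewrite big_ord_recl => <-; congr (_ / _); ring.
have x0E : x ord0 ord0 ^+ 2 = (1 - D) ^+ 2.
  by rewrite /D opprB addrC subrK exprMn sg1 mul1r.
have denE : stereo_den z = 2 / D.
  by rewrite /stereo_den aE x0E; field; rewrite gt_eqF.
apply/rowP => j; have [k ->|->] := unliftP ord0 j.
  by rewrite stereoS denE yE; field; rewrite gt_eqF.
rewrite stereo0 denE aE x0E.
rewrite (_ : sg * _ / _ = sg * (1 - D)); last by field; rewrite gt_eqF.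
by rewrite /D opprB addrC subrK mulrA -expr2 sg1 mul1r.
Qed.

Lemma sep_poly_coord i : sep_poly 1 (fun z : 'I_d.+1 -> R => z i).
Proof.
move=> j z; have [->|ij] := eqVneq i j.
  by exists 'X; rewrite ?size_polyX// => s; rewrite upd_eq hornerX.
exists (z i)%:P; first by rewrite (leq_trans (size_polyC_leq1 _)).
by move=> s; rewrite hornerC /upd (negPf ij).
Qed.

Lemma sep_poly_y i : sep_poly 1 (fun z => y z i).
Proof.
have := sep_polyD (sep_polyZ 4 (sep_poly_coord i)) (@sep_poly_cst _ 1 d.+1 (- 2)).
exact.
Qed.

Lemma sep_poly_sum N (I : Type) (s : seq I) (F : I -> ('I_d.+1 -> R) -> R) :
  (forall i, sep_poly N (F i)) -> sep_poly N (fun z => \sum_(i <- s) F i z).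
Proof.
move=> HF; elim: s => [|i s ih].
  rewrite (_ : (fun _ => _) = (fun=> 0)); first exact: sep_poly_cst.
  by apply/funext => x; rewrite big_nil.
rewrite (_ : (fun _ => _) = (fun x => F i x + \sum_(i <- s) F i x)).
  exact: sep_polyD.
by apply/funext => x; rewrite big_cons.
Qed.

Lemma sep_poly_a : sep_poly 2 a.
Proof.
apply: sep_poly_sum => i.
rewrite (_ : (fun _ => _) = (fun z => y z i * y z i)).
  exact: (@sep_polyM _ 1 1 _ _ _ (sep_poly_y i) (sep_poly_y i)).
by apply/funext => z; rewrite expr2.
Qed.

Lemma sep_poly_den : sep_poly 2 stereo_den.
Proof.
have := sep_polyD (@sep_poly_cst _ 2 d.+1 1) sep_poly_a.
exact.
Qed.

Lemma sep_poly_denX k : sep_poly (2 * k) (fun z => stereo_den z ^+ k).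
Proof.
elim: k => [|k ih]; first exact: sep_poly_cst.
rewrite (_ : (fun _ => _) = (fun z => stereo_den z * stereo_den z ^+ k)).
  by rewrite mulnS; exact: sep_polyM sep_poly_den ih.
by apply/funext => z; rewrite exprS.
Qed.

(** By homogeneity each coordinate factor absorbs one factor of the denominator, and a coordinate
    times the denominator has degree at most 2 in each variable. *)
Lemma hpoly_stereo k p : hpoly k p ->
  sep_poly (2 * k) (fun z => stereo_den z ^+ k * p (stereo z)).
Proof.
elim=> {k p} [c|k i f _ ih|k f g _ ihf _ ihg|k].
- by rewrite /=; under eq_fun do rewrite mul1r; exact: sep_poly_cst.
- rewrite (_ : (fun _ => _) = (fun z => (stereo_den z * stereo z ord0 i) *
      (stereo_den z ^+ k * f (stereo z)))); last first.
    by apply/funext => z; rewrite exprS; ring.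
  rewrite mulnS; apply: sep_polyM ih.
  have [j ->|->] := unliftP ord0 i.
    rewrite (_ : (fun _ => _) = (fun z => 2 * y z j)).
      exact/(sep_poly_widen (isT : 1 <= 2)%N)/sep_polyZ/sep_poly_y.
    apply/funext => z; rewrite stereoS; field.
    by rewrite gt_eqF// stereo_den_gt0.
  rewrite (_ : (fun _ => _) = (fun z => sg * (a z + - 1))).
    by apply/sep_polyZ/sep_polyD; [exact: sep_poly_a|exact: sep_poly_cst].
  apply/funext => z; rewrite stereo0; field.
  by rewrite gt_eqF// stereo_den_gt0.
- under eq_fun do rewrite mulrDr; exact: (sep_polyD ihf ihg).
- under eq_fun do rewrite mulr0; exact: sep_poly_cst.
Qed.

Lemma sum_hpoly_stereo N (p : nat -> 'rV[R]_d.+2 -> R) : (forall k, hpoly k (p k)) ->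
  sep_poly (2 * N)
    (fun z => stereo_den z ^+ N * \sum_(k < N.+1) p k (stereo z)).
Proof.
move=> hp.
rewrite (_ : (fun _ => _) = (fun z => \sum_(k < N.+1)
    (stereo_den z ^+ (N - k) * (stereo_den z ^+ k * p k (stereo z))))).
  apply: sep_poly_sum => k; apply: (@sep_poly_widen _ (2 * (N - k) + 2 * k)).
    by rewrite -mulnDr subnK// -ltnS.
  by apply: sep_polyM; [exact: sep_poly_denX|exact: hpoly_stereo].
apply/funext => z; rewrite mulr_sumr; apply: eq_bigr => k _.
by rewrite mulrA -exprD subnK// -ltnS.
Qed.

End stereographic.

(** * The Euclidean norm and the content of finite coverings *)

Section euclidean_triangle.
Context (R : realType) (n : nat).
Implicit Types (a b : 'I_n -> R) (x y : 'rV[R]_n).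

(** With A, B the sums of squares and C the scalar product, B (A B - C^2) is the sum of the squares
    (B a_i - C b_i)^2. *)
Lemma cauchy_schwarz a b :
  (\sum_i a i * b i) ^+ 2 <= (\sum_i a i ^+ 2) * (\sum_i b i ^+ 2).
Proof.
set A := \sum_i a i ^+ 2; set B := \sum_i b i ^+ 2; set C := \sum_i _.
have B0 : 0 <= B by apply: sumr_ge0 => i _; exact: sqr_ge0.
have [B1|B1] := eqVneq B 0.
  have b0 i : b i = 0.
    apply/eqP; rewrite -sqrf_eq0; apply/eqP.
    by apply: (psumr_eq0P _ B1) => // j _; exact: sqr_ge0.
  by rewrite B1 mulr0 /C big1 ?expr0n// => i _; rewrite b0 mulr0.
have {B1}B0 : 0 < B by rewrite lt_neqAle eq_sym B1.
rewrite -subr_ge0 -(pmulr_rge0 _ B0).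
have -> : B * (A * B - C ^+ 2) = \sum_i (B * a i - C * b i) ^+ 2.
  rewrite (eq_bigr (fun i => B ^+ 2 * a i ^+ 2 - 2 * B * C * (a i * b i)
     + C ^+ 2 * b i ^+ 2)); last by move=> i _; ring.
  rewrite big_split sumrB/= -!mulr_sumr -/A -/B -/C; ring.
by apply: sumr_ge0 => i _; exact: sqr_ge0.
Qed.

Lemma enormD x y : enorm (x + y) <= enorm x + enorm y.
Proof.
apply: enorm_le; first by rewrite addr_ge0// enorm_ge0.
rewrite sqrrD !enorm_sqr (eq_bigr (fun i => x ord0 i ^+ 2 +
  2 * (x ord0 i * y ord0 i) + y ord0 i ^+ 2)); last first.
  by move=> i _; rewrite mxE; ring.
rewrite !big_split/= lerD2r lerD2l -mulr_sumr -[leRHS]mulr_natl.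
rewrite ler_pM2l// (le_trans (ler_norm _))//.
rewrite -(@ler_sqr _ `|_|) ?nnegrE ?mulr_ge0 ?enorm_ge0//.
by rewrite real_normK ?num_real// exprMn !enorm_sqr cauchy_schwarz.
Qed.

Lemma enormN x : enorm (- x) = enorm x.
Proof. by rewrite /enorm; congr Num.sqrt; apply: eq_bigr => i _; rewrite mxE sqrrN. Qed.

Lemma ediam_eball (c : 'rV[R]_n) r : 0 < r ->
  (0 <= ediam (eball c r) <= (2 * r)%:E)%E.
Proof.
move=> r0; apply/andP; split.
  apply: ereal_sup_ubound; exists (c, c) => /=; last first.
    by rewrite subrr /enorm big1 ?sqrtr0// => i _; rewrite mxE expr0n.
  by rewrite /eball/= subrr /enorm big1 ?sqrtr0// => i _; rewrite mxE expr0n.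
apply: ge_ereal_sup => _ [[x y] /= [xc yc] <-]; rewrite lee_fin.
rewrite (_ : x - y = (x - c) + - (y - c)); last by rewrite opprB addrA subrK.
rewrite (le_trans (enormD _ _))// enormN mulr_natl mulr2n.
by rewrite lerD// ltW.
Qed.

(** The content is defined with infinite sequences of balls of positive radius. The [K] given balls
    are completed by balls whose diameters to the power [alpha] are dominated by a geometric series
    with sum 2 (2 r)^alpha, whence [K.+2]. *)
Lemma content_le (alpha : R) (E : set 'rV[R]_n) K (c : nat -> 'rV[R]_n) (r : R) :
  0 < alpha -> 0 < r ->
  E `<=` [set x | exists2 k, (k < K)%N & eball (c k) r x] ->
  (hausdorff_content alpha E <= (K.+2%:R * (2 * r) `^ alpha)%:E)%E.
Proof.
move=> a0 r0 Ec.
pose rr j := if (j < K)%N then r else r * (2^-1 ^+ j) `^ alpha^-1.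
have rr0 j : 0 < rr j.
  by rewrite /rr; case: ifP => // _; rewrite mulr_gt0// powR_gt0// exprn_gt0.
pose t j := (ediam (eball (c j) (rr j)) `^ alpha)%E.
have t0 j : (0 <= t j)%E by exact: poweR_ge0.
apply: (@le_trans _ _ (\sum_(0 <= j <oo) t j)%E).
  apply: ereal_inf_lbound; exists c, rr; split => //.
  by move=> x /Ec[k kK xk]; exists k => //; rewrite /rr kK.
apply: lime_le; first by apply: is_cvg_nneseries.
apply: nearW => k.
pose C := (2 * r) `^ alpha.
have C0 : 0 <= C by exact: powR_ge0.
have tj j : (t j <= ((j < K)%:R * C + C / 2 ^+ j)%:E)%E.
  have /andP[d0 d1] := ediam_eball (c j) (rr0 j).
  apply: (@le_trans _ _ ((2 * rr j) `^ alpha)%:E).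
    rewrite -poweR_EFin; apply: gt0_ler_poweR => //; first exact: ltW.
      by rewrite in_itv/= d0 leey.
    by rewrite in_itv/= leey andbT lee_fin mulr_ge0// ltW.
  rewrite lee_fin /rr; case: ifPn => jK.
    by rewrite mul1r lerDl divr_ge0// exprn_ge0.
  rewrite mul0r add0r mulrA powRM ?mulr_ge0 ?powR_ge0 ?(ltW r0)//.
  by rewrite -powRrM mulVf ?gt_eqF// powRr1 ?exprn_ge0// exprVn.
apply: (@le_trans _ _ (\sum_(0 <= j < k) ((j < K)%:R * C + C / 2 ^+ j)%:E)%E).
  by apply: lee_sum => j _; exact: tj.
rewrite sumEFin lee_fin -/C.
have : \sum_(0 <= j < k) ((j < K)%:R * C + C / 2 ^+ j) <=
    (minn k K)%:R * C + (C * 2 - C * 2 / 2 ^+ k).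
  elim: k => [|k ih]; first by rewrite big_geq// min0n mul0r expr0 divr1 subrr addr0.
  rewrite big_nat_recr//= (le_trans (lerD ih (lexx _)))//.
  have -> : (minn k.+1 K)%:R = (minn k K)%:R + (k < K)%:R :> R.
    by rewrite -natrD; congr _%:R; case: ltnP; lia.
  rewrite le_eqVlt; apply/orP; left; apply/eqP; rewrite exprS; field.
  by rewrite expf_neq0.
move/le_trans; apply.
rewrite (_ : K.+2%:R = K%:R + 2%:R); last by rewrite -natrD addn2.
rewrite mulrDl lerD//; first by apply: ler_wpM2r; rewrite ?ler_nat ?geq_minr.
by rewrite mulrC lerBlDr lerDl divr_ge0 ?mulr_ge0// exprn_ge0.
Qed.

End euclidean_triangle.

(** * From covering sublevel sets to covering the observation set *)

Section remez.
Context (R : realType) (d : nat).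

(** The number D^N / (kap rho^(d+1)) written as a natural number: D bounds the stereographic
    denominator, kap is the loss in passing from one hemisphere to the other, rho^(d+1) is the
    sublevel threshold, and L = 2 N is the degree in each variable of the charts. *)
Definition remez_factor (N m : nat) : nat :=
  let L := (2 * N)%N in
  ((5 + 4 * d) ^ N * (2 * L.+1 * (5 + 4 * d) ^ N * (4 * L.+1) ^ L) *
   (m ^ L * (4 * L.+1)) ^ d.+1)%N.

Variables (N m : nat) (m0 : (0 < m)%N) (p : nat -> 'rV[R]_d.+2 -> R).
Hypothesis hp : forall k, hpoly k (p k).
Let P x := \sum_(k < N.+1) p k x.
Let L := (2 * N)%N.
Let D : R := (5 + 4 * d)%:R.
Let rho : R := remez_kappa R L m / 2.
Let kap : R := (2 * L.+1%:R * D ^+ N * (4 * L.+1%:R) ^+ L)^-1.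

Let D1 : 1 <= D. Proof. by rewrite ler1n. Qed.
Let kap0 : 0 < kap.
Proof. by rewrite invr_gt0 !mulr_gt0// exprn_gt0// ?mulr_gt0// (lt_le_trans ltr01). Qed.
Let rho0 : 0 < rho.
Proof. by rewrite /rho /remez_kappa !divr_gt0 ?exprn_gt0 ?invr_gt0 ?ltr0n// mulr_gt0. Qed.

Let factorE : (remez_factor N m)%:R = D ^+ N / (kap * rho ^+ d.+1).
Proof.
have rhoE : rho^-1 = m%:R ^+ L * (4 * L.+1%:R).
  rewrite /rho /remez_kappa exprVn; field.
  by rewrite expf_neq0 ?gt_eqF ?ltr0n//= nat1r pnatr_eq0.
rewrite invfM -exprVn rhoE invrK mulrA /remez_factor.
by rewrite !(natrM, natrX) -/L -/D !mulrA.
Qed.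

Let chart (sg : R) z := stereo_den z ^+ N * P (@stereo R d sg z).

Let chart_ge sg z : `|P (stereo sg z)| <= `|chart sg z|.
Proof.
rewrite /chart normrM ger0_norm ?exprn_ge0 ?(ltW (stereo_den_gt0 z))//.
by rewrite ler_peMl// exprn_ege1// stereo_den_ge1.
Qed.

Let chart_le sg z : ucube R d.+1 z -> `|chart sg z| <= D ^+ N * `|P (stereo sg z)|.
Proof.
move=> Qz; rewrite /chart normrM ger0_norm ?exprn_ge0 ?(ltW (stereo_den_gt0 z))//.
apply: ler_wpM2r => //; rewrite lerXn2r ?nnegrE ?(ltW (stereo_den_gt0 z))//.
  exact: stereo_den_le.
Qed.

Variables (M : set 'rV[R]_d.+2) (b : R) (b0 : 0 <= b).
Hypothesis MS : M `<=` usphere R d.+2.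
Hypothesis PM : forall x, M x -> `|P x| <= b.

Let r : R := 9 * d.+1%:R ^+ 2 / m%:R.
Let K := (remez_count L d * m.+1 ^ d)%N.

Let cover_hemisphere (sg nu : R) : sg ^+ 2 = 1 -> 0 < nu ->
  (exists2 z, ucube R d.+1 z & nu <= `|chart sg z|) ->
  D ^+ N * b <= nu * rho ^+ d.+1 ->
  exists c : nat -> 'rV[R]_d.+2, forall x, M x -> sg * x ord0 ord0 <= 0 ->
    exists2 k, (k < K)%N & eball (c k) r x.
Proof.
move=> sg1 nu0 [z Qz fz] bnu.
have Nf := sep_polyZ nu^-1 (@sum_hpoly_stereo R d sg N p hp).
have [|Z HZ] := cover_sublevel m0 Nf.
  exists z => //; rewrite normrM normfV (gtr0_norm nu0) ler_pdivlMl// mulr1.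
  exact: fz.
exists (fun k => stereo sg (Z k)) => x Mx sx.
have [w Qw wx] := stereo_onto sg1 (MS Mx) sx.
have [|k kK wZ] := HZ w.
  split => //; rewrite normrM normfV (gtr0_norm nu0) ler_pdivrMl//.
  rewrite (le_trans _ bnu)// (le_trans (chart_le sg Qw))//.
  by rewrite ler_pM2l ?exprn_gt0 ?(lt_le_trans ltr01)// wx PM.
have hr : 0 <= d.+1%:R / m%:R :> R by rewrite divr_ge0.
exists k => //; rewrite /eball/= -wx (le_lt_trans (stereo_lip sg1 hr wZ))//.
rewrite /r mulrA ltr_pM2r ?invr_gt0 ?ltr0n// expr2 !mulrA -mulrA.
rewrite -[X in _ < X]mulrA ltr_pM2r ?mulr_gt0 ?ltr0n//.
by rewrite ltr_nat.
Qed.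

Lemma remez_cover x0 : usphere R d.+2 x0 -> (remez_factor N m)%:R * b < `|P x0| ->
  exists c : nat -> 'rV[R]_d.+2,
    M `<=` [set x | exists2 k, (k < 2 * K)%N & eball (c k) r x].
Proof.
move=> Sx0 bP.
set mu := `|P x0| in bP.
have mu0 : 0 < mu by apply: le_lt_trans bP; rewrite mulr_ge0.
have kap1 : kap <= 1.
  have k0 : 0 < kap^-1 by rewrite invr_gt0.
  rewrite -[kap]invrK invf_le1// invrK.
  by rewrite /D -[4 * _]natrM -!natrX -!natrM ler1n !muln_gt0 !expn_gt0.
have Db : D ^+ N * b <= kap * mu * rho ^+ d.+1.
  have := ltW bP; rewrite factorE mulrAC ler_pdivrMr ?mulr_gt0 ?exprn_gt0//.
  by rewrite mulrCA mulrA.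
have [sg sg1 sx0] : exists2 sg : R, sg ^+ 2 = 1 & sg * x0 ord0 ord0 <= 0.
  have [x00|x00] := leP (x0 ord0 ord0) 0.
    by exists 1; rewrite ?expr1n ?mul1r.
  by exists (- 1); rewrite ?sqrrN ?expr1n// mulN1r oppr_le0 ltW.
have sgN : (- sg) ^+ 2 = 1 by rewrite sqrrN.
have kmu0 : 0 < kap * mu by rewrite mulr_gt0.
have [z0 Qz0 z0x] := stereo_onto sg1 Sx0 sx0.
have z0mu : mu <= `|chart sg z0| by rewrite (le_trans _ (chart_ge _ _))// z0x.
have near_big : exists2 z, ucube R d.+1 z & kap * mu <= `|chart sg z|.
  by exists z0 => //; apply: le_trans z0mu; rewrite ler_piMl// ltW.
(* Where coordinate 0 of the cube lies in [3/4, 1] one has |y| >= 1, so this chart already shows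
   points of the other hemisphere. If [P] were small there, interpolation from [L.+1] nodes with
   spacing 1 / (4 (L + 1)) on the line through [z0] would make the chart small at [z0]; [kap] is the
   inverse of the resulting loss. *)
have far_big : exists2 z, ucube R d.+1 z & kap * mu <= `|chart (- sg) z|.
  apply: contrapT => small.
  have [q sq cq] := @sum_hpoly_stereo R d sg N p hp ord0 z0.
  pose h : R := (4 * L.+1%:R)^-1.
  have h0 : 0 < h by rewrite invr_gt0 mulr_gt0.
  pose s : seq R := [seq 3 / 4 + j%:R * h | j <- iota 0 L.+1].
  have s34 a : a \in s -> 3 / 4 <= a <= 1.
    move=> /mapP[j]; rewrite mem_iota/= add0n => jL ->.
    rewrite lerDl mulr_ge0 ?(ltW h0)//=.
    have : j%:R * h <= 1 / 4.
      rewrite ler_pdivrMr ?mulr_gt0// mulrA mul1r mulVf// mul1r ler_nat.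
      exact: ltnW.
    by move=> ?; lra.
  have : `|q.[z0 ord0]| <= (size s)%:R * (D ^+ N * (kap * mu)) * (h ^+ (size s).-1)^-1.
    apply: lagr_bound => //.
    - rewrite pairwise_map.
      have : pairwise ltn (iota 0 L.+1).
        by rewrite -sorted_pairwise ?iota_ltn_sorted//; exact: ltn_trans.
      apply: sub_pairwise => u v /= uv.
      rewrite (_ : _ - _ = - ((v%:R - u%:R) * h)); last by ring.
      rewrite normrN normrM (gtr0_norm h0) -[leLHS]mul1r ler_pM2r//.
      rewrite -natrB 1?ltnW// ger0_norm//.
      by rewrite ler1n subn_gt0.
    - by move=> a /s34/andP[a0 a1]; rewrite a1 andbT (le_trans _ a0)// divr_ge0.
    - by rewrite size_map size_iota.
    - move=> a /s34 /andP[a0 a1]; rewrite -cq -/(chart _ _).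
      have Qu : ucube R d.+1 (upd z0 ord0 a).
        move=> j; rewrite /upd; case: eqVneq => // _.
        by rewrite a1 andbT (le_trans _ a0)// divr_ge0.
      rewrite (le_trans (chart_le sg Qu))// ler_pM2l ?exprn_gt0 ?(lt_le_trans ltr01)//.
      set x := stereo sg _.
      have Sx : usphere R d.+2 x by exact: stereo_usphere.
      have [|z Qz zx] := stereo_onto sgN Sx.
        rewrite mulNr oppr_le0 stereo0 !mulrA -expr2 sg1 mul1r.
        rewrite divr_ge0 ?(ltW (stereo_den_gt0 _))// subr_ge0.
        rewrite (bigD1 ord0)//= upd_eq -[leLHS]addr0 lerD//.
          by rewrite -[leLHS]mulr1 -[1]mulr1 expr2 ler_pM//; lra.
        by apply: sumr_ge0 => i _; exact: sqr_ge0.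
      rewrite leNgt; apply/negP => xk; apply: small; exists z => //.
      by rewrite (le_trans (ltW xk))// -zx; exact: chart_ge.
    - by rewrite mulr_ge0 ?(ltW kmu0)// exprn_ge0.
  apply/negP; rewrite -ltNge -cq upd_id (lt_le_trans _ z0mu)//.
  rewrite size_map size_iota /= /h exprVn invrK /kap.
  have cancel (u v w t : R) : u != 0 -> v != 0 -> w != 0 ->
      w * (u * ((2 * w * u * v)^-1 * t)) * v = t / 2.
    by move=> u0 v0 w0; field; rewrite u0 v0 w0.
  rewrite cancel ?expf_neq0 ?mulf_neq0 ?pnatr_eq0//.
    by rewrite ltr_pdivrMr// ltr_pMr// ltr1n.
have [c1 H1] := cover_hemisphere sg1 kmu0 near_big Db.
have [c2 H2] := cover_hemisphere sgN kmu0 far_big Db.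
exists (fun k => if (k < K)%N then c1 k else c2 (k - K)%N) => x Mx.
have [sx|sx] := leP (sg * x ord0 ord0) 0.
  have [k kK xk] := H1 x Mx sx.
  by exists k; rewrite ?kK// mul2n -addnn ltn_addr.
have [|k kK xk] := H2 x Mx; first by rewrite mulNr oppr_le0 ltW.
exists (K + k)%N; first by rewrite mul2n -addnn ltn_add2l.
by rewrite ltnNge leq_addr/= addKn.
Qed.

End remez.

Lemma remez_count_le L d : ((remez_count L d + L).+1 <= (2 * d.+1 * L.+1) ^ d.+1)%N.
Proof.
elim: d => [|d ih]; first by rewrite /=; lia.
apply: (@leq_trans (2 * d.+2 * L.+1 * (2 * d.+1 * L.+1) ^ d.+1)); last first.
  rewrite [leqRHS]expnS leq_mul2l; apply/orP; right.
  by rewrite leq_exp2r// leq_mul2r leq_mul2l /= ltnW ?orbT.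
move: ih; move: (_ ^ _)%N => X /= ih.
apply: (@leq_trans (L.+1 * d.+2 * (remez_count L d + L).+1)).
  by rewrite [leqRHS]mulnS; nia.
by rewrite -[X in (_ <= X * _ * _ * _)%N]/(1 + 1)%N; nia.
Qed.

(** Every factor is bounded by a power of one number [Y] that is linear in [N.+1], and the exponents
    add up to at most a multiple of [N.+1]. This is the bound exp (O (N log N)). *)
Lemma remez_factor_le d N q0 a : (0 < q0)%N ->
  (remez_factor d N ((q0 * N.+1) ^ a) <=
   ((q0 + 8 + 4 * d) * N.+1) ^ ((4 + (2 * a + 1) * d.+1) * N.+1))%N.
Proof.
move=> q00; set Y := ((q0 + 8 + 4 * d) * N.+1)%N.
have Y0 : (0 < Y)%N by rewrite /Y muln_gt0; lia.
have h1 : (5 + 4 * d <= Y)%N by rewrite /Y; nia.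
have h2 : (2 * (2 * N).+1 <= Y)%N by rewrite /Y; nia.
have h3 : (4 * (2 * N).+1 <= Y)%N by rewrite /Y; nia.
have h4 : (q0 * N.+1 <= Y)%N by rewrite /Y; nia.
have ex x y k l : (x <= Y ^ k)%N -> (y <= Y ^ l)%N -> (x * y <= Y ^ (k + l))%N.
  by move=> xk yl; rewrite expnD leq_mul.
have pw x k l : (x <= Y ^ k)%N -> (x ^ l <= Y ^ (k * l))%N.
  by move=> xk; rewrite expnM; case: l => // l; rewrite leq_exp2r.
rewrite -(expn1 Y) in h1 h2 h3 h4.
apply: (leq_trans (ex _ _ _ _ (ex _ _ _ _ (pw _ _ N h1) (ex _ _ _ _
  (ex _ _ _ _ h2 (pw _ _ N h1)) (pw _ _ (2 * N)%N h3)))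
  (pw _ _ d.+1 (ex _ _ _ _ (pw _ _ (2 * N)%N (pw _ _ a h4)) h3)))).
by rewrite leq_pexp2l//; nia.
Qed.

(** * Choice of the scale and the Remez inequality *)

Section remez_content.
Context (R : realType) (d : nat) (delta : R) (M : set 'rV[R]_d.+2).
Hypothesis delta01 : 0 < delta < 1.
Hypothesis MS : M `<=` usphere R d.+2.
Hypothesis M_content : (0 < hausdorff_content (d.+2%:R - 2 + delta) M)%E.

(* m_N = (q0 (N + 1))^a makes the total alpha-content of the covering of a
   sublevel set at scale 1 / m_N smaller than that of M. *)
Lemma remez_scale : exists q0 a : nat, (0 < q0)%N /\ forall N,
  (((2 * (remez_count (2 * N) d * ((q0 * N.+1) ^ a).+1 ^ d)).+2%:R *
   (2 * (9 * d.+1%:R ^+ 2 / ((q0 * N.+1) ^ a)%:R)) `^ (d.+2%:R - 2 + delta))%:E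
   < hausdorff_content (d.+2%:R - 2 + delta) M)%E.
Proof.
move/andP: delta01 => [delta0 delta1].
have [c0 c00 cM] : exists2 c0 : R, 0 < c0 & (c0%:E <= hausdorff_content (d.+2%:R - 2 + delta) M)%E.
  case: hausdorff_content M_content => [c|_|]//; first by rewrite lte_fin => ?; exists c.
  by exists 1; rewrite // leey.
pose C : R := 18 * d.+1%:R ^+ 2.
have C1 : 1 <= C by rewrite /C -natrX -natrM ler1n muln_gt0 expn_gt0.
(* All constants independent of [N]. With [q0 > W] and [a] times [delta] at least d + 2, m^delta
   exceeds W (N + 1)^(d+1), which beats the growth of [remez_count] in [N]. *)
pose W := 4 * 2 ^+ d * C ^+ d.+1 * (4 * d.+1%:R) ^+ d.+1 / c0.
have W0 : 0 < W.
  by rewrite divr_gt0// !mulr_gt0// ?exprn_gt0 ?mulr_gt0// (lt_le_trans ltr01).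
pose q0 := (Num.bound W).+1.
have q0W : W < q0%:R.
  by rewrite (lt_trans (archi_boundP (ltW W0)))// ltr_nat.
pose a := Num.bound (d.+2%:R / delta).
have ad : d.+2%:R <= a%:R * delta.
  by rewrite -ler_pdivrMr// ltW// archi_boundP// divr_ge0// ltW.
exists q0, a; split=> // N.
apply: lt_le_trans cM; rewrite lte_fin.
set m := ((q0 * N.+1) ^ a)%N.
have m0 : (0 < m)%N by rewrite expn_gt0.
have m0R : 0 < m%:R :> R by rewrite ltr0n.
have alphaE : d.+2%:R - 2 + delta = d%:R + delta.
  by rewrite -!natr1; ring.
rewrite alphaE (_ : 2 * (_ / _) = C / m%:R); last by rewrite /C; field; rewrite gt_eqF.
set B := remez_count _ _.
have BX : (B.+1 <= (4 * d.+1 * N.+1) ^ d.+1)%N.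
  apply: (leq_trans _ (leq_trans (remez_count_le (2 * N) d) _)).
    by rewrite ltnS leq_addr.
  by rewrite leq_exp2r//; nia.
have md : ((2 * (B * m.+1 ^ d)).+2 <= 4 * B.+1 * (2 * m) ^ d)%N.
  have : (m.+1 ^ d <= (2 * m) ^ d)%N by case: (d) => // d'; rewrite leq_exp2r//; lia.
  have : (0 < (2 * m) ^ d)%N by rewrite expn_gt0 muln_gt0 m0.
  move: (_ ^ _)%N (_ ^ _)%N => u v; nia.
have mdelta : W * N.+1%:R ^+ d.+1 < m%:R `^ delta.
  have -> : m%:R `^ delta = (q0 * N.+1)%:R `^ (a%:R * delta).
    by rewrite powRrM powR_mulrn// /m natrX.
  apply: (@lt_le_trans _ _ ((q0 * N.+1)%:R `^ d.+2%:R)); last first.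
    by apply: ler_powR => //; rewrite ler1n muln_gt0.
  rewrite powR_mulrn// natrM exprMn.
  apply: (@lt_le_trans _ _ (q0%:R * N.+1%:R ^+ d.+1)).
    by rewrite ltr_pM2r// exprn_gt0.
  rewrite ler_pM// ?exprn_ge0//.
    by rewrite exprS ler_peMr// exprn_ege1// ler1n.
  by rewrite [leRHS]exprS ler_peMl ?exprn_ge0// ler1n.
have Cm : (C / m%:R) `^ (d%:R + delta) <= C ^+ d.+1 / (m%:R ^+ d * m%:R `^ delta).
  rewrite powRM ?invr_ge0 ?(ltW m0R)// ?(le_trans ler01)//.
  rewrite -[m%:R^-1]powR_inv1// -powRrM mulN1r powRN.
  rewrite [m%:R `^ (_ + _)]powRD ?(gt_eqF m0R) ?implybT//.
  rewrite [m%:R `^ d%:R]powR_mulrn//.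
  rewrite ler_pM2r ?invr_gt0 ?mulr_gt0 ?exprn_gt0 ?powR_gt0//.
  rewrite -powR_mulrn ?(le_trans ler01)//; apply: ler_powR => //.
  by rewrite -natr1 lerD2l ltW.
apply: (@le_lt_trans _ _ ((4 * B.+1 * (2 * m) ^ d)%:R * (C ^+ d.+1 / (m%:R ^+ d * m%:R `^ delta)))).
  by rewrite ler_pM ?powR_ge0// ler_nat.
have mde0 : 0 < m%:R `^ delta by exact: powR_gt0.
rewrite (_ : _ * _ = (4 * 2 ^+ d * C ^+ d.+1 * B.+1%:R) / m%:R `^ delta); last first.
  rewrite !natrM natrX natrM exprMn; field.
  by rewrite gt_eqF//= expf_neq0// gt_eqF.
rewrite ltr_pdivrMr//; apply: (@le_lt_trans _ _ (c0 * (W * N.+1%:R ^+ d.+1))); last first.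
  by rewrite ltr_pM2l.
rewrite /W (_ : c0 * _ = 4 * 2 ^+ d * C ^+ d.+1 * ((4 * d.+1%:R) * N.+1%:R) ^+ d.+1); last first.
  by rewrite (exprMn _ (4 * d.+1%:R)); field; rewrite gt_eqF.
rewrite ler_pM2l; last first.
  by rewrite !mulr_gt0// ?exprn_gt0// (lt_le_trans ltr01).
by rewrite -natrM -natrM -natrX ler_nat.
Qed.

(** A violation would, by [remez_cover], give a covering of [M] whose total cost is below the
    content of [M] by [remez_scale]. *)
Lemma remez : exists q E : nat, (0 < q)%N /\
  forall N (p : nat -> 'rV[R]_d.+2 -> R) (b : R), (forall k, hpoly k (p k)) ->
  0 <= b -> (forall x, M x -> `|\sum_(k < N.+1) p k x| <= b) ->
  forall x, usphere R d.+2 x ->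
    `|\sum_(k < N.+1) p k x| <= ((q * N.+1) ^ (E * N.+1))%:R * b.
Proof.
have [q0 [a [q00 Hq]]] := remez_scale.
exists (q0 + 8 + 4 * d)%N, (4 + (2 * a + 1) * d.+1)%N; split; first by lia.
move=> N p b hp b0 Mb x Sx; rewrite leNgt; apply/negP => xb.
have m0 : (0 < (q0 * N.+1) ^ a)%N by rewrite expn_gt0 muln_gt0 q00.
have [|c Mc] := remez_cover m0 hp b0 MS Mb Sx.
  apply: le_lt_trans xb; rewrite ler_wpM2r// ler_nat.
  exact: remez_factor_le.
have /andP[d0 _] := delta01.
have alpha0 : 0 < d.+2%:R - 2 + delta.
  by rewrite ltr_wpDl// subr_ge0 ler_nat.
have r0 : 0 < 9 * d.+1%:R ^+ 2 / ((q0 * N.+1) ^ a)%:R :> R.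
  by rewrite divr_gt0 ?ltr0n// mulr_gt0// exprn_gt0.
by have := content_le alpha0 r0 Mc; rewrite leNgt Hq.
Qed.

End remez_content.

(** * Harmonic polynomials *)

(* The directional derivative with its normed-module structures hidden, which
   keeps unification from unfolding them. *)
Definition dd (R : realType) (n : nat) (v : 'rV[R]_n) (f : 'rV[R]_n -> R) :
  'rV[R]_n -> R := fun x => 'D_v f x.

Lemma ddE (R : realType) (n : nat) (v : 'rV[R]_n) (f : 'rV[R]_n -> R) x :
  dd v f x = 'D_v f x.
Proof. by []. Qed.

Lemma laplacianE (R : realType) (n : nat) (f : 'rV[R]_n -> R) x :
  laplacian f x = \sum_i dd (delta_mx ord0 i) (dd (delta_mx ord0 i) f) x.
Proof. by []. Qed.

#[local] Opaque dd.

Section polynomial_functions.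
Context (R : realType) (n : nat).
Implicit Types (f g : 'rV[R]_n -> R) (v x : 'rV[R]_n).

Inductive pfun : ('rV[R]_n -> R) -> Prop :=
| pfun_cst c : pfun (fun=> c)
| pfun_coord i : pfun (fun x => x ord0 i)
| pfunD f g : pfun f -> pfun g -> pfun (fun x => f x + g x)
| pfunM f g : pfun f -> pfun g -> pfun (fun x => f x * g x).

Lemma pfun_differentiable f x : pfun f -> differentiable f x.
Proof.
elim=> {f} [c|i|f g _ df _ dg|f g _ df _ dg].
- exact: differentiable_cst.
- exact: differentiable_coord.
- exact: (differentiableD df dg).
- exact: (differentiableM df dg).
Qed.

Lemma pfun_derivable f x v : pfun f -> derivable f x v.
Proof. by move=> pf; exact/diff_derivable/pfun_differentiable. Qed.

Lemma pfun_continuous f : pfun f -> continuous f.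
Proof. by move=> pf x; exact/differentiable_continuous/pfun_differentiable. Qed.

Lemma derive_pcst (c : R) v x : dd v (fun _ : 'rV[R]_n => c) x = 0.
Proof. rewrite !ddE; exact: derive_cst. Qed.

Lemma derive_pcoord i v x : dd v (fun x : 'rV[R]_n => x ord0 i) x = v ord0 i.
Proof.
have lin : linear (fun x : 'rV[R]_n => x ord0 i : R^o).
  by move=> c u w; rewrite !mxE.
pose L := HB.pack_for {linear 'rV[R]_n -> R^o} (fun x : 'rV[R]_n => x ord0 i : R^o)
  (GRing.isLinear.Build _ _ _ _ _ lin).
rewrite ddE deriveE; last exact: differentiable_coord.
have -> : (fun x : 'rV[R]_n => x ord0 i) = L by [].
by rewrite diff_lin// => y; exact: coord_continuous.
Qed.

Lemma derive_pD f g v x : pfun f -> pfun g ->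
  dd v (fun x => f x + g x) x = dd v f x + dd v g x.
Proof. by move=> pf pg; rewrite !ddE; apply: deriveD; exact: pfun_derivable. Qed.

Lemma derive_pM f g v x : pfun f -> pfun g ->
  dd v (fun x => f x * g x) x = f x * dd v g x + g x * dd v f x.
Proof. by move=> pf pg; rewrite !ddE; apply: deriveM; exact: pfun_derivable. Qed.

Lemma pfun_derive f v : pfun f -> pfun (dd v f).
Proof.
elim=> {f} [c|i|f g pf df pg dg|f g pf df pg dg].
- rewrite (_ : dd v _ = fun=> 0); first exact: pfun_cst.
  by apply/funext => x; rewrite derive_pcst.
- rewrite (_ : dd v _ = fun=> v ord0 i); first exact: pfun_cst.
  by apply/funext => x; rewrite derive_pcoord.
- rewrite (_ : dd v _ = fun x => dd v f x + dd v g x); first exact: pfunD.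
  by apply/funext => x; rewrite derive_pD.
- rewrite (_ : dd v _ = fun x => f x * dd v g x + g x * dd v f x).
    by apply: pfunD; exact: pfunM.
  by apply/funext => x; rewrite derive_pM.
Qed.

Lemma pfunZ c f : pfun f -> pfun (fun x => c * f x).
Proof. by move=> pf; apply: pfunM pf; exact: pfun_cst. Qed.

Lemma derive_pZ c f v x : pfun f -> dd v (fun x => c * f x) x = c * dd v f x.
Proof.
move=> pf; rewrite derive_pM//; last exact: pfun_cst.
by rewrite derive_pcst mulr0 addr0.
Qed.

Lemma pfunX f k : pfun f -> pfun (fun x => f x ^+ k).
Proof.
move=> pf; elim: k => [|k ih].
  rewrite (_ : (fun _ => _) = fun=> 1); first exact: pfun_cst.
  by apply/funext => x; rewrite expr0.
rewrite (_ : (fun _ => _) = fun x => f x * f x ^+ k); first exact: pfunM.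
by apply/funext => x; rewrite exprS.
Qed.

Lemma derive_pX f k v x : pfun f ->
  dd v (fun x => f x ^+ k) x = k%:R * f x ^+ k.-1 * dd v f x.
Proof.
move=> pf; elim: k => [|k ih].
  rewrite (_ : (fun _ => _) = fun=> 1); first by rewrite derive_pcst !mul0r.
  by apply/funext => y; rewrite expr0.
rewrite (_ : (fun _ => _) = fun x => f x * f x ^+ k); last first.
  by apply/funext => y; rewrite exprS.
rewrite derive_pM//; last exact: pfunX.
rewrite ih /= -natr1; case: k {ih} => [|k] /=; first by rewrite !expr0; ring.
by rewrite exprS; ring.
Qed.

Lemma pfun_sum (I : Type) (s : seq I) (F : I -> 'rV[R]_n -> R) :
  (forall i, pfun (F i)) -> pfun (fun x => \sum_(i <- s) F i x).
Proof.
move=> HF; elim: s => [|i s ih].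
  rewrite (_ : (fun _ => _) = (fun=> 0)); first exact: pfun_cst.
  by apply/funext => x; rewrite big_nil.
rewrite (_ : (fun _ => _) = (fun x => F i x + \sum_(i <- s) F i x)).
  exact: pfunD.
by apply/funext => x; rewrite big_cons.
Qed.

Lemma derive_psum (I : Type) (s : seq I) (F : I -> 'rV[R]_n -> R) v x :
  (forall i, pfun (F i)) ->
  dd v (fun x => \sum_(i <- s) F i x) x = \sum_(i <- s) dd v (F i) x.
Proof.
move=> HF; elim: s => [|i s ih].
  rewrite (_ : (fun _ => _) = (fun=> 0)); first by rewrite derive_pcst big_nil.
  by apply/funext => y; rewrite big_nil.
rewrite (_ : (fun _ => _) = (fun x => F i x + \sum_(i <- s) F i x)); last first.
  by apply/funext => y; rewrite big_cons.
by rewrite derive_pD ?ih ?big_cons//; exact: pfun_sum.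
Qed.

Lemma derive_pC f u v x : pfun f -> dd u (dd v f) x = dd v (dd u f) x.
Proof.
move=> pf; elim: pf x => {f} [c|i|f g pf ihf pg ihg|f g pf ihf pg ihg] x.
- have H w : dd w (fun _ : 'rV[R]_n => c) = fun=> 0.
    by apply/funext => y; rewrite derive_pcst.
  by rewrite !H !derive_pcst.
- have H w : dd w (fun x : 'rV[R]_n => x ord0 i) = fun=> w ord0 i.
    by apply/funext => y; rewrite derive_pcoord.
  by rewrite !H !derive_pcst.
- have H w : dd w (fun x => f x + g x) = fun x => dd w f x + dd w g x.
    by apply/funext => y; rewrite derive_pD.
  rewrite (H v) (H u) (derive_pD _ _ (pfun_derive _ pf) (pfun_derive _ pg)).
  by rewrite (derive_pD _ _ (pfun_derive _ pf) (pfun_derive _ pg)) ihf ihg.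
- have H w : dd w (fun x => f x * g x) = fun x => f x * dd w g x + g x * dd w f x.
    by apply/funext => y; rewrite derive_pM.
  have pd := pfun_derive.
  have E u' v' : dd u' (dd v' (fun x => f x * g x)) x =
      f x * dd u' (dd v' g) x + dd v' g x * dd u' f x +
      (g x * dd u' (dd v' f) x + dd v' f x * dd u' g x).
    rewrite (H v'); have -> := derive_pD u' x (pfunM pf (pd _ v' pg)) (pfunM pg (pd _ v' pf)).
    by congr (_ + _); [exact: derive_pM pf (pd _ v' pg)|exact: derive_pM pg (pd _ v' pf)].
  rewrite (E u v) (E v u).
  rewrite ihf ihg.
  move: (dd v (dd u f) x) (dd v (dd u g) x) => A B.
  by move: (dd v g x) (dd v f x) (dd u g x) (dd u f x) (f x) (g x) => *; ring.
Qed.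

Let e i : 'rV[R]_n := delta_mx ord0 i.

Lemma derive_dir f v x : pfun f -> dd v f x = \sum_i v ord0 i * dd (e i) f x.
Proof.
move=> pf; have df := pfun_differentiable x pf.
rewrite ddE {1}(row_sum_delta v) deriveE// linear_sum/=; apply: eq_bigr => i _.
by rewrite ddE linearZ/= deriveE.
Qed.

Lemma hpoly_pfun k f : hpoly k f -> pfun f.
Proof.
elim=> {k f} [c|k i f _ pf|k f g _ pf _ pg|k].
- exact: pfun_cst.
- by apply: pfunM pf; exact: pfun_coord.
- exact: pfunD.
- exact: pfun_cst.
Qed.

Lemma hpoly0_cst f : hpoly 0 f -> exists c, f = fun=> c.
Proof.
have H k g : hpoly k g -> k = 0%N -> exists c, g = fun=> c.
  elim=> {k g} [c|//|k f1 f2 _ ih1 _ ih2 k0|k _].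
  - by move=> _; exists c.
  - by have [c1 ->] := ih1 k0; have [c2 ->] := ih2 k0; exists (c1 + c2).
  - by exists 0.
by move=> /H; apply.
Qed.

Lemma hpoly_derive k f v : hpoly k.+1 f -> hpoly k (dd v f).
Proof.
have H l g : hpoly l g -> forall k, l = k.+1 -> hpoly k (dd v g).
  elim=> {l g} [//|l i g hg ih m [lm]|l g1 g2 h1 ih1 h2 ih2 m lm|l m _].
  - subst m.
    rewrite (_ : dd v _ = fun x => v ord0 i * g x + x ord0 i * dd v g x); last first.
      apply/funext => x; rewrite derive_pM ?derive_pcoord; first by ring.
        exact: pfun_coord.
      exact: hpoly_pfun hg.
    apply: hpolyD; first exact: hpolyZ.
    case: l hg ih => [/hpoly0_cst[c ->] _|l hg ih].
      rewrite (_ : (fun _ => _) = fun=> 0); first exact: hpoly0.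
      by apply/funext => x; rewrite derive_pcst mulr0.
    by apply: hpoly_coord; exact: ih.
  - rewrite (_ : dd v _ = fun x => dd v g1 x + dd v g2 x).
      by apply: hpolyD; [exact: ih1|exact: ih2].
    by apply/funext => x; rewrite derive_pD; [|exact: hpoly_pfun h1|exact: hpoly_pfun h2].
  - rewrite (_ : dd v _ = fun=> 0); first exact: hpoly0.
    by apply/funext => x; rewrite derive_pcst.
by move=> hf; exact: H hf _ erefl.
Qed.

Lemma hpoly0_derive f v : hpoly 0 f -> dd v f = fun=> 0.
Proof. by move=> /hpoly0_cst[c ->]; apply/funext => x; rewrite derive_pcst. Qed.

Lemma hpoly_euler k f x : hpoly k f -> dd x f x = k%:R * f x.
Proof.
elim=> {k f} [c|k i f hf ih|k f g hf ihf hg ihg|k].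
- by rewrite derive_pcst mul0r.
- rewrite derive_pM ?derive_pcoord ?ih; first by rewrite -natr1; ring.
    exact: pfun_coord.
  exact: hpoly_pfun hf.
- by rewrite derive_pD ?ihf ?ihg ?mulrDr//; [exact: hpoly_pfun hf|exact: hpoly_pfun hg].
- by rewrite derive_pcst mulr0.
Qed.

Lemma laplacianD f g x : pfun f -> pfun g ->
  laplacian (fun x => f x + g x) x = laplacian f x + laplacian g x.
Proof.
move=> pf pg; rewrite !laplacianE -big_split; apply: eq_bigr => i _ /=.
rewrite (_ : dd (e i) (fun x => f x + g x) = fun x => dd (e i) f x + dd (e i) g x).
  by rewrite derive_pD//; exact: pfun_derive.
by apply/funext => y; rewrite derive_pD.
Qed.

Lemma laplacianM f g x : pfun f -> pfun g ->
  laplacian (fun x => f x * g x) x = f x * laplacian g x + g x * laplacian f x +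
    2 * \sum_i dd (e i) f x * dd (e i) g x.
Proof.
move=> pf pg; rewrite !laplacianE !mulr_sumr -!big_split; apply: eq_bigr => i _ /=.
rewrite (_ : dd (e i) (fun x => f x * g x) =
    fun x => f x * dd (e i) g x + g x * dd (e i) f x); last first.
  by apply/funext => y; rewrite derive_pM.
have pd := pfun_derive.
have -> := derive_pD (e i) x (pfunM pf (pd _ (e i) pg)) (pfunM pg (pd _ (e i) pf)).
have -> := derive_pM (e i) x pf (pd _ (e i) pg).
have -> := derive_pM (e i) x pg (pd _ (e i) pf).
move: (dd (e i) (dd (e i) f) x) (dd (e i) (dd (e i) g) x) => A B.
by move: (dd (e i) f x) (dd (e i) g x) (f x) (g x) => *; ring.
Qed.

Lemma laplacianZ c f x : pfun f ->
  laplacian (fun x => c * f x) x = c * laplacian f x.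
Proof.
move=> pf; rewrite !laplacianE mulr_sumr; apply: eq_bigr => i _ /=.
rewrite (_ : dd (e i) (fun x => c * f x) = fun x => c * dd (e i) f x).
  by rewrite derive_pZ//; exact: pfun_derive.
by apply/funext => y; rewrite derive_pZ.
Qed.

Lemma laplacian_psum (I : Type) (s : seq I) (F : I -> 'rV[R]_n -> R) x :
  (forall i, pfun (F i)) ->
  laplacian (fun x => \sum_(i <- s) F i x) x = \sum_(i <- s) laplacian (F i) x.
Proof.
move=> HF; rewrite !laplacianE exchange_big/=; apply: eq_bigr => i _.
rewrite (_ : dd (e i) (fun x => \sum_(j <- s) F j x) = fun x => \sum_(j <- s) dd (e i) (F j) x).
  by rewrite derive_psum// => j; exact: pfun_derive.
by apply/funext => y; rewrite derive_psum.
Qed.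

Lemma laplacian_derive f v x : pfun f ->
  laplacian (dd v f) x = dd v (laplacian f) x.
Proof.
move=> pf; rewrite laplacianE.
rewrite (_ : laplacian f = fun x => \sum_i dd (e i) (dd (e i) f) x); last first.
  by apply/funext => y; exact: laplacianE.
rewrite derive_psum; last first.
  by move=> i; exact/pfun_derive/pfun_derive.
apply: eq_bigr => i _.
have H : dd (e i) (dd v f) = dd v (dd (e i) f).
  by apply/funext => y; rewrite derive_pC.
rewrite H; have := @derive_pC (dd (e i) f) (e i) v x (pfun_derive _ pf).
exact.
Qed.

Definition harmonic f := forall x, laplacian f x = 0.

Lemma harmonic_derive f v : pfun f -> harmonic f -> harmonic (dd v f).
Proof.
move=> pf hf x; rewrite laplacian_derive//.
by rewrite (_ : laplacian f = fun=> 0) ?derive_pcst//; apply/funext.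
Qed.

Lemma hpoly_laplacian k f : hpoly k.+2 f -> hpoly k (laplacian f).
Proof.
move=> hf; rewrite (_ : laplacian f = fun x => \sum_i dd (e i) (dd (e i) f) x).
  by apply: hpoly_sum => i _; exact/hpoly_derive/hpoly_derive.
by apply/funext => x; exact: laplacianE.
Qed.

Lemma hpoly_harmonic k f : (k < 2)%N -> hpoly k f -> harmonic f.
Proof.
case: k => [|[|//]] _ hf x; rewrite laplacianE big1// => i _.
  by rewrite (hpoly0_derive _ hf) derive_pcst.
by rewrite (hpoly0_derive _ (hpoly_derive _ hf)).
Qed.

End polynomial_functions.

(** * Decomposition of polynomials into spherical harmonics *)

Section harmonic_decomposition.
Context (R : realType) (n : nat).
Implicit Types (f g h : 'rV[R]_n -> R) (x : 'rV[R]_n).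
Let e i : 'rV[R]_n := delta_mx ord0 i.

Definition r2 x : R := \sum_i x ord0 i ^+ 2.

Lemma pfun_r2 : pfun r2.
Proof. by apply: pfun_sum => i; apply: pfunX; exact: pfun_coord. Qed.

Lemma hpoly_r2 : hpoly 2 r2.
Proof. by apply: hpoly_sum => i _; exact: (hpolyM (hpoly_id _ _) (hpoly_id _ _)). Qed.

Lemma derive_r2 v x : dd v r2 x = 2 * \sum_i x ord0 i * v ord0 i.
Proof.
have -> := @derive_psum R n _ (index_enum 'I_n) (fun i x => x ord0 i ^+ 2) v x
  (fun i => pfunX 2 (pfun_coord R i)).
rewrite mulr_sumr; apply: eq_bigr => i _.
rewrite derive_pX ?derive_pcoord; last exact: pfun_coord.
by rewrite /= expr1 mulrA.
Qed.

Lemma derive_e_r2 i x : dd (e i) r2 x = 2 * x ord0 i.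
Proof.
rewrite derive_r2 (bigD1 i)//= big1 ?addr0.
  by rewrite /e !mxE !eqxx mulr1.
by move=> j ji; rewrite /e !mxE (negPf ji) andbF mulr0.
Qed.

Lemma laplacian_r2 x : laplacian r2 x = 2 * n%:R.
Proof.
rewrite laplacianE (eq_bigr (fun=> 2)); first by rewrite sumr_const card_ord mulr_natr.
move=> i _; rewrite -/(e i).
have -> : dd (e i) r2 = fun x => 2 * x ord0 i by apply/funext => y; exact: derive_e_r2.
rewrite derive_pZ; last exact: pfun_coord.
by rewrite derive_pcoord /e mxE !eqxx mulr1.
Qed.

(** The mixed term 2 (grad r^2 . grad f) = 4 (x . grad f) equals 4 k f by Euler's identity. *)
Lemma laplacian_r2M k f x : hpoly k f ->
  laplacian (fun y => r2 y * f y) x = r2 x * laplacian f x + (2 * n + 4 * k)%:R * f x.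
Proof.
move=> hf; have pf := hpoly_pfun hf.
rewrite (laplacianM x pfun_r2 pf) laplacian_r2.
rewrite (eq_bigr (fun i => 2 * (x ord0 i * dd (e i) f x))); last first.
  by move=> i _; rewrite -/(e i) derive_e_r2 mulrA.
rewrite -mulr_sumr -derive_dir// (hpoly_euler x hf).
rewrite natrD !natrM.
by move: (laplacian f x) (f x) (r2 x) => *; ring.
Qed.

(** That [c] is positive is the point: it lets the Laplacian be inverted on the functions r^(2j)
    h. *)
Lemma laplacian_r2X k j h : (0 < n)%N -> hpoly k h -> harmonic h ->
  exists2 c : R, 0 < c & forall x,
    laplacian (fun y => r2 y ^+ j.+1 * h y) x = c * (r2 x ^+ j * h x).
Proof.
move=> n0 hh harm.
have hr i : hpoly (2 * i + k) (fun y => r2 y ^+ i * h y).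
  apply: hpolyM => //; elim: i => [|i ih]; first exact: hpoly_cst.
  rewrite (_ : (fun _ => _) = fun x => r2 x * r2 x ^+ i).
    by rewrite mulnS; exact: hpolyM hpoly_r2 ih.
  by apply/funext => x; rewrite exprS.
elim: j => [|j [c c0 ih]].
  exists (2 * n + 4 * k)%:R; first by rewrite ltr0n addn_gt0 muln_gt0 n0.
  move=> x; rewrite (_ : (fun _ => _) = fun y => r2 y * h y).
    by rewrite (laplacian_r2M _ hh) harm mulr0 add0r expr0 mul1r.
  by apply/funext => y; rewrite expr1.
exists (c + (2 * n + 4 * (2 * j.+1 + k))%:R); first by rewrite ltr_wpDr.
move=> x; rewrite (_ : (fun _ => _) = fun y => r2 y * (r2 y ^+ j.+1 * h y)).
  by rewrite (laplacian_r2M _ (hr j.+1)) ih exprS; ring.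
by apply/funext => y; rewrite exprS mulrA.
Qed.

Inductive hdecomp : nat -> ('rV[R]_n -> R) -> Prop :=
| hdecomp_r2X k j h : hpoly k h -> harmonic h ->
    hdecomp (k + 2 * j) (fun x => r2 x ^+ j * h x)
| hdecompD k f g : hdecomp k f -> hdecomp k g -> hdecomp k (fun x => f x + g x).

Lemma hdecomp_hpoly k f : hdecomp k f -> hpoly k f.
Proof.
elim=> {k f} [k j h hh _|k f g _ hf _ hg]; last exact: hpolyD.
rewrite addnC; apply: hpolyM => //; elim: j => [|j ih]; first exact: hpoly_cst.
rewrite (_ : (fun _ => _) = fun x => r2 x * r2 x ^+ j).
  by rewrite mulnS; exact: hpolyM hpoly_r2 ih.
by apply/funext => x; rewrite exprS.
Qed.

Lemma hdecomp_laplacian k f : (0 < n)%N -> hdecomp k f ->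
  exists2 g, hdecomp k.+2 g & forall x, laplacian g x = f x.
Proof.
move=> n0; elim=> {k f} [k j h hh harm|k f g df [F dF LF] dg [G dG LG]].
  have [c c0 Hc] := laplacian_r2X j n0 hh harm.
  exists (fun x => r2 x ^+ j.+1 * (c^-1 * h x)).
    have -> : (k + 2 * j).+2 = (k + 2 * j.+1)%N by lia.
    apply: hdecomp_r2X; first exact: hpolyZ.
    by move=> x; rewrite laplacianZ ?harm ?mulr0//; exact: hpoly_pfun hh.
  move=> x; rewrite (_ : (fun _ => _) = fun x => c^-1 * (r2 x ^+ j.+1 * h x)).
    rewrite laplacianZ; first by rewrite Hc mulKf// gt_eqF.
    by apply: pfunM (hpoly_pfun hh); apply: pfunX; exact: pfun_r2.
  by apply/funext => y; rewrite mulrCA.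
exists (fun x => F x + G x); first exact: hdecompD.
move=> x; rewrite laplacianD ?LF ?LG//.
  exact: hpoly_pfun (hdecomp_hpoly dF).
exact: hpoly_pfun (hdecomp_hpoly dG).
Qed.

(** Induction on the degree in steps of two: the Laplacian of [f] is decomposable, hence has a
    decomposable preimage [g], and f - g is harmonic. *)
Lemma hpoly_hdecomp k f : (0 < n)%N -> hpoly k f -> hdecomp k f.
Proof.
move=> n0; have small l g : (l < 2)%N -> hpoly l g -> hdecomp l g.
  move=> l2 hg; rewrite (_ : g = fun x => r2 x ^+ 0 * g x).
    have := @hdecomp_r2X l 0 g hg (hpoly_harmonic l2 hg).
    by rewrite muln0 addn0.
  by apply/funext => x; rewrite expr0 mul1r.
elim/ltn_ind: k f => -[|[|k]] ih f hf; [exact: small|exact: small|].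
have [g dg Lg] := hdecomp_laplacian n0 (ih k (ltnW (ltnSn _)) _ (hpoly_laplacian hf)).
have hg := hdecomp_hpoly dg.
rewrite (_ : f = fun x => g x + r2 x ^+ 0 * (f x + (- 1) * g x)); last first.
  by apply/funext => x; rewrite expr0; ring.
apply: hdecompD => //.
suff H : harmonic (fun x => f x + (- 1) * g x).
  have := @hdecomp_r2X k.+2 0 _ (hpolyD hf (hpolyZ (- 1) hg)) H.
  by rewrite muln0 addn0.
move=> x; rewrite laplacianD ?laplacianZ ?Lg; [ring|..].
- exact: hpoly_pfun hg.
- exact: hpoly_pfun hf.
- by apply: pfunZ; exact: hpoly_pfun hg.
Qed.

Definition sphere_harmonics f := exists m (q : nat -> 'rV[R]_n -> R),
  (forall k, hpoly k (q k) /\ harmonic (q k)) /\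
  forall x, usphere R n x -> f x = \sum_(k < m) q k x.

Lemma harmonic0 : harmonic (fun _ : 'rV[R]_n => 0).
Proof.
move=> x; rewrite laplacianE big1// => i _.
rewrite (_ : dd _ (fun=> 0) = fun=> 0) ?derive_pcst//.
by apply/funext => y; rewrite derive_pcst.
Qed.

Lemma sphere_harmonicsD f g : sphere_harmonics f -> sphere_harmonics g ->
  sphere_harmonics (fun x => f x + g x).
Proof.
move=> [m [q [hq fq]]] [m' [q' [hq' gq']]].
exists (m + m')%N, (fun k x => (if (k < m)%N then q k x else 0) +
  (if (k < m')%N then q' k x else 0)); split.
  move=> k; have [[hk ak] [hk' ak']] := (hq k, hq' k).
  have H : forall (b : bool) (p : 'rV[R]_n -> R), hpoly k p -> harmonic p ->
      hpoly k (fun x => if b then p x else 0) /\ harmonic (fun x => if b then p x else 0).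
    by move=> [] p hp ap /=; [split|split; [exact: hpoly0|exact: harmonic0]].
  have [h1 a1] := H (k < m)%N _ hk ak; have [h2 a2] := H (k < m')%N _ hk' ak'.
  split; first exact: hpolyD.
  by move=> x; rewrite laplacianD ?a1 ?a2 ?addr0//;
    [exact: hpoly_pfun h1|exact: hpoly_pfun h2].
move=> x Sx; rewrite fq// gq'// big_split/=; congr (_ + _).
  by rewrite -big_mkcond (big_ord_widen _ (fun k => q k x) (leq_addr m' m)).
by rewrite -big_mkcond (big_ord_widen _ (fun k => q' k x) (leq_addl m m')).
Qed.

Lemma hdecomp_harmonics k f : hdecomp k f -> sphere_harmonics f.
Proof.
elim=> {k f} [k j h hh harm|k f g _ hf _ hg]; last exact: sphere_harmonicsD.
exists k.+1, (fun i x => if i == k then h x else 0); split.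
  move=> i; case: eqVneq => [->//|_].
  by split; [exact: hpoly0|exact: harmonic0].
move=> x /usphereP; rewrite -/(r2 x) => ->; rewrite expr1n mul1r.
by rewrite -big_mkcond/= (big_pred1 ord_max).
Qed.

Inductive hsum : ('rV[R]_n -> R) -> Prop :=
| hsum_hpoly k h : hpoly k h -> hsum h
| hsumD f g : hsum f -> hsum g -> hsum (fun x => f x + g x).

Lemma hsumM f g : hsum f -> hsum g -> hsum (fun x => f x * g x).
Proof.
move=> hf hg; elim: hf => {f} [k f hf|f f' _ ih _ ih'].
  elim: hg => {g} [l g hg|g g' _ ih _ ih'].
    exact: hsum_hpoly (hpolyM hf hg).
  rewrite (_ : (fun _ => _) = fun x => f x * g x + f x * g' x); first exact: hsumD.
  by apply/funext => x; rewrite mulrDr.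
rewrite (_ : (fun _ => _) = fun x => f x * g x + f' x * g x); first exact: hsumD.
by apply/funext => x; rewrite mulrDl.
Qed.

Lemma pfun_hsum f : pfun f -> hsum f.
Proof.
elim=> {f} [c|i|f g _ hf _ hg|f g _ hf _ hg].
- exact: hsum_hpoly (hpoly_cst _ _).
- exact: hsum_hpoly (hpoly_id _ _).
- exact: hsumD.
- exact: hsumM.
Qed.

Lemma pfun_harmonics f : (0 < n)%N -> pfun f -> sphere_harmonics f.
Proof.
move=> n0 /pfun_hsum; elim=> {f} [k h hh|f g _ hf _ hg].
  exact: hdecomp_harmonics (hpoly_hdecomp n0 hh).
exact: sphere_harmonicsD.
Qed.

End harmonic_decomposition.

(** * Maximum principle in the ball and Bernstein estimates *)

Section second_derivative_test.
Context (R : realType) (V : normedModType R).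
Implicit Types (f : V -> R) (x v : V).

Lemma is_derive_line f x v (s : R) : derivable f (s *: v + x) v ->
  is_derive s (1 : R) (fun t : R => f (t *: v + x)) ('D_v f (s *: v + x)).
Proof.
have E : (fun h : R => h^-1 *: (((fun t : R => f (t *: v + x)) \o shift s)
      (h *: (1 : R)) - f (s *: v + x))) =
    (fun h => h^-1 *: ((f \o shift (s *: v + x)) (h *: v) - f (s *: v + x))).
  by apply/funext => h /=; rewrite [h *: 1]mulr1 scalerDl addrA.
move=> df; apply: DeriveDef; first by rewrite /derivable E.
by rewrite /derive E.
Qed.

(** A positive second derivative at [x], where the first one vanishes, makes the first derivative
    positive slightly further along [v], and the mean value theorem then gives a value above the
    maximum. *)
Lemma derive2_at_max f x v (r : R) : 0 < r ->
  (forall s : R, `|s| < r -> derivable f (s *: v + x) v) -> derivable ('D_v f) x v ->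
  (forall s : R, `|s| < r -> f (s *: v + x) <= f x) -> 'D_v ('D_v f) x <= 0.
Proof.
move=> r0 df ddf fmax; rewrite leNgt; apply/negP => D0.
pose phi t := f (t *: v + x).
have dphi s : `|s| < r -> is_derive s (1 : R) phi ('D_v f (s *: v + x)).
  by move=> sr; apply: is_derive_line; exact: df.
have in_r t : t \in `]- r, r[ -> `|t| < r by rewrite in_itv/= -ltr_norml.
have Df0 : 'D_v f x = 0.
  have d0 : is_derive (0 : R) (1 : R) phi 0.
    apply: (@derive1_at_max _ phi (- r) r).
    - by rewrite lerNl (le_trans _ (ltW r0))// oppr_le0 ltW.
    - by move=> t /in_r/dphi dt; exact: ex_derive.
    - by rewrite in_itv/= oppr_lt0 r0.
    - by move=> t /in_r /fmax; rewrite /phi scale0r add0r.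
  have d1 := dphi 0 _; rewrite normr0 scale0r add0r in d1.
  by rewrite -(@derive_val _ _ _ _ _ _ _ (d1 r0)) (@derive_val _ _ _ _ _ _ _ d0).
have /cvgr_gt/(_ _ D0)[r' /= r'0 Hr'] := ddf.
pose h := Num.min r r' / 2.
have h0 : 0 < h by rewrite divr_gt0// lt_min r0.
have hr : h < r.
  by rewrite ltr_pdivrMr// mulr_natr mulr2n (@le_lt_trans _ _ r)// ?ge_min ?lexx// ltrDl.
have dpos s : 0 < s <= h -> 0 < 'D_v f (s *: v + x).
  move=> /andP[s0 sh].
  have := Hr' s; rewrite /ball_/= sub0r normrN (gtr0_norm s0) Df0 subr0.
  rewrite /= gt_eqF// => /(_ _ isT).
  rewrite pmulr_rgt0 ?invr_gt0//; apply.
  rewrite (le_lt_trans sh)// /h ltr_pdivrMr// mulr_natr mulr2n.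
  by rewrite (@le_lt_trans _ _ r')// ?ge_min ?lexx ?orbT// ltrDl.
have [||c] := @MVT _ phi (fun s => 'D_v f (s *: v + x)) 0 h h0.
- move=> s; rewrite in_itv/= => /andP[s0 sh]; apply: dphi.
  by rewrite gtr0_norm// (lt_trans sh).
- apply: derivable_within_continuous => s; rewrite in_itv/= => /andP[s0 sh].
  have := dphi s; rewrite ger0_norm// => /(_ (le_lt_trans sh hr)) ds.
  exact: ex_derive.
rewrite in_itv/= => /andP[c0 ch]; rewrite subr0 => E.
have : 0 < phi h - phi 0 by rewrite E mulr_gt0// dpos// c0 ltW.
by rewrite subr_gt0 /phi scale0r add0r ltNge fmax// gtr0_norm.
Qed.

End second_derivative_test.

Section ball_maximum_principle.
Context (R : realType) (n : nat).
Implicit Types (f g : 'rV[R]_n -> R) (x : 'rV[R]_n).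
Let e i : 'rV[R]_n := delta_mx ord0 i.

Lemma usphere_r2 x : usphere R n x <-> r2 x = 1.
Proof. exact: usphereP. Qed.

Lemma r2_ge0 x : 0 <= r2 x.
Proof. by apply: sumr_ge0 => i _; exact: sqr_ge0. Qed.

Lemma coord_le_r2 x i : x ord0 i ^+ 2 <= r2 x.
Proof.
rewrite /r2 (bigD1 i)//= lerDl; apply: sumr_ge0 => j _; exact: sqr_ge0.
Qed.

Lemma r2_bounded (A : set 'rV[R]_n) (c : R) : (forall x, A x -> r2 x <= c) ->
  bounded_set A.
Proof.
move=> Ac; exists (1 + c); split; first exact: num_real.
move=> M cM x /= /Ac xc; rewrite [leLHS]/Num.norm/= mx_normrE.
have c0 : 0 <= c by exact: le_trans (r2_ge0 x) xc.
apply/bigmax_leP; split; first by rewrite ltW// (le_lt_trans _ cM)// addr_ge0.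
move=> [i j] _ /=; rewrite (ord1 i); have xj := le_trans (coord_le_r2 x j) xc.
rewrite (le_trans _ (ltW cM))//.
rewrite -(@ler_sqr _ `|_|) ?nnegrE ?addr_ge0// real_normK ?num_real//.
by rewrite (le_trans xj)//; nra.
Qed.

Lemma compact_closed_r2 (A : set R) (c : R) : closed A -> A `<=` [set t | t <= c] ->
  compact [set x : 'rV[R]_n | A (r2 x)].
Proof.
move=> cA Ac; apply: bounded_closed_compact.
  by apply: (@r2_bounded _ c) => x /= /Ac.
apply: (@closed_comp _ _ (@r2 R n) A) => // x _.
exact: pfun_continuous (pfun_r2 R n) x.
Qed.

Lemma compact_usphere : compact (usphere R n).
Proof.
rewrite (_ : usphere R n = [set x | [set 1 : R] (r2 x)]).
  by apply: (@compact_closed_r2 _ 1); [exact: closed_eq|move=> t ->/=].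
by apply/seteqP; split => x /=; rewrite -usphere_r2.
Qed.

Lemma line_near (P : set 'rV[R]_n) x v : (\forall y \near x, P y) ->
  exists2 r : R, 0 < r & forall s : R, `|s| < r -> P (s *: v + x).
Proof.
move=> Px.
have : (fun s : R => s *: v + x) @ (0 : R) --> x.
  have : (fun s : R => s *: v + x) @ (0 : R) --> 0 *: v + x.
    apply: cvgD; last exact: cvg_cst.
    by apply: cvgZ; [exact: cvg_id|exact: cvg_cst].
  by rewrite scale0r add0r.
move=> /(_ _ Px)[r /= r0 Hr]; exists r => // s sr; apply: (Hr s).
by rewrite /ball_/= sub0r normrN.
Qed.

Lemma pfun_laplacian_at_max f x : pfun f ->
  (\forall y \near x, f y <= f x) -> laplacian f x <= 0.
Proof.
move=> pf fx; apply: sumr_le0 => i _.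
have [r r0 Hr] := line_near (e i) fx.
apply: (derive2_at_max r0).
- by move=> s _; exact: pfun_derivable.
- have := @pfun_derivable _ _ _ x (e i) (pfun_derive (e i) pf).
  have -> : dd (e i) f = 'D_(e i) f by apply/funext => y; rewrite ddE.
  exact.
- exact: Hr.
Qed.

(** Adding [d] times r^2 makes the Laplacian strictly positive, which forbids an interior maximum.
    As [d] is half the excess of [f 0] over [c], the sum on the sphere still stays below [f 0]. *)
Lemma subharmonic_max f (c : R) : (0 < n)%N -> pfun f ->
  (forall x, r2 x < 1 -> 0 <= laplacian f x) ->
  (forall x, usphere R n x -> f x <= c) -> f 0 <= c.
Proof.
move=> n0 pf sub fc; rewrite leNgt; apply/negP => cf0.
pose d := (f 0 - c) / 2; have d0 : 0 < d by rewrite divr_gt0// subr_gt0.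
pose g x := f x + d * r2 x.
have pg : pfun g by apply: pfunD => //; apply: pfunZ; exact: pfun_r2.
have r20 : r2 (0 : 'rV[R]_n) = 0 by rewrite /r2 big1// => i _; rewrite mxE expr0n.
have [|||x0] := @compact_EVT_max _ R g [set x : 'rV[R]_n | [set t : R | t <= 1] (r2 x)].
- by exists 0; rewrite /= r20.
- by apply: (@compact_closed_r2 _ 1) => //; exact: closed_le.
- by apply: continuous_subspaceT; exact: pfun_continuous.
rewrite inE/= => rx0 gmax.
have g0 : f 0 <= g x0.
  by rewrite (le_trans _ (gmax 0 _)) ?inE/= ?r20// /g r20 mulr0 addr0.
have [rx1|rx1] := eqVneq (r2 x0) 1.
  move: g0; rewrite leNgt => /negP; apply.
  rewrite /g rx1 mulr1 (@le_lt_trans _ _ (c + d))//.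
    by rewrite lerD2r fc//; exact/usphere_r2.
  by rewrite /d; lra.
have {}rx0 : r2 x0 < 1 by rewrite lt_neqAle rx1.
have := pfun_laplacian_at_max (x := x0) pg.
have /[swap]/[apply] : \forall y \near x0, g y <= g x0.
  have := pfun_continuous (pfun_r2 R n) (x := x0).
  move=> /cvgr_lt/(_ _ rx0); apply: filterS => y y1.
  by apply: gmax; rewrite inE/= ltW.
rewrite leNgt => /negP; apply.
rewrite /g laplacianD//; last by apply: pfunZ; exact: pfun_r2.
rewrite laplacianZ; last exact: pfun_r2.
rewrite laplacian_r2; apply: ltr_wpDl; first exact: sub.
by apply: mulr_gt0 => //; apply: mulr_gt0; rewrite ltr0n.
Qed.

End ball_maximum_principle.

(** * A Bernstein estimate at the centre of the ball *)

Section bernstein.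
Context (R : realType) (n : nat) (n0 : (0 < n)%N).
Implicit Types (f g : 'rV[R]_n -> R) (x u : 'rV[R]_n).
Let e i : 'rV[R]_n := delta_mx ord0 i.

Let w x : R := 1 - r2 x.
(** Dictated by [laplacian_cutoff]: with p + 2 = 2 (k + 1), the losses 16 (p + 2)^2 and 2 n (p + 2)
    are at most 64 (k + 1)^2 and 4 n (k + 1)^2. *)
Let A : R := (64 + 4 * n)%:R.

Let A0 : 0 < A. Proof. by rewrite ltr0n addn_gt0. Qed.

Let pfun_w : pfun w.
Proof.
rewrite (_ : w = fun x => 1 + (- 1) * r2 x).
  by apply: pfunD; [exact: pfun_cst|apply: pfunZ; exact: pfun_r2].
by apply/funext => x; rewrite mulN1r.
Qed.

Let derive_w i x : dd (e i) w x = - (2 * x ord0 i).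
Proof.
rewrite (_ : w = fun x => 1 + (- 1) * r2 x); last first.
  by apply/funext => y; rewrite mulN1r.
rewrite derive_pD; [|exact: pfun_cst|by apply: pfunZ; exact: pfun_r2].
rewrite derive_pcst derive_pZ; last exact: pfun_r2.
by rewrite derive_e_r2 add0r mulN1r.
Qed.

Let derive_wX p i x :
  dd (e i) (fun x => w x ^+ p.+2) x = - (2 * p.+2%:R) * (w x ^+ p.+1 * x ord0 i).
Proof. by rewrite derive_pX// derive_w /=; ring. Qed.

Let derive2_wX p i x : dd (e i) (dd (e i) (fun x => w x ^+ p.+2)) x =
  4 * p.+2%:R * p.+1%:R * x ord0 i ^+ 2 * w x ^+ p - 2 * p.+2%:R * w x ^+ p.+1.
Proof.
have -> : dd (e i) (fun x => w x ^+ p.+2) =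
    fun x => - (2 * p.+2%:R) * (w x ^+ p.+1 * x ord0 i).
  by apply/funext => y; rewrite derive_wX.
rewrite derive_pZ; last by apply: pfunM; [exact: pfunX|exact: pfun_coord].
rewrite derive_pM; [|exact: pfunX|exact: pfun_coord].
rewrite derive_pcoord derive_pX// derive_w /e mxE !eqxx /=.
by ring.
Qed.

Let harmonic_sqr g x : pfun g -> harmonic g ->
  laplacian (fun x => g x ^+ 2) x = 2 * \sum_i dd (e i) g x ^+ 2.
Proof.
move=> pg hg; rewrite (_ : (fun _ => _) = fun x => g x * g x); last first.
  by apply/funext => y; rewrite expr2.
by rewrite (laplacianM _ pg pg) hg mulr0 add0r add0r.
Qed.

Let laplacian_cutoff g x k : pfun g -> harmonic g -> r2 x < 1 ->
  w x ^+ (2 * k.+1) * (\sum_i dd (e i) g x ^+ 2) -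
    A * k.+1%:R ^+ 2 * w x ^+ (2 * k) * g x ^+ 2 <=
  laplacian (fun x => w x ^+ (2 * k.+1) * g x ^+ 2) x.
Proof.
move=> pg hg x1; set p := (2 * k)%N.
have -> : (2 * k.+1 = p.+2)%N by rewrite /p mulnS.
have wx0 : 0 < w x by rewrite subr_gt0.
have wx1 : w x <= 1 by rewrite gerBl r2_ge0.
rewrite laplacianM; [|exact: pfunX|exact: pfunX].
rewrite (harmonic_sqr x pg hg) (laplacianE (fun x => w x ^+ p.+2)).
pose T i := w x ^+ p.+2 * dd (e i) g x ^+ 2 -
  (16 * p.+2%:R ^+ 2) * x ord0 i ^+ 2 * w x ^+ p * g x ^+ 2 -
  2 * p.+2%:R * w x ^+ p.+1 * g x ^+ 2.
apply: (@le_trans _ _ (\sum_i T i)).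
  have -> : \sum_i T i = w x ^+ p.+2 * (\sum_i dd (e i) g x ^+ 2) -
      (16 * p.+2%:R ^+ 2) * r2 x * w x ^+ p * g x ^+ 2 -
      n%:R * (2 * p.+2%:R * w x ^+ p.+1 * g x ^+ 2).
    rewrite /T !sumrB -mulr_sumr; congr (_ - _ - _).
      by rewrite -!mulr_suml -mulr_sumr.
    by rewrite sumr_const card_ord -[LHS]mulr_natl.
  rewrite -[leRHS]addrA lerD2l -opprD lerN2.
  apply: (@le_trans _ _ ((16 * p.+2%:R ^+ 2 + n%:R * (2 * p.+2%:R)) *
      (w x ^+ p * g x ^+ 2))).
    rewrite [leRHS]mulrDl; apply: lerD.
      rewrite -!mulrA; do 3 (apply: ler_wpM2l => //).
      by rewrite ler_piMl ?(ltW x1)// mulr_ge0 ?sqr_ge0// exprn_ge0// ltW.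
    rewrite -!mulrA; do 3 (apply: ler_wpM2l => //).
    apply: ler_wpM2r; first exact: sqr_ge0.
    by rewrite exprS ler_piMl// exprn_ge0// ltW.
  have wg : 0 <= w x ^+ p * g x ^+ 2 by rewrite mulr_ge0 ?sqr_ge0// exprn_ge0// ltW.
  rewrite -[leRHS]mulrA; apply: ler_wpM2r => //.
  rewrite (_ : p.+2%:R = 2 * k.+1%:R); last by rewrite -natrM mulnS.
  have -> : A = 64 + 4 * n%:R by rewrite /A natrD natrM.
  rewrite [leRHS]mulrDl; apply: lerD; first by rewrite le_eqVlt; apply/orP; left; apply/eqP; ring.
  rewrite (_ : n%:R * _ = 4 * n%:R * k.+1%:R); last by ring.
  by rewrite ler_wpM2l// expr2 ler_peMr// ler1n.
have -> : w x ^+ p.+2 * (2 * \sum_i dd (e i) g x ^+ 2) + g x ^+ 2 *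
    (\sum_i dd (e i) (dd (e i) (fun x => w x ^+ p.+2)) x) +
    2 * (\sum_i dd (e i) (fun x => w x ^+ p.+2) x * dd (e i) (fun x => g x ^+ 2) x) =
    \sum_i (w x ^+ p.+2 * (2 * dd (e i) g x ^+ 2) +
      g x ^+ 2 * dd (e i) (dd (e i) (fun x => w x ^+ p.+2)) x +
      2 * (dd (e i) (fun x => w x ^+ p.+2) x * dd (e i) (fun x => g x ^+ 2) x)).
  by rewrite !big_split/= -!mulr_sumr.
apply: ler_sum => i _.
rewrite derive2_wX derive_wX derive_pX//= expr1 /T.
have e2 : w x ^+ p.+2 = w x * (w x * w x ^+ p) by rewrite !exprS.
have e1 : w x ^+ p.+1 = w x * w x ^+ p by rewrite exprS.
rewrite e2 e1.
have wp : 0 <= w x ^+ p by rewrite exprn_ge0// ltW.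
move: (dd (e i) g x) (x ord0 i) (g x) (w x) wx0 wp => a b c d d0 W0.
rewrite -subr_ge0.
rewrite [X in 0 <= X](_ : _ = d ^+ p * (d * a - 4 * p.+2%:R * (b * c)) ^+ 2 +
  4 * p.+2%:R * p.+1%:R * (d ^+ p * (b * c) ^+ 2)).
  apply: addr_ge0; first by apply: mulr_ge0 => //; exact: sqr_ge0.
  apply: mulr_ge0; first by rewrite !mulr_ge0.
  by apply: mulr_ge0 => //; exact: sqr_ge0.
by ring.
Qed.

(* Phi is subharmonic in the ball, equal to g^2 on the sphere, and its last term
   at 0 is the square of the k-th derivative of g, up to the constant. *)
Let Phi u g k x := \sum_(j < k.+1)
  (A ^+ j * (j`!)%:R ^+ 2)^-1 * (w x ^+ (2 * j) * (iter j (dd u) g x) ^+ 2).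

Let pfun_iter u g j : pfun g -> pfun (iter j (dd u) g).
Proof. by move=> pg; elim: j => //= j ih; exact: pfun_derive. Qed.

Let harmonic_iter u g j : pfun g -> harmonic g -> harmonic (iter j (dd u) g).
Proof.
move=> pg hg; elim: j => [|j ih]; first exact: hg.
exact: harmonic_derive (pfun_iter u j pg) ih.
Qed.

Let pfun_term u g j c : pfun g ->
  pfun (fun x => c * (w x ^+ (2 * j) * (iter j (dd u) g x) ^+ 2)).
Proof.
move=> pg; apply: pfunZ; apply: pfunM; first exact: pfunX.
exact/pfunX/pfun_iter.
Qed.

(** The sum telescopes: the negative term of level k + 1 involves the square of the [u]-derivative
    of level k, at most its squared gradient since [u] is a unit vector, and the coefficients let
    the gradient kept at level k compensate it. *)
Let laplacian_Phi u g k x : pfun g -> harmonic g -> usphere R n u -> r2 x < 1 ->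
  (A ^+ k * (k`!)%:R ^+ 2)^-1 * (w x ^+ (2 * k) *
    \sum_i dd (e i) (iter k (dd u) g) x ^+ 2) <= laplacian (Phi u g k) x.
Proof.
move=> pg hg Su x1.
have pi j := pfun_iter u j pg; have hi j := harmonic_iter u j pg hg.
elim: k => [|k ih].
  rewrite (_ : Phi u g 0 = fun x => g x ^+ 2); last first.
    apply/funext => y; rewrite /Phi big_ord1 /=.
    by rewrite fact0 !expr0 expr1n !mulr1 invr1 !mul1r.
  rewrite harmonic_sqr//= fact0 expr0 expr1n mulr1 invr1 muln0 expr0 !mul1r.
  by rewrite ler_peMl ?ler1n// sumr_ge0// => i _; exact: sqr_ge0.
rewrite (_ : Phi u g k.+1 = fun x => Phi u g k x +
   (A ^+ k.+1 * (k.+1`!)%:R ^+ 2)^-1 *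
     (w x ^+ (2 * k.+1) * (iter k.+1 (dd u) g x) ^+ 2)); last first.
  by apply/funext => y; rewrite /Phi big_ord_recr.
rewrite laplacianD; [|by apply: pfun_sum => j; exact: pfun_term|exact: pfun_term].
rewrite laplacianZ; last by apply: pfunM; apply: pfunX => //; exact: pi.
set c := (A ^+ k * (k`!)%:R ^+ 2)^-1 in ih.
have c0 : 0 < c by rewrite invr_gt0 mulr_gt0 ?exprn_gt0// ltr0n fact_gt0.
have cS : (A ^+ k.+1 * (k.+1`!)%:R ^+ 2)^-1 = c / (A * k.+1%:R ^+ 2).
  by rewrite /c factS natrM exprMn exprS -invfM; congr (_^-1); ring.
rewrite cS; set c' := c / _.
have c'0 : 0 < c' by rewrite divr_gt0// mulr_gt0// exprn_gt0.
have := ler_wpM2l (ltW c'0) (laplacian_cutoff k (pi k.+1) (hi k.+1) x1).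
move/(lerD ih); apply: le_trans.
rewrite mulrBr addrCA lerDl subr_ge0.
rewrite (_ : c' * _ = c * (w x ^+ (2 * k) * iter k.+1 (dd u) g x ^+ 2)); last first.
  by rewrite /c'; field; rewrite gt_eqF ?gt_eqF//= nat1r pnatr_eq0.
apply: ler_wpM2l; first exact: ltW.
apply: ler_wpM2l; first by rewrite exprn_ge0// subr_ge0 ltW.
rewrite /= (derive_dir u x (pi k)) (le_trans (cauchy_schwarz _ _))//.
by move/usphere_r2: Su; rewrite -/(r2 u) => ->; rewrite mul1r.
Qed.

Lemma bernstein u g k (b : R) : pfun g -> harmonic g -> usphere R n u ->
  (forall x, usphere R n x -> `|g x| <= b) ->
  `|iter k (dd u) g 0| <= A ^+ k * (k`!)%:R * b.
Proof.
move=> pg hg Su gb.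
have b0 : 0 <= b by apply: le_trans (gb u Su).
have : Phi u g k 0 <= b ^+ 2.
  apply: subharmonic_max => //.
  - by apply: pfun_sum => j; exact: pfun_term.
  - move=> x x1; apply: le_trans (laplacian_Phi k pg hg Su x1).
    rewrite mulr_ge0//; first by rewrite invr_ge0 mulr_ge0 ?exprn_ge0// ltW.
    rewrite mulr_ge0//; first by rewrite exprn_ge0// subr_ge0 ltW.
    by apply: sumr_ge0 => i _; exact: sqr_ge0.
  - move=> x Sx; rewrite /Phi big_ord_recl big1.
      rewrite /= fact0 muln0 !expr0 expr1n mulr1 invr1 !mul1r addr0.
      by rewrite -[leLHS]real_normK ?num_real// ler_sqr ?nnegrE// gb.
    move=> j _; rewrite /w; have -> := (usphere_r2 x).1 Sx.
    by rewrite subrr expr0n/= mul0r mulr0.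
have w0 : w 0 = 1.
  by rewrite /w /r2 big1 ?subr0// => i _; rewrite mxE expr0n.
rewrite /Phi big_ord_recr/= w0 expr1n mul1r => H.
have {}H : (A ^+ k * (k`!)%:R ^+ 2)^-1 * iter k (dd u) g 0 ^+ 2 <= b ^+ 2.
  apply: le_trans H; rewrite lerDr; apply: sumr_ge0 => j _.
  rewrite expr1n mul1r mulr_ge0 ?sqr_ge0// invr_ge0 mulr_ge0 ?exprn_ge0// ltW.
have kf0 : 0 < (k`!)%:R :> R by rewrite ltr0n fact_gt0.
rewrite ler_pdivrMl ?mulr_gt0 ?exprn_gt0// in H.
rewrite -(@ler_sqr _ `|_|) ?nnegrE ?mulr_ge0 ?exprn_ge0 ?(ltW A0)//.
rewrite real_normK ?num_real// (le_trans H)// !exprMn.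
apply: ler_wpM2r; first exact: sqr_ge0.
apply: ler_wpM2r; first exact: sqr_ge0.
(* The argument gives the square root of [A ^+ k]; [A >= 1] is used to dispense with the root. *)
rewrite expr2 ler_peMr ?exprn_ge0 ?(ltW A0)// exprn_ege1//.
by rewrite ler1n addn_gt0.
Qed.

Lemma iter_derive_hpoly u k j f : hpoly (k + j) f -> hpoly k (iter j (dd u) f).
Proof.
elim: j k => [|j ih] k /=; first by rewrite addn0.
by rewrite addnS -addSn => /ih; exact: hpoly_derive.
Qed.

Lemma iter_derive_hpoly_eq0 u k j f : hpoly k f -> (k < j)%N ->
  iter j (dd u) f = fun=> 0.
Proof.
move=> hf kj; have Z l : iter l (dd u) (fun=> 0) = fun=> 0.
  by elim: l => //= l ->; apply/funext => x; rewrite derive_pcst.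
rewrite -(subnK kj) iterD iterS.
have := @iter_derive_hpoly u 0 k f; rewrite add0n => /(_ hf) h0.
by rewrite (hpoly0_derive _ h0) Z.
Qed.

(** Euler's identity at the point [u] itself, applied to each successive derivative, whose degree
    drops by one every time. *)
Lemma iter_derive_hpoly_diag u k j f : hpoly (k + j) f ->
  (k`!)%:R * iter j (dd u) f u = ((k + j)`!)%:R * f u.
Proof.
elim: j k => [|j ih] k /= hf; first by rewrite addn0.
rewrite addnS -addSn in hf; rewrite addnS -addSn -(ih _ hf) factS natrM.
by rewrite (hpoly_euler u (iter_derive_hpoly u hf)) mulrA [_ * k.+1%:R]mulrC.
Qed.

(* The k-th component of a harmonic function, as its k-th radial derivative at
   the centre of the ball. *)
Lemma harmonic_component m (q : nat -> 'rV[R]_n -> R) (b : R) u k :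
  (forall k, hpoly k (q k) /\ harmonic (q k)) ->
  (forall x, usphere R n x -> `|\sum_(j < m) q j x| <= b) ->
  usphere R n u -> (k < m)%N -> `|q k u| <= A ^+ k * b.
Proof.
move=> hq qb Su km.
have pq j : pfun (q j) by exact: hpoly_pfun (hq j).1.
pose g x := \sum_(j < m) q j x.
have pg : pfun g by apply: pfun_sum => j.
have hg : harmonic g.
  move=> x; rewrite laplacian_psum => [|j]; last exact: pq.
  by rewrite big1// => j _; have [_ ->] := hq j.
have iE l x : iter l (dd u) g x = \sum_(j < m) iter l (dd u) (q j) x.
  elim: l x => // l ih x /=.
  have -> : iter l (dd u) g = fun x => \sum_(j < m) iter l (dd u) (q j) x.
    exact/funext.
  by rewrite derive_psum// => j; exact: pfun_iter.
have := bernstein k pg hg Su qb.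
rewrite iE (bigD1 (Ordinal km))//= big1 ?addr0; last first.
  move=> j; rewrite -val_eqE/= => jk.
  have [kj|kj|/eqP] := ltngtP k j; last by rewrite eq_sym (negPf jk).
    have hj := (hq j).1; rewrite -(subnK (ltnW kj)) in hj.
    have := hpoly_scale 0 0 (iter_derive_hpoly u hj).
    by rewrite scale0r expr0n subn_eq0 leqNgt kj/= mul0r subnK// ltnW.
  by rewrite (iter_derive_hpoly_eq0 _ (hq j).1).
have /(iter_derive_hpoly u)/hpoly0_cst[c Hc] : hpoly (0 + k) (q k) by have [] := hq k.
have := @iter_derive_hpoly_diag u 0 k (q k); rewrite add0n => /(_ (hq k).1).
rewrite Hc fact0 mul1r => ->; rewrite normrM normr_nat mulrAC.
by rewrite mulrC ler_pM2r// ltr0n fact_gt0.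
Qed.

End bernstein.

(** * Polynomial approximation on the sphere *)

Section sphere_approximation.
Context (R : realType) (n : nat).
Implicit Types (f g p : 'rV[R]_n -> R) (x y : 'rV[R]_n).

Definition approximable f := forall eta : R, 0 < eta ->
  exists2 p, pfun p & forall x, usphere R n x -> `|f x - p x| <= eta.

Lemma pfun_bounded_sphere p : pfun p ->
  exists2 B : R, 0 < B & forall x, usphere R n x -> `|p x| <= B.
Proof.
move=> pp; have : compact (p @` usphere R n).
  apply: continuous_compact; last exact: compact_usphere.
  by apply: continuous_subspaceT; exact: pfun_continuous.
move=> /compact_bounded[M [_ HM]]; exists (`|M| + 1); first by rewrite ltr_wpDl.
move=> x Sx; apply: HM; last by exists x.
by rewrite (le_lt_trans (ler_norm _))// ltrDl.
Qed.

(** Bernoulli's inequality in reciprocal form; it bounds s (1 - s)^k by 1 / k uniformly in [s],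
    although the geometric rate degenerates at s = 0. *)
Lemma bernoulli_inv (s : R) k : 0 <= s <= 1 -> (1 - s) ^+ k * (1 + k%:R * s) <= 1.
Proof.
move=> /andP[s0 s1]; elim: k => [|k ih]; first by rewrite expr0 mul0r addr0 mulr1.
apply: le_trans ih; rewrite exprSr -mulrA; apply: ler_wpM2l.
  by rewrite exprn_ge0// subr_ge0.
rewrite -natr1; have k0 : 0 <= k%:R :> R by [].
by nra.
Qed.

(* The iteration g := g + (t^2 - g^2) / 2 increases from 0 to |t|. *)
Lemma approximable_abs_pfun p : pfun p -> approximable (fun x => `|p x|).
Proof.
move=> pp eta eta0; have [B B0 pB] := pfun_bounded_sphere pp.
pose t x := B^-1 * p x.
pose G k := iter k (fun g x => g x + 2^-1 * (t x ^+ 2 + (- 1) * g x ^+ 2)) (fun=> 0).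
have pG k : pfun (G k).
  elim: k => [|k ih]; first exact: pfun_cst.
  apply: pfunD => //; apply: pfunZ; apply: pfunD; first exact/pfunX/pfunZ.
  exact/pfunZ/pfunX.
have Gt k x : usphere R n x ->
    0 <= `|t x| - G k x <= `|t x| * (1 - `|t x| / 2) ^+ k /\ 0 <= G k x.
  move=> Sx; have t1 : `|t x| <= 1.
    by rewrite normrM gtr0_norm ?invr_gt0// ler_pdivrMl// mulr1 pB.
  have t2 : t x ^+ 2 = `|t x| ^+ 2 by rewrite real_normK ?num_real.
  elim: k => [|k [/andP[ih1 ih2] ih3]].
    by rewrite /= subr0 expr0 mulr1 lexx normr_ge0.
  have -> : G k.+1 x = G k x + 2^-1 * (t x ^+ 2 + (- 1) * G k x ^+ 2) by [].
  have -> : `|t x| - (G k x + 2^-1 * (t x ^+ 2 + (- 1) * G k x ^+ 2)) =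
      (`|t x| - G k x) * (1 - (`|t x| + G k x) / 2) by rewrite t2; field.
  rewrite t2 exprSr mulrA; move: ih1 ih2 ih3 t1 (normr_ge0 (t x)).
  move: (G k x) `|t x| (_ ^+ k) => g a c ga ih g0 a1 a0.
  have ag : 0 <= 1 - (a + g) / 2 by lra.
  have a2 : 0 <= 1 - a / 2 by lra.
  split; last by nra.
  rewrite mulr_ge0//=; apply: le_trans (ler_wpM2r a2 ih).
  by apply: ler_wpM2l => //; lra.
(* The error is at most B |t| (1 - |t| / 2)^N <= B |t| / (1 + N |t| / 2) <= 2 B / N. *)
pose N := Num.bound (2 * B / eta).
have BN : 2 * B <= eta * N%:R.
  by rewrite -ler_pdivrMl// mulrC ltW// archi_boundP// !mulr_ge0 ?invr_ge0 ?ltW.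
exists (fun x => B * G N x); first exact: pfunZ.
move=> x Sx; have [/andP[h1 h2] h3] := Gt N x Sx.
have -> : `|p x| = B * `|t x|.
  by rewrite /t normrM normfV (gtr0_norm B0) mulVKf// gt_eqF.
rewrite -mulrBr normrM gtr0_norm// ger0_norm//.
have t1 : `|t x| <= 1.
  by rewrite normrM gtr0_norm ?invr_gt0// ler_pdivrMl// mulr1 pB.
apply: (le_trans (ler_wpM2l (ltW B0) h2)).
have := @bernoulli_inv (`|t x| / 2) N.
have -> : 0 <= `|t x| / 2 <= 1 by rewrite divr_ge0//=; lra.
have : 0 <= (1 - `|t x| / 2) ^+ N by rewrite exprn_ge0//; lra.
move=> + /(_ isT); move: (_ ^+ N) => c c0; move: (normr_ge0 (t x)) t1.
move: `|t x| (N%:R : R) BN (ler0n R N) => a M BM M0 a0 a1 H.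
have [a00|a00] := eqVneq a 0; first by rewrite a00 mul0r mulr0 ltW.
rewrite -(ler_pM2r (_ : 0 < 1 + M * (a / 2))); last first.
  by rewrite ltr_pwDl// mulr_ge0// divr_ge0.
apply: (@le_trans _ _ (B * a)).
  by rewrite -!mulrA ler_pM2l// ler_piMr.
by nra.
Qed.

Lemma approximable_pfun p : pfun p -> approximable p.
Proof. by move=> pp eta eta0; exists p => // x _; rewrite subrr normr0 ltW. Qed.

Lemma approximableD f g : approximable f -> approximable g ->
  approximable (fun x => f x + g x).
Proof.
move=> af ag eta eta0; have e2 : 0 < eta / 2 by rewrite divr_gt0.
have [p pp fp] := af _ e2; have [q pq gq] := ag _ e2.
exists (fun x => p x + q x); first exact: pfunD.
move=> x Sx; rewrite opprD addrACA (le_trans (ler_normD _ _))//.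
by rewrite (splitr eta) lerD ?fp ?gq.
Qed.

Lemma approximableZ c f : approximable f -> approximable (fun x => c * f x).
Proof.
move=> af eta eta0; have c0 : 0 < `|c| + 1 by rewrite ltr_wpDl.
have [p pp fp] := af (eta / (`|c| + 1)) (divr_gt0 eta0 c0).
exists (fun x => c * p x); first exact: pfunZ.
move=> x Sx; rewrite -mulrBr normrM.
rewrite (le_trans (ler_wpM2l _ (fp x Sx)))// mulrCA ler_piMr ?(ltW eta0)//.
by rewrite ler_pdivrMr// mul1r lerDl.
Qed.

Lemma approximable_abs f : approximable f -> approximable (fun x => `|f x|).
Proof.
move=> af eta eta0; have e2 : 0 < eta / 2 by rewrite divr_gt0.
have [p pp fp] := af _ e2; have [q pq pqx] := approximable_abs_pfun pp e2.
exists q => // x Sx; rewrite (_ : _ - _ = (`|f x| - `|p x|) + (`|p x| - q x)); last by ring.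
rewrite (le_trans (ler_normD _ _))// (splitr eta) lerD ?pqx//.
by rewrite (le_trans (ler_dist_dist _ _))// fp.
Qed.

Lemma approximable_min f g : approximable f -> approximable g ->
  approximable (fun x => Num.min (f x) (g x)).
Proof.
move=> af ag; rewrite (_ : (fun _ => _) = fun x => 2^-1 * ((f x + g x) +
    (- 1) * `|f x + (- 1) * g x|)).
  apply: approximableZ; apply: approximableD; first exact: approximableD.
  by apply: approximableZ; apply: approximable_abs; apply: approximableD => //;
    exact: approximableZ.
apply/funext => x; rewrite minr_absE mulrC; congr (_ * _).
by rewrite !mulN1r.
Qed.

Lemma approximable_bigmin (I : Type) (s : seq I) (F : I -> 'rV[R]_n -> R) K :
  (forall i, pfun (F i)) ->
  approximable (fun x => \big[Num.min/K]_(i <- s) F i x).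
Proof.
move=> pF; elim: s => [|i s ih].
  rewrite (_ : (fun _ => _) = fun=> K); first exact/approximable_pfun/pfun_cst.
  by apply/funext => x; rewrite big_nil.
rewrite (_ : (fun _ => _) = fun x => Num.min (F i x) (\big[Num.min/K]_(i <- s) F i x)).
  by apply: approximable_min => //; exact: approximable_pfun.
by apply/funext => x; rewrite big_cons.
Qed.

(** [f] is approximated by a minimum of finitely many paraboloids. Each dominates [f] on the whole
    sphere, so the minimum is never too small, and compactness makes some paraboloid close to [f] at
    every point. The minimum reduces to absolute values. *)
Lemma sphere_approx f : (forall x, usphere R n x -> {for x, continuous f}) ->
  approximable f.
Proof.
move=> cf eta eta0; pose e := eta / 4; have e0 : 0 < e by rewrite divr_gt0.
have [B B0 fB] : exists2 B : R, 0 < B & forall x, usphere R n x -> `|f x| <= B.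
  have : compact (f @` usphere R n).
    apply: continuous_compact; last exact: compact_usphere.
    by apply: continuous_in_subspaceT => x; rewrite inE => Sx; exact: cf.
  move=> /compact_bounded[M [_ HM]]; exists (`|M| + 1); first by rewrite ltr_wpDl.
  move=> x Sx; apply: HM; last by exists x.
  by rewrite (le_lt_trans (ler_norm _))// ltrDl.
(* Above each point y of the sphere, a paraboloid that dominates f and is close
   to f near y. *)
have par y : usphere R n y -> exists L : R, 0 <= L /\
    forall x, usphere R n x -> f x <= f y + e + L * r2 (x - y).
  move=> Sy; have /cvgr_dist_lt/(_ _ e0)/nbhs_ballP[r /= r0 Hr] := cf y Sy.
  exists (2 * B / r ^+ 2); split.
    by rewrite divr_ge0 ?mulr_ge0 ?exprn_ge0 ?ltW.
  move=> x Sx; have [xy|xy] := pselect (ball y r x).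
    have := Hr x xy; rewrite ltr_norml => /andP[+ _].
    have : 0 <= 2 * B / r ^+ 2 * r2 (x - y).
      by rewrite mulr_ge0 ?r2_ge0// divr_ge0 ?mulr_ge0 ?exprn_ge0 ?ltW.
    by lra.
  have xyr : r ^+ 2 <= r2 (x - y).
    rewrite leNgt; apply/negP => xyr; apply: xy; split=> // i j.
    rewrite (ord1 i) /ball/= distrC -(@ltr_sqr _ `|_|) ?nnegrE ?(ltW r0)//.
    rewrite real_normK ?num_real// (le_lt_trans _ xyr)//.
    by have := coord_le_r2 (x - y) j; rewrite !mxE.
  have H : 2 * B <= 2 * B / r ^+ 2 * r2 (x - y).
    rewrite -mulrA ler_peMr ?mulr_ge0 ?(ltW B0)//.
    by rewrite ler_pdivlMl ?exprn_gt0// mulr1.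
  have := fB x Sx; have := fB y Sy; rewrite !ler_norml => /andP[? ?] /andP[? ?].
  by lra.
have /choice[L HL] : forall y, exists L : R, usphere R n y -> 0 <= L /\
    forall x, usphere R n x -> f x <= f y + e + L * r2 (x - y).
  move=> y; have [/par[L HL]|nS] := pselect (usphere R n y).
    by exists L.
  by exists 0 => /nS.
pose p y x := f y + e + L y * r2 (x - y).
have pp y : pfun (p y).
  apply: pfunD; first exact: pfun_cst.
  apply: pfunZ; rewrite (_ : (fun _ => _) = fun x =>
      \sum_i (x ord0 i + - y ord0 i) ^+ 2).
    apply: pfun_sum => i; apply: pfunX; apply: pfunD; last exact: pfun_cst.
    exact: pfun_coord.
  by apply/funext => x; apply: eq_bigr => i _; rewrite !mxE.
pose O y := [set x | p y x < f x + 2 * e]^°.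
have := @compact_usphere R n; rewrite compact_cover.
move=> /(_ _ (usphere R n) O) [].
- by move=> y _; exact: open_interior.
- move=> y Sy; exists y => //; rewrite /O/=.
  have c1 : {for y, continuous (fun x => f x - p y x)}.
    apply: continuousB; first exact: cf.
    exact: pfun_continuous.
  have : - (2 * e) < f y - p y y.
    rewrite /p subrr /r2 big1; first by rewrite mulr0 addr0; lra.
    by move=> i _; rewrite mxE expr0n.
  move=> /(cvgr_gt _ c1); apply: filterS => x /=; lra.
move=> D DS cD.
(* [B + e], the value of the empty minimum, lies above [f], so it does not spoil the lower bound;
   the upper bound comes from a paraboloid of the finite cover. *)
have [g pg fg] := @approximable_bigmin _ (finmap.enum_fset D) p (B + e) pp (eta / 4) e0.
exists g => // x Sx.
have lo : f x <= \big[Num.min/B + e]_(y <- finmap.enum_fset D) p y x.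
  rewrite big_seq; apply: (big_ind (fun t => f x <= t)).
  - by rewrite (le_trans (ler_norm _))// (le_trans (fB x Sx))// lerDl ltW.
  - by move=> a b fa fb; rewrite le_min fa.
  - move=> y /DS; rewrite inE => Sy.
    by have [_] := HL y Sy; apply.
have hi : \big[Num.min/B + e]_(y <- finmap.enum_fset D) p y x <= f x + 2 * e.
  have [y /= yD yx] := cD x Sx.
  apply: (@le_trans _ _ (p y x)).
    have : y \in finmap.enum_fset D by [].
    elim: (finmap.enum_fset D) => // z s ih; rewrite inE big_cons ge_min.
    by case/orP => [/eqP ->|/ih ->]; rewrite ?lexx ?orbT.
  exact: (ltW (interior_subset yx)).
have := fg x Sx; move: lo hi; move: (\big[_/_]_(_ <- _) _) => b lo hi.
rewrite !ler_norml => /andP[? ?].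
by rewrite /e in lo hi *; apply/andP; split; lra.
Qed.

End sphere_approximation.

(** * The heat equation on the sphere *)

Section caloric.
Context (R : realType) (n : nat).
Implicit Types (W : R -> 'rV[R]_n -> R) (x y : 'rV[R]_n).
Let e i : 'rV[R]_n := delta_mx ord0 i.

(* Solutions of the heat equation of the sphere, read on their extensions that
   are constant along rays. *)
Record caloric W : Prop := Caloric {
  caloric_homogeneous : forall t y, W t y = W t (normalize y);
  caloric_continuous : forall t y, 0 < t -> y != 0 ->
    {for (t, y), continuous (fun p : R * 'rV[R]_n => W p.1 p.2)};
  caloric_derivable_time : forall t x, 0 < t -> usphere R n x ->
    derivable (fun s => W s x) t 1;
  caloric_derivable : forall t y i, 0 < t -> y != 0 ->
    derivable (W t) y (e i);
  caloric_derivable2 : forall t y i, 0 < t -> y != 0 ->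
    derivable ('D_(e i) (W t)) y (e i);
  caloric_heat : forall t x, 0 < t -> usphere R n x ->
    'D_1 (fun s => W s x) t = \sum_i 'D_(e i) ('D_(e i) (W t)) x }.

Lemma usphere_neq0 x : usphere R n x -> x != 0.
Proof.
move=> /usphere_r2 x1; apply/eqP => x0; move: x1.
rewrite x0 /r2 big1; first by move=> /esym/eqP; rewrite oner_eq0.
by move=> i _; rewrite mxE expr0n.
Qed.

Lemma enorm_eq0 x : (enorm x == 0) = (x == 0).
Proof.
apply/eqP/eqP => [x0|->]; last first.
  by rewrite /enorm big1 ?sqrtr0// => i _; rewrite mxE expr0n.
have := enorm_sqr x; rewrite x0 expr0n /= => /esym H.
apply/rowP => i; rewrite mxE; apply/eqP; rewrite -sqrf_eq0; apply/eqP.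
by apply: (psumr_eq0P _ H) => // j _; exact: sqr_ge0.
Qed.

Lemma enormZ c x : enorm (c *: x) = `|c| * enorm x.
Proof.
rewrite /enorm -sqrtr_sqr -sqrtrM ?sqr_ge0//; congr Num.sqrt.
by rewrite mulr_sumr; apply: eq_bigr => i _; rewrite mxE exprMn.
Qed.

Lemma normalize_usphere y : y != 0 -> usphere R n (normalize y).
Proof.
move=> y0; rewrite /usphere/= /normalize enormZ normfV ger0_norm ?enorm_ge0//.
by rewrite mulVf// enorm_eq0.
Qed.

Lemma normalize_id x : usphere R n x -> normalize x = x.
Proof. by rewrite /normalize => ->; rewrite invr1 scale1r. Qed.

Lemma near_neq0 x : x != 0 -> \forall y \near x, y != 0.
Proof.
have r2_eq0 y : (r2 y == 0) = (y == 0) by rewrite /r2 -enorm_sqr sqrf_eq0 enorm_eq0.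
rewrite -r2_eq0 => x0; have x1 : 0 < r2 x by rewrite lt_neqAle eq_sym x0 r2_ge0.
have := pfun_continuous (pfun_r2 R n) (x := x).
by move=> /cvgr_gt/(_ _ x1); apply: filterS => y /gt_eqF; rewrite r2_eq0 => ->.
Qed.

Lemma caloricD W W' : caloric W -> caloric W' -> caloric (fun t y => W t y + W' t y).
Proof.
move=> [h1 c1 t1 d1 dd1 e1] [h2 c2 t2 d2 dd2 e2].
(* The sum rule is available only off the origin; an identity near [y] suffices to differentiate
   once more. *)
have near2 t y i : 0 < t -> y != 0 ->
    \near y, 'D_(e i) (fun y => W t y + W' t y) y = ('D_(e i) (W t) + 'D_(e i) (W' t)) y.
  move=> t0 y0; have := near_neq0 y0; apply: filterS => z z0.
  by rewrite [LHS](@deriveD _ _ _ (W t) (W' t))//; [exact: d1|exact: d2].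
split.
- by move=> t y; rewrite h1 h2.
- by move=> t y t0 y0; apply: continuousD; [exact: c1|exact: c2].
- by move=> t x t0 Sx; apply: derivableD; [exact: t1|exact: t2].
- by move=> t y i t0 y0; apply: derivableD; [exact: d1|exact: d2].
- move=> t y i t0 y0.
  apply: (@near_eq_derivable _ _ _ ('D_(e i) (W t) + 'D_(e i) (W' t))); last first.
    by apply: derivableD; [exact: dd1|exact: dd2].
  have := near2 t y i t0 y0.
  by apply: filterS => z E; exact: (esym E).
- move=> t x t0 Sx; have x0 := usphere_neq0 Sx.
  rewrite [LHS](@deriveD _ _ _ (fun s => W s x) (fun s => W' s x)); [|exact: t1|exact: t2].
  rewrite e1// e2// -big_split; apply: eq_bigr => i _ /=.
  rewrite (near_eq_derive _ (near2 t x i t0 x0)).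
  by rewrite [RHS]deriveD//; [exact: dd1|exact: dd2].
Qed.

Lemma caloricN W : caloric W -> caloric (fun t y => - W t y).
Proof.
move=> [h1 c1 t1 d1 dd1 e1].
have near2 t y i : 0 < t -> y != 0 ->
    \near y, 'D_(e i) (fun y => - W t y) y = (- 'D_(e i) (W t)) y.
  move=> t0 y0; have := near_neq0 y0; apply: filterS => z z0.
  by rewrite [LHS](@deriveN _ _ _ (W t))//; exact: d1.
split.
- by move=> t y; rewrite h1.
- by move=> t y t0 y0; apply: continuousN; exact: c1.
- by move=> t x t0 Sx; apply: derivableN; exact: t1.
- by move=> t y i t0 y0; apply: derivableN; exact: d1.
- move=> t y i t0 y0.
  apply: (@near_eq_derivable _ _ _ (- 'D_(e i) (W t))); last first.
    by apply: derivableN; exact: dd1.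
  have := near2 t y i t0 y0.
  by apply: filterS => z E; exact: (esym E).
- move=> t x t0 Sx; have x0 := usphere_neq0 Sx.
  rewrite [LHS](@deriveN _ _ _ (fun s => W s x)); last exact: t1.
  rewrite e1// -sumrN; apply: eq_bigr => i _ /=.
  rewrite (near_eq_derive _ (near2 t x i t0 x0)).
  by rewrite [RHS]deriveN//; exact: dd1.
Qed.

(** [eps] is chosen so that W - eps (t - s) still exceeds [c] at (t0, x0). At its maximum the second
    space derivatives are at most 0, because [W] is constant along rays and so maximal among all y
    != 0; hence the time derivative of [W] is below [eps], and a slightly earlier time gives a
    larger value. Only earlier times are compared, as the maximum may sit at [t0]. *)
Lemma caloric_max W (s c : R) : caloric W -> 0 < s ->
  (forall x, usphere R n x -> W s x <= c) ->
  forall t x, s <= t -> usphere R n x -> W t x <= c.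
Proof.
move=> [hom cont dt d1 d2 heat] s0 Wc t0 x0 st0 Sx0.
rewrite leNgt; apply/negP => cW.
have st : s < t0.
  rewrite lt_neqAle st0 andbT; apply: contraTneq cW => <-.
  by rewrite -leNgt Wc.
pose eps := (W t0 x0 - c) / (2 * (t0 - s)).
have eps0 : 0 < eps by rewrite divr_gt0 ?mulr_gt0// subr_gt0.
have epsE : eps * (t0 - s) = (W t0 x0 - c) / 2.
  by rewrite /eps; field; rewrite subr_eq0 gt_eqF.
pose g (p : R * 'rV[R]_n) := W p.1 p.2 - eps * (p.1 - s).
have [|||[t x]] := @compact_EVT_max _ R g (`[s, t0] `*` usphere R n).
- by exists (t0, x0); split => //=; rewrite in_itv/= st0 lexx.
- by apply: compact_setX; [exact: segment_compact|exact: compact_usphere].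
- apply: continuous_in_subspaceT => -[t x]; rewrite inE => -[/= + Sx].
  rewrite in_itv/= => /andP[ts _]; apply: cvgB.
    by apply: cont; [exact: lt_le_trans ts|exact: usphere_neq0].
  apply: cvgM; first exact: cvg_cst.
  by apply: cvgB; [exact: cvg_fst|exact: cvg_cst].
rewrite inE => -[/= + Sx]; rewrite in_itv/= => /andP[ts tt0] gmax.
have t_gt0 : 0 < t by exact: lt_le_trans ts.
have g0 : c < g (t, x).
  apply: (@lt_le_trans _ _ (g (t0, x0))); first by rewrite /g/= epsE; lra.
  by apply: gmax; rewrite inE; split => //=; rewrite in_itv/= st0 lexx.
have {}ts : s < t.
  rewrite lt_neqAle ts andbT; apply: contraTneq g0 => E.
  by rewrite -leNgt /g/= -E subrr mulr0 subr0 Wc.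
have xn0 := usphere_neq0 Sx.
have Wmax y : y != 0 -> W t y <= W t x.
  move=> y0; rewrite hom; have := gmax (t, normalize y); rewrite inE /g/= lerD2r; apply.
  by split => /=; [rewrite in_itv/= (ltW ts)|exact: normalize_usphere].
have space i : 'D_(e i) ('D_(e i) (W t)) x <= 0.
  have [r r0 Hr] := line_near (e i) (near_neq0 xn0).
  apply: (derive2_at_max r0).
  - by move=> z zr; apply: d1 => //; exact: Hr.
  - exact: d2.
  - by move=> z zr; apply: Wmax; exact: Hr.
have : 'D_1 (fun s => W s x) t < eps.
  by rewrite heat// (le_lt_trans _ eps0)// sumr_le0.
move=> /(cvgr_lt _ (dt t x t_gt0 Sx))[r /= r0 Hr].
pose h := Num.min r (t - s) / 2.
have m0 : 0 < Num.min r (t - s) by rewrite lt_min r0 subr_gt0.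
have h0 : 0 < h by rewrite divr_gt0.
have hm : h < Num.min r (t - s) by rewrite /h ltr_pdivrMr// mulr_natr mulr2n ltrDl.
move: hm; rewrite lt_min => /andP[hr hts].
have := Hr (- h); rewrite /ball_/= sub0r opprK gtr0_norm// oppr_eq0 gt_eqF//.
move=> /(_ hr isT); rewrite -[(- h)^-1 *: _]/((- h)^-1 * _) invrN mulNr -mulrN.
rewrite ltr_pdivrMl//.
have -> : - h *: (1 : R) + t = t - h by rewrite [_ *: 1]mulr1 addrC.
have : g (t - h, x) <= g (t, x).
  by apply: gmax; rewrite inE; split => //=; rewrite in_itv/=; apply/andP; split; lra.
by rewrite /g/=; nra.
Qed.

Lemma caloric_max_norm W (s c : R) : caloric W -> 0 < s ->
  (forall x, usphere R n x -> `|W s x| <= c) ->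
  forall t x, s <= t -> usphere R n x -> `|W t x| <= c.
Proof.
move=> cW s0 Wc t x st Sx; rewrite ler_norml; apply/andP; split.
  rewrite lerNl; apply: (caloric_max (caloricN cW) s0) => // y Sy.
  by rewrite lerNl; have := Wc y Sy; rewrite ler_norml => /andP[].
apply: (caloric_max cW s0) => // y Sy.
by have := Wc y Sy; rewrite ler_norml => /andP[].
Qed.

Lemma heat_flow_caloric u0 u : heat_flow u0 u -> caloric (fun t => u t \o @normalize R n).
Proof.
move=> [_ [dt dx dxx [c0 _ _ _]] heat _].
have inD t y : 0 < t -> y != 0 -> (t, y) \in [set p : R * 'rV[R]_n | 0 < p.1 /\ p.2 != 0].
  by move=> t0 y0; rewrite inE.
split.
- move=> t y /=; congr (u t _); have [->|y0] := eqVneq y 0.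
    by rewrite /normalize !scaler0.
  by rewrite [RHS]normalize_id//; exact: normalize_usphere.
- by move=> t y t0 y0; exact: (c0 _ (inD t y t0 y0)).
- by move=> t x t0 Sx; exact: (dt _ (inD t x t0 (usphere_neq0 Sx))).
- by move=> t y i t0 y0; exact: (dx _ (inD t y t0 y0)).
- by move=> t y i t0 y0; exact: (dxx _ (inD t y t0 y0) i i).
- move=> t x t0 Sx; have /eqP := heat t x t0 Sx; rewrite subr_eq0 derive1E => /eqP E.
  transitivity (laplace_beltrami (u t) x); last by [].
  by rewrite -E; congr ('D_1 _ t); apply/funext => r /=; rewrite normalize_id.
Qed.

Lemma derive_lineE (f : 'rV[R]_n -> R) x v :
  'D_v f x = 'D_(1 : R) (fun h : R => f (h *: v + x)) 0.
Proof.
have E : (fun h : R => h^-1 *: (((fun t : R => f (t *: v + x)) \o shift 0)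
      (h *: (1 : R)) - f (0 *: v + x))) =
    (fun h => h^-1 *: ((f \o shift x) (h *: v) - f x)).
  by apply/funext => h /=; rewrite [h *: 1]mulr1 addr0 scale0r add0r.
by rewrite /derive E.
Qed.

(** Restriction to the line through [x] in direction [v] turns this into the chain rule in one
    variable. *)
Lemma is_derive_dir_comp (h : R -> R) (f : 'rV[R]_n -> R) x v (a b : R) :
  is_derive (f x) (1 : R) h a -> is_derive x v f b ->
  is_derive x v (h \o f) (a * b).
Proof.
move=> hd [fd fb].
have fd' : is_derive (0 : R) (1 : R) (fun s : R => f (s *: v + x)) b.
  by apply: DeriveDef; [exact: (proj1 (derivable1P _ _ _) fd)|rewrite -derive_lineE].
have hd' : is_derive ((fun s : R => f (s *: v + x)) 0) (1 : R) h a.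
  by rewrite scale0r add0r.
have [H1 H2] := is_derive1_comp hd' fd'.
apply: DeriveDef; first exact: (proj2 (derivable1P (h \o f) x v) H1).
by rewrite derive_lineE.
Qed.

(** * Spherical harmonics extended constantly along rays *)

Section radial_extension.
Implicit Types (p : 'rV[R]_n -> R).

Definition inv_norm y : R := (enorm y)^-1.
Let rho := inv_norm.

Let r2_gt0 y : y != 0 -> 0 < r2 y.
Proof.
by move=> y0; rewrite lt_neqAle r2_ge0 andbT eq_sym /r2 -enorm_sqr sqrf_eq0 enorm_eq0.
Qed.

Lemma is_derive_inv_norm y i : y != 0 ->
  is_derive y (e i) rho (- (y ord0 i * rho y ^+ 3)).
Proof.
move=> y0; have s0 : 0 < Num.sqrt (r2 y) by rewrite sqrtr_gt0 r2_gt0.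
have h : is_derive (r2 y) (1 : R) (fun t => (Num.sqrt t)^-1)
    (- (Num.sqrt (r2 y)) ^- 2 *: (2 * Num.sqrt (r2 y))^-1).
  by apply: is_deriveV; [rewrite gt_eqF|apply: is_derive1_sqrt; exact: r2_gt0].
have r : is_derive y (e i) (@r2 R n) (2 * y ord0 i).
  apply: DeriveDef; last by rewrite -derive_e_r2 ddE.
  exact/pfun_derivable/pfun_r2.
have H := is_derive_dir_comp h r.
apply: (@is_derive_eq _ _ _ rho y (e i) _ _ H).
rewrite /rho /inv_norm /enorm -/(r2 y) -[_ *: _]/(_ * _); field.
by rewrite gt_eqF.
Qed.

Lemma is_derive_radial m p y i : pfun p -> y != 0 ->
  is_derive y (e i) (fun z => rho z ^+ m * p z)
    (rho y ^+ m.+2 * (- m%:R * (y ord0 i * p y)) + rho y ^+ m * dd (e i) p y).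
Proof.
move=> pp y0; have dr := is_derive_inv_norm i y0.
have dp : is_derive y (e i) p (dd (e i) p y).
  by rewrite ddE; apply: derivableP; exact: pfun_derivable.
have dX := is_deriveX m dr.
have H := is_deriveM dX dp.
have E : (rho ^+ m) * p = (fun z => rho z ^+ m * p z).
  by apply/funext => z; rewrite exprfctE.
rewrite E in H; apply: (is_derive_eq H).
rewrite exprfctE -![_ *: _]/(_ * _).
case: m {dX H E} => [|m] /=; first by rewrite !mul0r mulr0 oppr0 mul0r !mulr0 addr0 add0r.
by rewrite !exprS; ring.
Qed.

Lemma derive2_radial m p y i : pfun p -> y != 0 ->
  derivable ('D_(e i) (fun z => rho z ^+ m * p z)) y (e i) /\
  'D_(e i) ('D_(e i) (fun z => rho z ^+ m * p z)) y =
    rho y ^+ m.+4 * (m%:R * m.+2%:R * (y ord0 i ^+ 2 * p y)) +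
    - m%:R * rho y ^+ m.+2 * (p y + 2 * y ord0 i * dd (e i) p y) +
    rho y ^+ m * dd (e i) (dd (e i) p) y.
Proof.
move=> pp y0; pose p1 (z : 'rV[R]_n) := - m%:R * (z ord0 i * p z).
have pi : pfun (fun z : 'rV[R]_n => z ord0 i) by exact: pfun_coord.
have pp1 : pfun p1 by apply: pfunZ; exact: pfunM.
have pd := pfun_derive (e i) pp.
have D := is_deriveD (is_derive_radial m.+2 i pp1 y0) (is_derive_radial m i pd y0).
have N : \near y, ((fun z => rho z ^+ m.+2 * p1 z) + (fun z => rho z ^+ m * dd (e i) p z)) y =
    'D_(e i) (fun z => rho z ^+ m * p z) y.
  apply: filterS (near_neq0 y0) => z z0.
  by have := is_derive_radial m i pp z0; move=> H; rewrite (@derive_val _ _ _ _ _ _ _ H).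
have := near_eq_is_derive N D => H; split; first exact: ex_derive.
rewrite (@derive_val _ _ _ _ _ _ _ H).
rewrite /p1 derive_pZ; last exact: pfunM.
rewrite (derive_pM _ _ pi pp) derive_pcoord /e mxE !eqxx /=.
by move: (dd _ _ y) (dd _ p y) (rho y) (p y) (y ord0 i) => a b c f g; ring.
Qed.

(** Summed over i, the three terms contribute k (k + 2) since r^2 = 1, then - k n, then - 2 k^2 by
    Euler's identity; together - k (k + n - 2). *)
Lemma radial_eigen k p x : hpoly k p -> harmonic p -> usphere R n x ->
  \sum_i 'D_(e i) ('D_(e i) (fun z => rho z ^+ k * p z)) x =
  - (k%:R * (k%:R + n%:R - 2)) * p x.
Proof.
move=> hp ap Sx; have pp := hpoly_pfun hp.
have x0 := usphere_neq0 Sx; have x1 : rho x = 1 by rewrite /rho /inv_norm Sx invr1.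
rewrite (eq_bigr (fun i => (k%:R * k.+2%:R * p x) * x ord0 i ^+ 2 -
   k%:R * p x - 2 * k%:R * (x ord0 i * dd (e i) p x) + dd (e i) (dd (e i) p) x)).
  rewrite big_split/= !sumrB -!mulr_sumr -/(r2 x) -laplacianE ap.
  rewrite -derive_dir// (hpoly_euler x hp) ((usphere_r2 x).1 Sx).
  rewrite sumr_const card_ord -[_ *+ n]mulr_natr.
  by rewrite -natr1 -[k.+1%:R]natr1; ring.
move=> i _; have [_ ->] := derive2_radial k i pp x0.
by rewrite x1 !expr1n; ring.
Qed.

Lemma continuous_radial k p y : pfun p -> y != 0 ->
  {for y, continuous (fun z => rho z ^+ k * p z)}.
Proof.
move=> pp y0.
have cr : {for y, continuous rho}.
  have ce : {for y, continuous (@enorm R n)}.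
    apply: (@continuous_comp _ _ _ (@r2 R n) Num.sqrt); last exact: sqrt_continuous.
    exact: (pfun_continuous (pfun_r2 R n)).
  have nz : enorm y != 0 by rewrite enorm_eq0.
  exact: cvgV nz ce.
have cX : {for y, continuous (fun z => rho z ^+ k)}.
  elim: k => [|k ih].
    have -> : (fun z => rho z ^+ 0) = cst 1 by apply/funext => z; rewrite expr0.
    exact: cst_continuous.
  have -> : (fun z => rho z ^+ k.+1) = fun z => rho z * rho z ^+ k.
    by apply/funext => z; rewrite exprS.
  exact: cvgM cr ih.
exact: cvgM cX (pfun_continuous pp (x := y)).
Qed.

Lemma hpoly_normalize k p y : hpoly k p -> p (normalize y) = rho y ^+ k * p y.
Proof. by move=> hp; rewrite /normalize (hpoly_scale _ _ hp). Qed.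

End radial_extension.

Definition sphere_eigenvalue (k : nat) : R := k%:R * (k%:R + n%:R - 2).

(** Homogeneity turns the extension of [q] along rays into |y|^(-k) q(y), an eigenfunction by
    [radial_eigen]. *)
Lemma caloric_hpoly k q (s : R) : hpoly k q -> harmonic q ->
  caloric (fun t y => expR (- sphere_eigenvalue k * (t - s)) * q (normalize y)).
Proof.
move=> hq aq; set lam := sphere_eigenvalue k.
pose c t := expR (- lam * (t - s)).
have WE t : (fun y => c t * q (normalize y)) =
    fun y => inv_norm y ^+ k * (c t * q y).
  by apply/funext => y; rewrite (hpoly_normalize _ hq) mulrCA.
have ht t : hpoly k (fun y => c t * q y) by exact: hpolyZ.
have at_ t : harmonic (fun y => c t * q y).
  by move=> y; rewrite laplacianZ ?aq ?mulr0//; exact: hpoly_pfun hq.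
have dc (t : R) : is_derive t (1 : R) c (- lam * c t).
  have d1 : is_derive t (1 : R) (fun t => - lam * (t - s)) (- lam).
    have -> : (fun t => - lam * (t - s)) = (- lam) *: (id - cst s).
      by apply/funext.
    by apply: is_derive_eq; rewrite subr0 [_ *: _]mulr1.
  have d2 := is_derive_expR (- lam * (t - s)).
  have H := @is_derive1_comp _ expR (fun t => - lam * (t - s)) t _ _ d2 d1.
  by apply: (is_derive_eq H); rewrite mulrC.
have dW (t : R) y : is_derive t (1 : R) (fun t => c t * q (normalize y))
    (- lam * (c t * q (normalize y))).
  rewrite (_ : (fun _ => _) = (q (normalize y)) *: c).
    have H := is_deriveZ (q (normalize y)) (dc t).
    by apply: (is_derive_eq H); rewrite -[_ *: _]/(_ * _); ring.
  by apply/funext => r; rewrite mulrC.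
split.
- move=> t y; congr (_ * q _); have [->|y0] := eqVneq y 0.
    by rewrite /normalize !scaler0.
  by rewrite [RHS]normalize_id//; exact: normalize_usphere.
- move=> t y t0 y0.
  have cc : {for t, continuous c}.
    apply: differentiable_continuous; apply/derivable1_diffP.
    by have := dc t => H; exact: ex_derive.
  have cq : {for y, continuous (fun y => q (normalize y))}.
    have -> : (fun y => q (normalize y)) = fun y => inv_norm y ^+ k * q y.
      by apply/funext => z; exact: hpoly_normalize.
    by apply: continuous_radial => //; exact: hpoly_pfun hq.
  have c1 : {for (t, y), continuous (c \o @fst R 'rV[R]_n)}.
    by apply: continuous_comp; [exact: cvg_fst|exact: cc].
  have c2 : {for (t, y), continuous ((fun y => q (normalize y)) \o @snd R 'rV[R]_n)}.
    by apply: continuous_comp; [exact: cvg_snd|exact: cq].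
  exact: cvgM c1 c2.
- by move=> t x _ _; have := dW t x => H; exact: ex_derive.
- move=> t y i _ y0; rewrite WE.
  by have := is_derive_radial k i (hpoly_pfun (ht t)) y0 => H; exact: ex_derive.
- move=> t y i _ y0; rewrite WE.
  by have [] := derive2_radial k i (hpoly_pfun (ht t)) y0.
- move=> t x t0 Sx; rewrite (@derive_val _ _ _ _ _ _ _ (dW t x)).
  under eq_bigr do rewrite WE.
  by rewrite (radial_eigen (ht t) (at_ t) Sx) normalize_id.
Qed.

Lemma caloric0 : caloric (fun _ _ => 0).
Proof.
have D v : 'D_v (fun _ : 'rV[R]_n => 0 : R) = fun=> 0.
  by apply/funext => y; exact: derive_cst.
split => //.
- by move=> t y _ _; exact: cvg_cst.
- by move=> t y i _ _; rewrite D; exact: derivable_cst.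
- move=> t x _ _; rewrite [LHS]derive_cst big1// => i _.
  by rewrite D; exact: derive_cst.
Qed.

Lemma caloric_sum m (q : nat -> 'rV[R]_n -> R) (s : R) :
  (forall k, hpoly k (q k) /\ harmonic (q k)) ->
  caloric (fun t y => \sum_(k < m)
    expR (- sphere_eigenvalue k * (t - s)) * q k (normalize y)).
Proof.
move=> hq; elim: m => [|m ih].
  rewrite (_ : (fun _ => _) = fun _ _ => 0); first exact: caloric0.
  by apply/funext => t; apply/funext => y; rewrite big_ord0.
have [h1 a1] := hq m; have := caloricD ih (caloric_hpoly s h1 a1).
congr caloric; apply/funext => t; apply/funext => y.
by rewrite big_ord_recr.
Qed.

End caloric.

(** * Separation of low and high frequencies *)

Section high_frequencies.
Context (R : realType).

Lemma expR1_ge2 : 2 <= expR (1 : R).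
Proof. by rewrite (le_trans _ (expR_ge1Dx 1))//; lra. Qed.

Lemma expR_natN_le k : expR (- k%:R : R) <= 2^-1 ^+ k.
Proof.
rewrite -mulrN1 expRM_natl expRN; apply: lerXn2r; rewrite ?nnegrE ?invr_ge0 ?expR_ge0//.
by rewrite lef_pV2 ?posrE ?expR_gt0// expR1_ge2.
Qed.

Lemma sum_half_le N m : \sum_(k < m) (2^-1 : R) ^+ (N.+1 + k) <= 1.
Proof.
suff H : \sum_(k < m) (2^-1 : R) ^+ (N.+1 + k) <= 1 - 2^-1 ^+ m.
  by rewrite (le_trans H)// gerBl exprn_ge0// invr_ge0.
elim: m => [|m ih]; first by rewrite big_ord0 expr0 subrr.
rewrite big_ord_recr/= (le_trans (lerD ih (lexx _)))//.
have : (2^-1 : R) ^+ (N.+1 + m) <= 2^-1 ^+ m.+1.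
  by rewrite ler_wiXn2l ?invr_ge0 ?invf_le1 ?ler1n//; lia.
rewrite exprS; move: (_ ^+ (_ + _)) (2^-1 ^+ m) => a b; lra.
Qed.

(** The exponent k^2 r is split in two halves: one exceeds k (ln C + 1), because N < k, and so pays
    for C^k and a further e^(-k); the other exceeds N^2 r / 2. *)
Lemma high_frequency_decay (n k N : nat) (C r : R) : (2 <= n)%N -> (N < k)%N ->
  1 <= C -> 0 <= r -> ln C + 1 <= N%:R * r / 2 ->
  expR (- sphere_eigenvalue R n k * r) * C ^+ k <=
  expR (- (N%:R ^+ 2 * r / 2)) * 2^-1 ^+ k.
Proof.
move=> n2 Nk C1 r0 CN.
have C0 : 0 < C by exact: lt_le_trans C1.
rewrite -[C in C ^+ k]lnK// -expRM_natl -expRD.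
apply: (@le_trans _ _ (expR (- (N%:R ^+ 2 * r / 2)) * expR (- k%:R))); last first.
  by rewrite ler_wpM2l ?expR_ge0// expR_natN_le.
rewrite -expRD ler_expR /sphere_eigenvalue.
have n2R : 2 <= n%:R :> R by rewrite ler_nat.
have Nk' : N%:R + 1 <= k%:R :> R by rewrite natr1 ler_nat.
have N0 : 0 <= N%:R :> R by [].
have L0 : 0 <= ln C by rewrite ln_ge0.
move: (k%:R : R) (N%:R : R) (n%:R : R) (ln C) Nk' N0 n2R L0 CN => K M D l MK M0 D2 l0 CN.
have h1 : K ^+ 2 * r <= K * (K + D - 2) * r.
  apply: ler_wpM2r => //; nra.
have h2 : K * (l + 1) <= K * (M * r / 2) by apply: ler_wpM2l => //; lra.
have h3 : M * (M * r) <= K * (M * r).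
  by apply: ler_wpM2r; [exact: mulr_ge0|lra].
have h4 : K * (M * r) <= K * (K * r).
  apply: ler_wpM2l; first lra.
  by apply: ler_wpM2r => //; lra.
rewrite mulNr; move: h1 h2 h3 h4; rewrite !expr2; nra.
Qed.

End high_frequencies.

Section spectral_splitting.
Context (R : realType) (n : nat) (n2 : (2 <= n)%N) (M : set 'rV[R]_n).
Hypothesis MS : M `<=` usphere R n.
Variables (N : nat) (AN : R) (AN1 : 1 <= AN).
Hypothesis rem : forall (p : nat -> 'rV[R]_n -> R) (b : R),
  (forall k, hpoly k (p k)) -> 0 <= b ->
  (forall x, M x -> `|\sum_(k < N.+1) p k x| <= b) ->
  forall x, usphere R n x -> `|\sum_(k < N.+1) p k x| <= AN * b.
Let C : R := (64 + 4 * n)%:R.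

(** The high modes at time [t] are of size exp (- N^2 (t - s) / 2) [F]. They enter twice, once in
    the remainder and once, multiplied by [AN], as an error in the values on [M] fed to the Remez
    inequality; hence the factor 2 [AN]. *)
Lemma observe_low_frequencies W (s t F b : R) : caloric W -> 0 < s -> s < t ->
  0 <= F -> 0 <= b -> ln C + 1 <= N%:R * (t - s) / 2 ->
  (forall x, usphere R n x -> `|W s x| <= F) ->
  (forall x, M x -> `|W t x| <= b) ->
  forall x, usphere R n x ->
    `|W t x| <= AN * b + 2 * AN * expR (- (N%:R ^+ 2 * (t - s) / 2)) * F.
Proof.
move=> cW s0 st F0 b0 CN WF Wb x Sx.
have n0 : (0 < n)%N by exact: leq_trans n2.
have C1 : 1 <= C by rewrite ler1n addn_gt0.
have AN0 : 0 <= AN by exact: le_trans AN1.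
pose r := t - s; have r0 : 0 < r by rewrite subr_gt0.
pose E := expR (- (N%:R ^+ 2 * r / 2)).
have E0 : 0 <= E by exact: expR_ge0.
have E1 : E <= 1.
  by rewrite -expR0 ler_expR oppr_le0 divr_ge0// mulr_ge0 ?sqr_ge0// ltW.
apply/ler_addgt0Pr => eps eps0.
(* Total weight of [eta]: 1 from the approximation at time [t], and at most 3 [AN] from the low and
   high parts. *)
pose K := 1 + 3 * AN; have K0 : 0 < K by rewrite /K; lra.
pose eta := eps / K; have eta0 : 0 < eta by rewrite divr_gt0.
have cs y : usphere R n y -> {for y, continuous (W s)}.
  move=> Sy; have := caloric_continuous cW s0 (usphere_neq0 Sy) => c.
  by apply: (@continuous2_cvg _ _ _ _ (nbhs y) _ (fun=> s) id W s y c);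
    [exact: cvg_cst|exact: cvg_id].
have [p pp pW] := sphere_approx cs eta0.
have [m [q [hq pq]]] := pfun_harmonics n0 pp.
(* Padding by zero, so that at least [N.+1] components are present even if [m] is small. *)
pose q' k x := if (k < m)%N then q k x else 0.
have hq' k : hpoly k (q' k) /\ harmonic (q' k).
  rewrite /q'; case: (k < m)%N; first exact: hq.
  by split; [exact: hpoly0|exact: harmonic0].
have q'E y : usphere R n y -> p y = \sum_(k < N.+1 + m) q' k y.
  move=> Sy; rewrite (pq _ Sy) -big_mkcond/=.
  by rewrite (big_ord_widen _ (fun k => q k y) (leq_addl N.+1 m)).
have comp k y : usphere R n y -> (k < N.+1 + m)%N -> `|q' k y| <= C ^+ k * (F + eta).
  move=> Sy km; apply: (harmonic_component n0 hq' _ Sy km) => z Sz.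
  rewrite -q'E// (_ : p z = W s z - (W s z - p z)); last by rewrite subKr.
  by rewrite (le_trans (ler_normB _ _))// lerD ?WF ?pW.
pose f k := expR (- sphere_eigenvalue R n k * (t - s)).
have close y : usphere R n y -> `|W t y - \sum_(k < N.+1 + m) f k * q' k y| <= eta.
  move=> Sy.
  have cV := caloricD cW (caloricN (caloric_sum (N.+1 + m) s hq')).
  have := caloric_max_norm cV s0 (c := eta) _ (ltW st) Sy.
  rewrite normalize_id//; apply => z Sz; rewrite normalize_id//.
  rewrite (_ : \sum_(k < _) _ = p z) ?pW// q'E//.
  by apply: eq_bigr => k _; rewrite subrr mulr0 expR0 mul1r.
pose low y := \sum_(k < N.+1) f k * q' k y.
pose high y := \sum_(k < m) f (N.+1 + k)%N * q' (N.+1 + k)%N y.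
have splitE y : \sum_(k < N.+1 + m) f k * q' k y = low y + high y.
  exact: big_split_ord.
have high_le y : usphere R n y -> `|high y| <= E * (F + eta).
  move=> Sy; rewrite (le_trans (ler_norm_sum _ _ _))//.
  apply: (@le_trans _ _ (\sum_(k < m) (2^-1 : R) ^+ (N.+1 + k) * (E * (F + eta)))).
    apply: ler_sum => k _; rewrite normrM ger0_norm ?expR_ge0//.
    rewrite (le_trans (ler_wpM2l (expR_ge0 _) (comp _ _ Sy _)))//.
      by rewrite ltn_add2l.
    rewrite [leLHS]mulrA [leRHS]mulrA.
    apply: ler_wpM2r; first by rewrite addr_ge0// ltW.
    rewrite [leRHS]mulrC.
    by apply: high_frequency_decay => //; [rewrite ltnS leq_addr|exact: ltW].
  by rewrite -mulr_suml ler_piMl ?sum_half_le// mulr_ge0// addr_ge0// ltW.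
have B0 : 0 <= b + eta + E * (F + eta).
  by rewrite addr_ge0// ?addr_ge0// ?(ltW eta0)// mulr_ge0// addr_ge0// ltW.
have low_le : `|low x| <= AN * (b + eta + E * (F + eta)).
  apply: (rem (p := fun k y => f k * q' k y)) => // [k|y My].
    by apply: hpolyZ; have [] := hq' k.
  have Sy := MS My; rewrite -/(low y).
  rewrite (_ : low y = W t y - (W t y - (low y + high y)) - high y); last by ring.
  rewrite (le_trans (ler_normB _ _))// lerD ?high_le//.
  by rewrite (le_trans (ler_normB _ _))// lerD ?Wb// -splitE close.
rewrite (_ : W t x = (W t x - (low x + high x)) + low x + high x); last by ring.
rewrite (le_trans (ler_normD _ _))// (le_trans (lerD (ler_normD _ _) (high_le x Sx)))//.
have cl : `|W t x - (low x + high x)| <= eta by rewrite -splitE close.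
rewrite (le_trans (lerD (lerD cl low_le) (lexx _)))//.
rewrite -/r -/E (_ : eps = K * eta); last by rewrite /eta mulrCA divff ?mulr1// gt_eqF.
have h1 : E * (F + eta) <= AN * (E * (F + eta)).
  by rewrite ler_peMl// mulr_ge0// addr_ge0// ltW.
have h2 : AN * (E * eta) <= AN * eta.
  by apply: ler_wpM2l => //; rewrite ler_piMl// ltW.
rewrite /K; move: h1 h2; nra.
Qed.

End spectral_splitting.

(** * Observability *)

Section schedule.
Context (R : realType).

Definition remez_bound (q E N : nat) : R := ((q * N.+1) ^ (E * N.+1))%:R.

Lemma remez_bound_ge1 q E N : (0 < q)%N -> 1 <= remez_bound q E N.
Proof. by move=> q0; rewrite ler1n expn_gt0 muln_gt0 q0. Qed.

(** From q y <= z^2 and z <= e^z. With z of the order of the square root of y = N + 1 this replaces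
    N log N by N^(3/2), which still suffices and avoids logarithms. *)
Lemma remez_bound_le_exp q E y z : (0 < y)%N -> (q * y <= z ^ 2)%N ->
  remez_bound q E y.-1 <= expR ((2 * E * y * z)%:R).
Proof.
move=> y0 qy; rewrite /remez_bound prednK//.
have z1 : z%:R <= expR (z%:R : R).
  by rewrite (le_trans _ (expR_ge1Dx _))// lerDr.
apply: (@le_trans _ _ ((z ^ (2 * E * y))%:R)).
  rewrite ler_nat -[(2 * E * y)%N]mulnA [leqRHS]expnM; case: (E * y)%N => // k.
  by rewrite leq_exp2r.
rewrite natrX natrM [X in expR X]mulrC expRM_natr -[X in expR X]mulr1.
rewrite mulr1; apply: lerXn2r; rewrite ?nnegrE ?expR_ge0//.
Qed.

(* N_j + 1 = (L 2^j)^2 modes are observed on a time interval of length of order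
   2^-j. *)
Definition modes (L j : nat) : nat := ((L * 2 ^ j) ^ 2).-1.

Lemma schedule_modes (T lc : R) (q E : nat) : 0 < T -> (0 < q)%N ->
  exists L : nat, forall j (tau := T / 2 ^+ j.+2),
    lc <= (modes L j)%:R * (tau / 2) / 2 /\
    4 * remez_bound q E (modes L j.+1) <=
      expR ((modes L j)%:R ^+ 2 * (tau / 2) / 2).
Proof.
move=> T0 q0.
(* Up to constants both exponents grow like 2^(3j): N^(3/2) gives (L 2^j)^3 and N^2 times the
   duration gives L T (L 2^j)^3, so a large [L] wins for all j at once. The number 16 E q is 2 E q
   times 2^3 from passing to j + 1, the 2 comes from 4 <= e^2, and 64 and 32 are the denominators
   met below. *)
pose c : R := 64 * (2 + 16 * E%:R * q%:R) + 32 * `|lc|.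
have c0 : 0 <= c by rewrite /c addr_ge0 ?mulr_ge0// addr_ge0// !mulr_ge0.
(* [L >= 2] ensures that [modes L j] is at least half of (L 2^j)^2. *)
pose L := (Num.bound (c / T)).+2.
have LT : c <= L%:R * T.
  rewrite -ler_pdivrMr// ltW// (lt_le_trans (archi_boundP _))//.
    by rewrite divr_ge0// ltW.
  by rewrite ler_nat; exact: leq_trans (leqnSn _) (leqnSn _).
exists L => j tau.
have y0 i : (0 < (L * 2 ^ i) ^ 2)%N by rewrite expn_gt0 muln_gt0 expn_gt0.
have L2 : 2 <= L%:R :> R by rewrite ler_nat.
pose P : R := 2 ^+ j; have P1 : 1 <= P by rewrite exprn_ege1// ler1n.
have P0 : 0 < P by exact: lt_le_trans P1.
have tauE : tau / 2 / 2 = T / (16 * P).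
  by rewrite /tau /P !exprS; field; rewrite expf_neq0.
have LP2 : 2 <= L%:R * P.
  by rewrite -[2]mulr1 ler_pM.
have NE : (modes L j)%:R = (L%:R * P) ^+ 2 - 1.
  by rewrite /modes -subn1 natrB ?y0// natrX natrM natrX.
have N2 : (L%:R * P) ^+ 2 / 2 <= (modes L j)%:R.
  rewrite NE; move: LP2; move: (L%:R * P) => a; nra.
have e1 : (modes L j)%:R * (tau / 2) / 2 = (modes L j)%:R * (T / (16 * P)).
  by rewrite -mulrA tauE.
have e2 : (modes L j)%:R ^+ 2 * (tau / 2) / 2 = (modes L j)%:R ^+ 2 * (T / (16 * P)).
  by rewrite -mulrA tauE.
have l0 : 0 <= L%:R :> R by [].
have TP : 0 <= T / (16 * P) by rewrite divr_ge0 ?mulr_ge0// ltW.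
have cE : 0 <= 16 * E%:R * q%:R :> R by rewrite !mulr_ge0.
rewrite e1 e2; split.
  apply: (@le_trans _ _ ((L%:R * P) ^+ 2 / 2 * (T / (16 * P)))); last exact: ler_wpM2r.
  rewrite (_ : _ * _ = (L%:R * T) * (L%:R * P) / 32); last first.
    by field; rewrite gt_eqF.
  rewrite ler_pdivlMr//.
  have h1 : 32 * lc <= c.
    by rewrite /c ler_wpDl ?mulr_ge0 ?addr_ge0// ler_wpM2l// ler_norm.
  have h2 : c * 1 <= (L%:R * T) * (L%:R * P) by rewrite ler_pM//; lra.
  lra.
have rb : remez_bound q E (modes L j.+1) <=
    expR (16 * E%:R * q%:R * (L%:R * P) ^+ 3).
  apply: (le_trans (remez_bound_le_exp (z := (q * (L * 2 ^ j.+1))%N) E (y0 j.+1) _)).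
    by rewrite [leqRHS]expnMn leq_mul2r; apply/orP; right; rewrite -[leqLHS]expn1 leq_pexp2l.
  have P2 : 2 ^+ j.+1 = 2 * P by rewrite /P exprS.
  rewrite ler_expR !(natrM, natrX) P2 le_eqVlt; apply/orP; left; apply/eqP.
  by ring.
have four : 4 <= expR (2 : R).
  rewrite (_ : 2 = 1 + 1 :> R)// expRD; have := expR1_ge2 R => h.
  by rewrite (_ : 4 = 2 * 2 :> R) ?ler_pM//; ring.
apply: (le_trans (ler_pM _ _ four rb)) => //.
rewrite -expRD ler_expR.
apply: (@le_trans _ _ (((L%:R * P) ^+ 2 / 2) ^+ 2 * (T / (16 * P)))); last first.
  apply: ler_wpM2r => //; apply: lerXn2r => //; rewrite ?nnegrE//.
  by rewrite divr_ge0// sqr_ge0.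
rewrite (_ : _ ^+ 2 * _ = (L%:R * T) * (L%:R * P) ^+ 3 / 64); last first.
  by field; rewrite gt_eqF.
rewrite ler_pdivlMr//.
have LP3 : 1 <= (L%:R * P) ^+ 3 by rewrite exprn_ege1//; lra.
have h1 : 64 * (2 + 16 * E%:R * q%:R) <= c.
  by rewrite /c lerDl mulr_ge0.
have h2 : c * (L%:R * P) ^+ 3 <= L%:R * T * (L%:R * P) ^+ 3.
  by rewrite ler_wpM2r// (le_trans _ LP3).
have h3 : 64 * (2 + 16 * E%:R * q%:R) * (L%:R * P) ^+ 3 <= L%:R * T * (L%:R * P) ^+ 3.
  by apply: le_trans h2; rewrite ler_wpM2r// (le_trans _ LP3).
by move: h3 LP3; move: (_ ^+ 3) => a; lra.
Qed.

End schedule.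
Arguments remez_bound {R} q E N.

(** * The telescoping argument in time *)

Section observation.
Context (R : realType) (n : nat) (n2 : (2 <= n)%N) (M : set 'rV[R]_n).
Hypothesis MS : M `<=` usphere R n.
Hypothesis M0 : M !=set0.
Variables (W : R -> 'rV[R]_n -> R) (cW : caloric W).

Definition sphere_sup t : R := sup [set `|W t x| | x in usphere R n].
Definition observed t : \bar R := ereal_sup [set `|W t x|%:E | x in M].

Let S0 : usphere R n !=set0.
Proof. by have [x /MS Sx] := M0; exists x. Qed.

Lemma caloric_slice t y : 0 < t -> y != 0 -> {for y, continuous (W t)}.
Proof.
move=> t0 y0; have c := caloric_continuous cW t0 y0.
by apply: (@continuous2_cvg _ _ _ _ (nbhs y) _ (fun=> t) id W t y c);
  [exact: cvg_cst|exact: cvg_id].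
Qed.

Lemma caloric_time t y : 0 < t -> y != 0 -> {for t, continuous (W^~ y)}.
Proof.
move=> t0 y0; have c := caloric_continuous cW t0 y0.
by apply: (@continuous2_cvg _ _ _ _ (nbhs t) _ id (fun=> y) W t y c);
  [exact: cvg_id|exact: cvg_cst].
Qed.

Lemma le_sphere_sup t x : 0 < t -> usphere R n x -> `|W t x| <= sphere_sup t.
Proof.
move=> t0 Sx.
have c : {within usphere R n, continuous (fun x => `|W t x|)}.
  apply: continuous_in_subspaceT => y; rewrite inE => Sy.
  have h := caloric_slice t0 (usphere_neq0 Sy).
  exact: (cvg_norm h).
have := compact_has_sup (image_nonempty _ S0)
  (continuous_compact c (@compact_usphere R n)).
by move=> /sup_upper_bound; apply; exists x.
Qed.

Lemma sphere_sup_le t c : (forall x, usphere R n x -> `|W t x| <= c) -> sphere_sup t <= c.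
Proof.
move=> Wc; apply: sup_le_ub; first exact: image_nonempty S0.
by move=> _ [x Sx <-]; exact: Wc.
Qed.

Lemma sphere_sup_ge0 t : 0 < t -> 0 <= sphere_sup t.
Proof. by move=> t0; have [x Sx] := S0; rewrite (le_trans _ (le_sphere_sup t0 Sx)). Qed.

Lemma sphere_sup_nincr s t : 0 < s -> s <= t -> sphere_sup t <= sphere_sup s.
Proof.
move=> s0 st; apply: sphere_sup_le => x Sx.
by apply: (caloric_max_norm cW s0 _ st Sx) => y Sy; exact: le_sphere_sup.
Qed.

Lemma observed_ge0 t : (0 <= observed t)%E.
Proof.
have [x Mx] := M0; apply: (@le_trans _ _ `|W t x|%:E).
  by rewrite lee_fin.
by apply: ereal_sup_ubound; exists x.
Qed.

Lemma observed_fin t : 0 < t -> exists2 b : R, 0 <= b & observed t = b%:E /\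
  forall x, M x -> `|W t x| <= b.
Proof.
move=> t0; have := observed_ge0 t.
have : (observed t <= (sphere_sup t)%:E)%E.
  by apply: ge_ereal_sup => _ [x Mx <-]; rewrite lee_fin le_sphere_sup//; exact: MS.
case E : observed => [b| |]//= _ b0; exists b => //; split => // x Mx.
by rewrite -lee_fin -E; apply: ereal_sup_ubound; exists x.
Qed.

Lemma measurable_observed (a b : R) : 0 <= a -> measurable_fun `]a, b[ observed.
Proof.
(* For positive times a supremum of functions continuous in time is lower semicontinuous; the value
   -oo elsewhere keeps this on the whole line, where measurability follows. *)
move=> a0; pose g t := if 0 < t then observed t else -oo%E.
have mg : measurable_fun setT g.
  apply: lower_semicontinuous_measurable => t c; rewrite /g; case: ifPn => // t0.
  move=> /ereal_sup_gt[_ [x Mx <-]]; rewrite lte_fin => cx.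
  have ct := caloric_time t0 (usphere_neq0 (MS Mx)).
  exists ([set s | 0 < s] `&` [set s | c < `|W s x|]).
    apply: filterI; first exact: lt_nbhsr.
have h := cvg_norm ct _; exact: (cvgr_gt _ (h _) _ cx).
  move=> s [/= s0 sx]; rewrite s0; apply: (@lt_le_trans _ _ `|W s x|%:E) => //.
  by apply: ereal_sup_ubound; exists x.
apply: (@eq_measurable_fun _ _ _ _ _ g).
  by move=> t; rewrite inE/= in_itv/= => /andP[ta _]; rewrite /g (le_lt_trans a0 ta).
exact: measurable_funS mg.
Qed.

Variables (q E : nat) (q0 : (0 < q)%N) (T : R) (T0 : 0 < T).
Hypothesis rem : forall N (p : nat -> 'rV[R]_n -> R) (b : R),
  (forall k, hpoly k (p k)) -> 0 <= b ->
  (forall x, M x -> `|\sum_(k < N.+1) p k x| <= b) ->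
  forall x, usphere R n x -> `|\sum_(k < N.+1) p k x| <= remez_bound q E N * b.
Variable L : nat.
Let tau j : R := T / 2 ^+ j.+2.
Let A j : R := remez_bound q E (modes L j).
Hypothesis sched : forall j,
  ln (64 + 4 * n)%:R + 1 <= (modes L j)%:R * (tau j / 2) / 2 /\
  4 * A j.+1 <= expR ((modes L j)%:R ^+ 2 * (tau j / 2) / 2).

Let time j : R := T / 2 * (1 + (2 ^+ j)^-1).
(** Half the length of the j-th time interval, the half that is observed, divided by the Remez
    factor for that interval. *)
Let weight j : R := tau j / (2 * A j).

Let A1 j : 1 <= A j. Proof. exact: remez_bound_ge1. Qed.
Let tau0 j : 0 < tau j. Proof. by rewrite divr_gt0// exprn_gt0. Qed.
Let timeS j : time j = time j.+1 + tau j.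
Proof. by rewrite /time /tau !exprS; field; rewrite expf_neq0. Qed.
Let time_half j : T / 2 <= time j.
Proof. by rewrite /time ler_peMr ?divr_ge0 ?(ltW T0)// lerDl invr_ge0 exprn_ge0. Qed.
Let time_gt0 j : 0 < time j.
Proof. by rewrite (lt_le_trans _ (time_half j))// divr_gt0. Qed.
Let weight0 j : 0 < weight j.
Proof. by rewrite divr_gt0// mulr_gt0// (lt_le_trans ltr01). Qed.

(** Only the later half of the interval is used, so that the high modes have decayed during at least
    [tau j / 2]; the supremum at [time j] is then bounded by that at [t]. *)
Let one_step j t : time j.+1 + tau j / 2 < t -> t <= time j ->
  (((sphere_sup (time j) -
     2 * A j * expR (- ((modes L j)%:R ^+ 2 * (tau j / 2) / 2)) *
       sphere_sup (time j.+1)) / A j)%:E <= observed t)%E.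
Proof.
move=> t1 t2; have s0 := time_gt0 j.+1; have tj := tau0 j.
have st : time j.+1 < t by rewrite (lt_trans _ t1)// ltrDl divr_gt0.
have t0 : 0 < t by exact: lt_trans st.
have [b b0 [-> Wb]] := observed_fin t0.
have Aj0 : 0 < A j by exact: lt_le_trans (A1 j).
rewrite lee_fin ler_pdivrMr// lerBlDr [b * _]mulrC.
apply: (le_trans (sphere_sup_nincr t0 t2)); apply: sphere_sup_le => x Sx.
have [sch _] := sched j.
have ts : tau j / 2 <= t - time j.+1 by lra.
have F0 := sphere_sup_ge0 s0.
have := @observe_low_frequencies _ _ n2 _ MS _ _ (A1 j) (@rem (modes L j)) W
  (time j.+1) t _ b cW s0 st F0 b0 _ _ Wb x Sx.
move=> /(_ _ _)/le_trans; apply.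
- apply: (le_trans sch); rewrite ler_pM2r// ler_wpM2l//.
- by move=> y Sy; exact: le_sphere_sup.
rewrite lerD2l ler_wpM2r// ler_wpM2l ?mulr_ge0 ?(ltW Aj0)//.
by rewrite ler_expR lerN2 ler_pM2r// ler_wpM2l// sqr_ge0.
Qed.

Let mid j := time j.+1 + tau j / 2.

(** [one_step] integrated over the later half. The schedule is made for the coefficient [tau j * X]
    of the next supremum: it is at most [tau j / (4 * A j.+1)], which is exactly [weight j.+1], so
    the inequalities telescope. *)
Let integral_step j :
  ((weight j * sphere_sup (time j))%:E <=
   \int[lebesgue_measure]_(t in `]mid j, time j[) observed t +
   (weight j.+1 * sphere_sup (time j.+1))%:E)%E.
Proof.
pose X := expR (- ((modes L j)%:R ^+ 2 * (tau j / 2) / 2)).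
pose kap := (sphere_sup (time j) - 2 * A j * X * sphere_sup (time j.+1)) / A j.
have Aj0 : 0 < A j by exact: lt_le_trans (A1 j).
have AS0 : 0 < A j.+1 by exact: lt_le_trans (A1 j.+1).
have F0 := sphere_sup_ge0 (time_gt0 j.+1).
have mid0 : 0 <= mid j by rewrite addr_ge0 ?divr_ge0 ?(ltW (tau0 j))// ltW.
have int0 : (0 <= \int[lebesgue_measure]_(t in `]mid j, time j[) observed t)%E.
  by apply: integral_ge0 => t _; exact: observed_ge0.
have wX : weight j * (2 * A j * X) <= weight j.+1.
  have [_ sch] := sched j.
  have -> : weight j * (2 * A j * X) = tau j * X.
    by rewrite /weight; field; rewrite gt_eqF.
  have -> : weight j.+1 = tau j * (4 * A j.+1)^-1.
    rewrite /weight /tau exprS; field; rewrite expf_neq0//= gt_eqF//.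
  rewrite ler_pM2l// /X expRN lef_pV2 ?posrE ?expR_gt0// mulr_gt0//.
have wk : weight j * sphere_sup (time j) <=
    kap * (tau j / 2) + weight j.+1 * sphere_sup (time j.+1).
  rewrite -lerBlDr.
  have -> : kap * (tau j / 2) = weight j * sphere_sup (time j) -
      weight j * (2 * A j * X) * sphere_sup (time j.+1).
    by rewrite /kap /weight; field; rewrite gt_eqF.
  by rewrite lerD2l lerN2 ler_wpM2r.
(* A negative lower bound for the observation carries no information, but then the next term alone
   already dominates. *)
have [k0|k0] := leP 0 kap; last first.
  apply: (@le_trans _ _ (weight j.+1 * sphere_sup (time j.+1))%:E).
    rewrite lee_fin (le_trans wk)// gerDr.
    by rewrite mulr_le0_ge0 ?(ltW k0)// divr_ge0// ltW.
  by rewrite leeDr.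
apply: (@le_trans _ _ ((kap * (tau j / 2))%:E + (weight j.+1 * sphere_sup (time j.+1))%:E)%E).
  by rewrite -EFinD lee_fin.
rewrite leeD2r//.
have mI : measurable (`]mid j, time j[%classic : set R) by exact: measurable_itv.
have <- : (\int[lebesgue_measure]_(t in `]mid j, time j[) (cst kap%:E) t =
    (kap * (tau j / 2))%:E)%E.
  rewrite integral_cst//= lebesgue_measure_itv/= lte_fin.
  have -> : mid j < time j.
    by rewrite /mid [ltRHS]timeS ltrD2l ltr_pdivrMr// ltr_pMr// ltr1n.
  rewrite -EFinB -EFinM /mid [X in X - _]timeS; congr (_%:E).
  by field.
apply: ge0_le_integral => //.
- exact: measurable_observed.
- move=> t; rewrite /= in_itv/= => /andP[t1 t2].
  by apply: one_step => //; exact: ltW.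
Qed.

Let chain J : ((weight 0 * sphere_sup T)%:E <=
  \int[lebesgue_measure]_(t in `]time J, T[) observed t +
  (weight J * sphere_sup (time J))%:E)%E.
Proof.
have time0 : time 0 = T by rewrite /time expr0 invr1; field.
elim: J => [|J ih].
  rewrite time0 leeDr//; apply: integral_ge0 => t _; exact: observed_ge0.
apply: (le_trans ih); apply: (le_trans (leeD (lexx _) (integral_step J))).
rewrite addeA leeD2r//.
have timeT : time J <= T.
  by rewrite -time0 /time expr0 ler_pM2l ?divr_gt0// lerD2l invr1
    invf_le1 ?exprn_gt0// exprn_ege1// ler1n.
have tS : time J.+1 < mid J by rewrite /mid ltrDl divr_gt0.
have mt : mid J < time J.
  by rewrite /mid [ltRHS]timeS ltrD2l ltr_pdivrMr// ltr_pMr// ltr1n.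
have tJ0 := ltW (time_gt0 J.+1).
rewrite -ge0_integral_setU//.
- apply: ge0_subset_integral => //.
  + exact: measurableU.
  + exact: measurable_observed.
  + by move=> t _; exact: observed_ge0.
  + move=> t [] /=; rewrite !in_itv/= => /andP[t1 t2]; apply/andP; split.
    * by rewrite (lt_trans _ t1)// (lt_trans tS).
    * by [].
    * exact: lt_trans t1.
    * exact: lt_le_trans timeT.
- apply: (@measurable_funS _ _ _ _ `]time J.+1, T[%classic) => //.
    move=> t [] /=; rewrite !in_itv/= => /andP[t1 t2]; apply/andP; split.
    * by rewrite (lt_trans _ t1)// (lt_trans tS).
    * by [].
    * exact: lt_trans t1.
    * exact: lt_le_trans timeT.
  exact: measurable_observed.
- by move=> t _; exact: observed_ge0.
- rewrite disj_set2E; apply/eqP/seteqP; split => // t [] /=.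
  by rewrite !in_itv/= => /andP[t1 _] /andP[_ t2]; have := lt_trans t1 t2; rewrite ltxx.
Qed.

Lemma observability_sup :
  ((weight 0 * sphere_sup T)%:E <=
   \int[lebesgue_measure]_(t in `]0%R, T[) observed t)%E.
Proof.
apply/lee_addgt0Pr => eps eps0.
have T20 : 0 < T / 2 by rewrite divr_gt0.
have F0 := sphere_sup_ge0 T20.
have TF0 : 0 <= T * sphere_sup (T / 2) by rewrite mulr_ge0// ltW.
(* The remainder is at most T 2^(-J) times the supremum at T / 2, finite because the times stay
   above T / 2; 2^J > J makes it at most [eps]. *)
pose J := Num.bound (T * sphere_sup (T / 2) / eps).
apply: (le_trans (chain J)); apply: leeD.
  apply: ge0_subset_integral => //.
  - exact: measurable_observed.
  - by move=> t _; exact: observed_ge0.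
  - move=> t /=; rewrite !in_itv/= => /andP[t1 ->]; rewrite andbT.
    exact: lt_trans t1.
rewrite lee_fin.
have Fle : sphere_sup (time J) <= sphere_sup (T / 2) by exact: sphere_sup_nincr.
have p0 : 0 < 2 ^+ J :> R by rewrite exprn_gt0.
have wle : weight J <= T / 2 ^+ J.
  rewrite /weight (@le_trans _ _ (tau J))//.
    rewrite ler_pdivrMr ?mulr_gt0 ?(lt_le_trans _ (A1 J))// ler_peMr ?(ltW (tau0 J))//.
    by rewrite (le_trans (A1 J))// ler_peMl ?ler1n// (le_trans ler01).
  rewrite /tau ler_pM2l// lef_pV2 ?posrE ?exprn_gt0//.
  by rewrite ler_weXn2l ?ler1n//; lia.
apply: (le_trans (ler_pM (ltW (weight0 J)) (sphere_sup_ge0 (time_gt0 J)) wle Fle)).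
rewrite mulrAC ler_pdivrMr// -ler_pdivrMl// mulrC.
rewrite (le_trans (ltW (archi_boundP _)))//; first by rewrite divr_ge0// ltW.
by rewrite -natrX ler_nat ltnW// ltn_expl.
Qed.

End observation.

(** * Finite mass and support of the surface measure *)

Section sphere_mass.
Context (R : realType).

Definition cube n : set 'rV[R]_n := [set x | forall i, x ord0 i \in `[-1, 1]].
Arguments cube n : clear implicits.

Lemma lebesgue_cube_finite n :
  measurable (cube n) /\ (lebesgue_rV R n (cube n) < +oo)%E.
Proof.
elim: n => [|n [mc fc]].
  rewrite (_ : cube 0 = setT); last by apply/seteqP; split => // x _ [].
  by split; [exact: measurableT|rewrite /= diracT ltry].
have cubeE : cube n.+1 = @split_rV R n @^-1` ((`[-1, 1]%classic : set R) `*` cube n).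
  apply/seteqP; split => [x xc|x [/= x0 xc] i]; first by split => //= i; rewrite mxE.
  by case: (unliftP ord0 i) => [k ->|->//]; have := xc k; rewrite mxE.
have mI : measurable (`[-1, 1]%classic : set R) by exact: measurable_itv.
have mp : measurable ((`[-1, 1]%classic : set R) `*` cube n) by exact: measurableX.
split.
  by rewrite cubeE -[X in measurable X]setTI; apply: measurable_split_rV.
rewrite /= /lebesgue_succ /pushforward cubeE -comp_preimage.
rewrite (_ : _ \o _ = id) ?preimage_id; last first.
  by apply/funext => p /=; rewrite cons_rVK.
rewrite product_measure1E//; apply: lte_mul_pinfty => //.
by rewrite /= lebesgue_measure_itv/=; case: ifP.
Qed.

Lemma measurable_rV0 n : measurable [set (0 : 'rV[R]_n)].
Proof.
rewrite (_ : [set _] = setT `&` @enorm R n @^-1` [set 0]).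
  by apply: measurable_enorm => //; exact: measurable_set1.
rewrite setTI; apply/seteqP; split => x /= /eqP.
  by rewrite -enorm_eq0 => /eqP.
by rewrite enorm_eq0 => /eqP.
Qed.

(** The successor matters: in dimension 0 the measure is the point mass at 0. *)
Lemma lebesgue_rV0 n : lebesgue_rV R n.+1 [set 0] = 0%E.
Proof.
rewrite /= /lebesgue_succ /pushforward.
rewrite (_ : _ @^-1` _ = [set 0] `*` [set 0]); last first.
  apply/seteqP; split => [[t x] /=|[t x] [/= -> ->]].
    move=> /rowP e; split => /=; first by have := e ord0; rewrite !mxE unlift_none.
    by apply/rowP => k; have := e (lift ord0 k); rewrite !mxE liftK.
  by apply/rowP => k; rewrite !mxE; case: unliftP => //= j _; rewrite mxE.
rewrite product_measure1E//; last exact: measurable_rV0.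
by rewrite /= lebesgue_measure_set1 mul0e.
Qed.

Lemma sphere_measure_finite n : (sphere_measure R n setT < +oo)%E.
Proof.
have [mc fc] := lebesgue_cube_finite n.
rewrite /sphere_measure /mscale /= lte_mul_pinfty// ?lee_fin//.
rewrite /cone_measure /pushforward /mrestr preimage_setT setTI.
apply: le_lt_trans fc; apply: le_measure; rewrite ?inE//; first exact: measurable_ball1.
move=> x; rewrite /eball/= subr0 => x1 i; rewrite in_itv/= -ler_norml.
rewrite (le_trans _ (ltW x1))// -(@ler_pXn2r _ 2)// ?nnegrE ?enorm_ge0//.
rewrite real_normK ?num_real// enorm_sqr (bigD1 i)//= lerDl sumr_ge0// => k _.
exact: sqr_ge0.
Qed.

Lemma measurable_usphere n : measurable (usphere R n).
Proof.
rewrite (_ : usphere R n = setT `&` @enorm R n @^-1` [set 1]).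
  by apply: measurable_enorm => //; exact: measurable_set1.
by rewrite setTI.
Qed.

(** Normalisation sends everything except the origin into the sphere, and the origin is a null
    set. *)
Lemma sphere_measure_support n : sphere_measure R n.+1 (~` usphere R n.+1) = 0%E.
Proof.
have m0 : measurable (@normalize R n.+1 @^-1` (~` usphere R n.+1)).
  rewrite -[X in measurable X]setTI; apply: measurable_normalize => //.
  by apply: measurableC; exact: measurable_usphere.
have v0 : lebesgue_rV R n.+1
    (@normalize R n.+1 @^-1` (~` usphere R n.+1) `&` eball 0 1) = 0%E.
  apply: (@subset_measure0 _ _ _ (lebesgue_rV R n.+1) _ [set 0]).
  - by apply: measurableI => //; exact: measurable_ball1.
  - exact: measurable_rV0.
  - move=> y [/= yS _]; apply: contrapT => /eqP y0; apply: yS.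
    exact: normalize_usphere.
  - exact: lebesgue_rV0.
transitivity (n.+1%:R%:E * lebesgue_rV R n.+1
    (@normalize R n.+1 @^-1` (~` usphere R n.+1) `&` eball 0 1))%E; first by [].
by rewrite v0 mule0.
Qed.

(** The bound holds only on the sphere, hence almost everywhere; values off the sphere are
    arbitrary. *)
Lemma Lnorm_le_sup n (f : 'rV[R]_n.+1 -> R) (c : R) :
  f \in Lfun (sphere_measure R n.+1) 2%:E ->
  0 <= c -> (forall x, usphere R n.+1 x -> `|f x| <= c) ->
  ('N[sphere_measure R n.+1]_2%:E[EFin \o f] <=
   (Num.sqrt (fine (sphere_measure R n.+1 setT)) * c)%:E)%E.
Proof.
move=> /[!inE] /andP[mf _] c0 fc.
set mu := sphere_measure R n.+1.
have mf' : measurable_fun setT f by move: mf; rewrite inE.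
have mufin := sphere_measure_finite n.+1.
have mu0 : (0 <= mu setT)%E by exact: measure_ge0.
rewrite unlock /Lnorm.
have key : (\int[mu]_x (`|(EFin \o f) x| `^ 2) <= (c ^+ 2)%:E * mu setT)%E.
  rewrite -integral_cst//.
  apply: ae_ge0_le_integral => //.
  - by move=> x _; exact: poweR_ge0.
  - apply: (measurableT_comp (measurable_poweR _)).
    by apply: measurableT_comp => //; exact/measurable_EFinP.
  - by move=> x _; rewrite lee_fin sqr_ge0.
  exists (~` usphere R n.+1); split.
  - by apply: measurableC; exact: measurable_usphere.
  - exact: sphere_measure_support.
  - move=> x /= xc Sx; apply: xc => _.
    by rewrite /= powR_mulrn// lee_fin lerXn2r ?nnegrE// fc.
apply: (le_trans (gt0_ler_poweR _ _ _ key)); rewrite ?in_itv/= ?leey ?andbT//.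
- by apply: integral_ge0 => x _; exact: (@poweR_ge0 _ `|(f x)%:E| 2).
- by rewrite mule_ge0// lee_fin sqr_ge0.
have -> : mu setT = (fine (mu setT))%:E by rewrite fineK// ge0_fin_numE.
rewrite -EFinM /= powR12_sqrt ?mulr_ge0 ?sqr_ge0 ?fine_ge0//.
by rewrite sqrtrM ?sqr_ge0// sqrtr_sqr ger0_norm// mulrC lexx.
Qed.
End sphere_mass.

(** On an empty set the Remez inequality for the constant 1 would hold with observed bound 0, giving
    1 <= 0. *)
Lemma content_nonempty (R : realType) (d : nat) (delta : R) (M : set 'rV[R]_d.+2) :
  0 < delta < 1 -> M `<=` usphere R d.+2 ->
  (0 < hausdorff_content (d.+2%:R - 2 + delta) M)%E -> M !=set0.
Proof.
move=> hd MS Mc; have [q [E [_ rem]]] := remez hd MS Mc.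
apply/set0P; apply/eqP => M0.
pose p k : 'rV[R]_d.+2 -> R := if k is 0 then fun=> 1 else fun=> 0.
have hp k : hpoly k (p k) by case: k => [|k]; [exact: hpoly_cst|exact: hpoly0].
have S : usphere R d.+2 (stereo 1 (fun=> 0)) by apply: stereo_usphere; rewrite expr1n.
have := rem 0%N p 0 hp (lexx _) _ _ S; rewrite M0 big_ord1 mulr0 normr_le0 oner_eq0.
by move=> h; suff : false by []; apply: h => x [].
Qed.

Theorem theorem1p2 (R : realType) (n : nat) (delta : R) (M : set 'rV[R]_n)
    (hn : (2 <= n)%N) (hdelta : 0 < delta < 1)
    (M_closed : closed M) (M_sphere : M `<=` usphere R n)
    (M_content : (0 < hausdorff_content (n%:R - 2 + delta) M)%E)
    (T : R) (hT : 0 < T) :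
  exists2 Cobs : R, 0 < Cobs &
    forall (u0 : 'rV[R]_n -> R) (u : R -> 'rV[R]_n -> R),
      u0 \in Lfun (sphere_measure R n) 2%:E ->
      heat_flow u0 u ->
      ('N[sphere_measure R n]_2%:E[EFin \o u T] <=
       Cobs%:E * \int[lebesgue_measure]_(t in `]0%R, T[)
                   ereal_sup [set `|u t x|%:E | x in M])%E.
Proof.
case: n M hn M_closed M_sphere M_content => [|[|d]]// M n2 _ MS Mc.
have M0 := content_nonempty hdelta MS Mc.
have [q [E [q0 rem]]] := remez hdelta MS Mc.
have [L sched] := schedule_modes (ln (64 + 4 * d.+2)%:R + 1) E hT q0.
pose w : R := T / 2 ^+ 2 / (2 * remez_bound q E (modes L 0)).
have w0 : 0 < w.
  rewrite divr_gt0 ?divr_gt0 ?exprn_gt0// mulr_gt0//.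
  exact: lt_le_trans (remez_bound_ge1 R E (modes L 0) q0).
pose c : R := Num.sqrt (fine (sphere_measure R d.+2 setT)).
have c0 : 0 <= c by exact: sqrtr_ge0.
(* [c] is the square root of the total mass, which converts the supremum into the L^2 norm; [c + 1]
   in place of [c] makes the constant visibly positive. *)
exists ((c + 1) / w); first by rewrite divr_gt0// ltr_wpDl.
move=> u0 u _ hu; have cW := heat_flow_caloric hu.
have [uL _ _ _] := hu.
have obs := observability_sup n2 MS M0 cW q0 hT rem sched.
set W := (fun t => _) in cW obs.
set I := (\int[_]_(t in _) _)%E in obs.
(* The observability estimate concerns the extension of the flow along rays, which agrees with [u]
   on [M] because [M] lies in the sphere. *)
have IE : (\int[lebesgue_measure]_(t in `]0%R, T[)
    ereal_sup [set `|u t x|%:E | x in M] = I)%E.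
  apply: eq_integral => t _; congr ereal_sup; apply/seteqP; split=> _ [x Mx <-]; exists x => //;
    by rewrite /W /= normalize_id//; exact: MS.
rewrite IE; set F := sphere_sup W T in obs.
have F0 : 0 <= F by exact: (sphere_sup_ge0 MS M0 cW hT).
have uF x : usphere R d.+2 x -> `|u T x| <= F.
  move=> Sx; rewrite (_ : u T x = W T x); first exact: (le_sphere_sup MS M0 cW hT).
  by rewrite /W/= normalize_id.
apply: (le_trans (Lnorm_le_sup (uL _ hT) F0 uF)); rewrite -/c.
apply: (@le_trans _ _ (((c + 1) / w)%:E * (w * F)%:E)%E).
  rewrite -EFinM lee_fin mulrA divfK ?gt_eqF// ler_wpM2r// lerDl//.
apply: lee_wpmul2l; last exact: obs.
by rewrite lee_fin divr_ge0 ?ltW// ltr_wpDl.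
Qed.
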